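(* Consider the asymptotic setting of the context ($p=p(n)\to\infty$; all quantities implicitly indexed by $n$ except universal constants). Let $X\in\mathbb R^{n\times p}$ have i.i.d. rows drawn from $N_p(0,\Sigma^* )$, which is perfectly Markovian with respect to the DAG $G^*$. Suppose the following. (1) There exist $\underline\nu=\underline\nu(n)>0$, $\overline\nu=\overline\nu(n)>0$ and a universal constant $\delta_0\in(0,1)$ such that $0<\frac{\underline\nu}{(1-\delta_0)^2}\le\lambda_{\min}(\Sigma^* )\le\lambda_{\max}(\Sigma^* )\le\frac{\overline\nu}{(1+\delta_0)^2}$. (2) $d_{\mathrm{in}}\log p=o(n)$. (3) $\kappa\le n$, $1\le c_1\sqrt{1+\alpha/\gamma}\le p$, and $c_2\ge(\alpha+1)(4d_{\mathrm{in}}+6)+t$ for some universal constant $t>0$. (4) With $\nu_0=4\overline\nu^2\underline\nu^{-4}(\overline\nu-\underline\nu)^2$, for every $\sigma\in\mathbb S^p$, $(\nu_0+1)\max_{j\in[p]}|\mathrm{Pa}_j(G^*_\sigma)|\le d_{\mathrm{in}}$. (5) There exists a universal constant $C_\beta>0$ such that for every $\sigma\in\mathbb S^p$, $$\min\{|(B^*_\sigma)_{ij}|^2\colon(B^*_\sigma)_{ij}\ne0\}\ge5(C_\beta+4c_2)\frac{\overline\nu^2\log p}{\alpha\,\underline\nu^2\,n}.$$ Assume $C_\beta\ge8t/3$. Then for sufficiently large $n$, with probability at least $1-3p^{-1}$, the following statements hold. (i) $\min\{\psi_j(g_j^\sigma(S))-\psi_j(S)\colon\sigma\in\mathbb S^p,\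 j\in[p],\ S\in\mathcal M_p^\sigma(j,d_{\mathrm{in}})\setminus\{S^*_{\sigma,j}\}\}\ge t\log p$, where $S^*_{\sigma,j}=\mathrm{Pa}_j(G^*_\sigma)$. (ii) If $t>2$, then $$\min_{\sigma\in\mathbb S^p}\min_{j\in[p]}\frac{\exp(\psi_j(S^*_{\sigma,j}))}{\sum_{S\in\mathcal M_p^\sigma(j,d_{\mathrm{in}})}\exp(\psi_j(S))}\ge1-p^{-(t-2)}.$$ (iii) If $t>3$, then $$\min_{\sigma\in\mathbb S^p}\frac{\exp(\psi(G^*_\sigma))}{\sum_{G\in\mathcal G_p^\sigma(d_{\mathrm{in}},d_{\mathrm{out}})}\exp(\psi(G))}\ge1-p^{-(t-3)}.$$
   Context: Setting: $p=p(n)\to\infty$ as $n\to\infty$; $G^*$, $\Sigma^*$ (positive definite) and the parameters $c_1>0$, $c_2\ge0$, $\alpha\in(0,1)$, $\gamma>0$, $\kappa\ge0$, $d_{\mathrm{in}},d_{\mathrm{out}}\in[p]$ are implicitly indexed by $n$. A constant is universal if it does not depend on $n$. $\lambda_{\min},\lambda_{\max}$ denote extreme eigenvalues. DAGs have vertex set $[p]=\{1,\dots,p\}$; $\mathbb S^p$ is the set of permutations of $[p]$; $\mathrm{Pa}_j(G),\mathrm{Ch}_j(G)$ are the parents and children of $j$ in $G$; $|G|$ is the number of edges. A distribution is perfectly Markovian w.r.t. $G$ if its conditional independence relations are exactly those encoded by $G$ (d-separation). $\mathcal G_p^\sigma$ is the set of DAGs with topological ordering $\sigma$ (i.e. $\sigma(j)\to\sigma(i)\notin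 G$ for $i<j$); $\mathcal G_p^\sigma(d_{\mathrm{in}},d_{\mathrm{out}})$ consists of those $G\in\mathcal G_p^\sigma$ with $\max_j|\mathrm{Pa}_j(G)|\le d_{\mathrm{in}}$, $\max_j|\mathrm{Ch}_j(G)|\le d_{\mathrm{out}}$. $\mathcal A_p^\sigma(j)=\{k\colon\sigma^{-1}(k)<\sigma^{-1}(j)\}$ and $\mathcal M_p^\sigma(j,d_{\mathrm{in}})=\{S\subseteq\mathcal A_p^\sigma(j)\colon|S|\le d_{\mathrm{in}}\}$. For each $\sigma$, $(B^*_\sigma,\Omega^*_\sigma)$ is the unique pair with $\Omega^*_\sigma$ diagonal with positive diagonal, $(B^*_\sigma)_{ij}=0$ whenever $\sigma^{-1}(i)\ge\sigma^{-1}(j)$, and $(I-(B^*_\sigma)^\top)^{-1}\Omega^*_\sigma(I-B^*_\sigma)^{-1}=\Sigma^*$. $G^*_\sigma$ is the DAG with $i\to j\in G^*_\sigma$ iff $(B^*_\sigma)_{ij}\ne0$ (the minimal I-map of $G^*$ with ordering $\sigma$). Scores: $X_j$ is the $j$-th column of $X$, $X_S$ the submatrix of columns indexed by $S$, $\Phi_S=X_S(X_S^\top X_S)^{-1}X_S^\top$ ($\Phi_\emptyset=0$). Define $$e^{\psi_j(S)}=(c_1p^{c_2})^{-|S|}(1+\alpha\gamma^{-1})^{-|S|/2}\{X_j^\top(I-\Phi_S)X_j\}^{-(\alpha n+\kappa)/2},\qquad\psi(G)=\sum_{j=1}^p\psi_j(\mathrm{Pa}_j(G)).$$ Operators $g_j^\sigma$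 on $\mathcal M_p^\sigma(j,d_{\mathrm{in}})$: with $T=S^*_{\sigma,j}\setminus S$, $R=S\setminus S^*_{\sigma,j}$: (i) if $S=S^*_{\sigma,j}$, $g_j^\sigma(S)=S$; (ii) if $S^*_{\sigma,j}\subsetneq S$, $g_j^\sigma(S)=S\setminus\{\tilde\ell\}$, $\tilde\ell=\arg\max_{\ell\in R}\psi_j(S\setminus\{\ell\})$; (iii) if $S^*_{\sigma,j}\not\subseteq S$, $|S|<d_{\mathrm{in}}$, $g_j^\sigma(S)=S\cup\{\tilde k\}$, $\tilde k=\arg\max_{k\in T}\psi_j(S\cup\{k\})$; (iv) if $S^*_{\sigma,j}\not\subseteq S$, $|S|=d_{\mathrm{in}}$, $g_j^\sigma(S)=(S\cup\{\tilde k\})\setminus\{\tilde\ell\}$, $(\tilde k,\tilde\ell)=\arg\max_{(k,\ell)\in T\times R}\psi_j((S\cup\{k\})\setminus\{\ell\})$. *)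

(* Defs.v *)
From HB Require Import structures.
From mathcomp Require Import all_boot all_order all_fingroup all_algebra.
From mathcomp Require Import all_classical all_reals all_analysis.

Set Implicit Arguments.
Unset Strict Implicit.
Unset Printing Implicit Defensive.
Import Order.TTheory GRing.Theory Num.Theory.
Import numFieldNormedType.Exports.

Local Open Scope classical_set_scope.
Local Open Scope ring_scope.

(* A digraph on the vertex set 'I_p is its set of edges; (i, j) is i -> j. *)
Notation digraph p := {set 'I_p * 'I_p}.

Section Graphs.
Context {p : nat}.
Implicit Types (G : digraph p) (A B C S : {set 'I_p}) (s : 'S_p).

Definition parents G (j : 'I_p) : {set 'I_p} := [set i | (i, j) \in G]%SET.
Definition children G (i : 'I_p) : {set 'I_p} := [set j | (i, j) \in G]%SET.

Definition edge G : rel 'I_p := fun i j => (i, j) \in G.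

(* [connect] is reflexive, so loops are excluded as well. *)
Definition acyclic G : bool :=
  [forall i, forall j, edge G i j ==> ~~ connect (edge G) j i].

Definition dags_ordered s : {set digraph p} :=
  [set G | acyclic G &
     [forall i : 'I_p, forall j : 'I_p, (i < j)%N ==> ((s j, s i) \notin G)]]%SET.

Definition sparse_dags s (din dout : nat) : {set digraph p} :=
  [set G in dags_ordered s |
     (\max_(j < p) #|parents G j| <= din)%N &&
     (\max_(j < p) #|children G j| <= dout)%N]%SET.

Definition predecessors s (j : 'I_p) : {set 'I_p} :=
  [set k | (s^-1%g k < s^-1%g j)%N]%SET.

Definition models s (j : 'I_p) (din : nat) : {set {set 'I_p}} :=
  [set S : {set 'I_p} | (S \subset predecessors s j) && (#|S| <= din)%N]%SET.

(* The trail q (a sequence of vertices) is blocked by C at its interior vertex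
   v, whose neighbours on the trail are u and w. *)
Definition blocked_at G C (u v w : 'I_p) : Prop :=
  if edge G u v && edge G w v
  then forall c, c \in C -> ~~ connect (edge G) v c
  else v \in C.

Definition blocked G C (q : seq 'I_p) : Prop :=
  exists q1 q2 u v w, q = q1 ++ [:: u, v, w & q2] /\ blocked_at G C u v w.

Definition d_separated G A B C : Prop :=
  forall a b (q : seq 'I_p), a \in A -> b \in B -> last a q = b ->
    uniq (a :: q) -> path (fun i j => edge G i j || edge G j i) a q ->
    blocked G C (a :: q).

End Graphs.

Section Probability.
Context {R : realType}.

Definition mutually_independent d (T : measurableType d) (P : probability T R)
    d' (U : measurableType d') (m : nat) (Y : 'I_m -> T -> U) : Prop :=
  forall A : 'I_m -> set U, (forall i, measurable (A i)) ->
    P (\bigcap_i (Y i @^-1` A i)) = (\prod_(i < m) P (Y i @^-1` A i))%E.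

Definition iid d (T : measurableType d) (P : probability T R)
    d' (U : measurableType d') (m : nat) (Y : 'I_m -> T -> U)
    (mu : set U -> \bar R) : Prop :=
  [/\ forall i, measurable_fun setT (Y i),
      forall i A, measurable A -> P (Y i @^-1` A) = mu A
    & mutually_independent P Y].

Definition positive_definite (p : nat) (Sigma : 'M[R]_p) : Prop :=
  Sigma^T = Sigma /\
  forall v : 'rV[R]_p, v != 0 -> 0 < (v *m Sigma *m v^T) 0 0.

(* A symmetric matrix of positive size has a finite nonempty set of eigenvalues,
   so this inf and this sup are attained. *)
Definition lambda_min (p : nat) (Sigma : 'M[R]_p) : R :=
  inf [set a | eigenvalue Sigma a].
Definition lambda_max (p : nat) (Sigma : 'M[R]_p) : R :=
  sup [set a | eigenvalue Sigma a].

(* mu = N_p(0, Sigma), for Sigma positive definite: the law of A Z with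
   A A^T = Sigma and Z a vector of p independent standard normal variables.
   As A is invertible, Z may be realised on the sample space of mu itself,
   with A Z the identity map. *)
Definition centered_gaussian (p : nat) (Sigma : 'M[R]_p)
    (mu : probability (p.-tuple R) R) : Prop :=
  exists (A : 'M[R]_p) (Z : 'I_p -> p.-tuple R -> R),
    [/\ A *m A^T = Sigma,
        iid mu Z (normal_prob 0 1)
      & forall x j, tnth x j = \sum_(k < p) A j k * Z k x].

(* The sigma-algebra generated by the coordinates indexed by C. *)
Definition coord_events (p : nat) (C : {set 'I_p}) : set_system (p.-tuple R) :=
  <<s \bigcup_(j in [set` C])
        preimage_set_system setT (fun x : p.-tuple R => tnth x j) measurable >>.

(* f is a version of the conditional probability of E given the
   sub-sigma-algebra F. *)
Definition cond_prob d (T : measurableType d) (mu : probability T R)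
    (F : set_system T) (E : set T) (f : T -> R) : Prop :=
  [/\ forall B : set R, measurable B -> F (f @^-1` B),
      mu.-integrable setT (EFin \o f)
    & forall D, F D -> (\int[mu]_(x in D) (f x)%:E)%E = mu (E `&` D)].

Definition cond_indep (p : nat) (mu : probability (p.-tuple R) R)
    (A B C : {set 'I_p}) : Prop :=
  forall E F, coord_events A E -> coord_events B F ->
    exists f g, [/\ cond_prob mu (coord_events C) E f,
                    cond_prob mu (coord_events C) F g
                  & cond_prob mu (coord_events C) (E `&` F) (f \* g)].

Definition perfectly_markovian (p : nat) (mu : probability (p.-tuple R) R)
    (G : digraph p) : Prop :=
  forall A B C : {set 'I_p},
    (A :&: B = finset.set0)%SET -> (A :&: C = finset.set0)%SET -> (B :&: C = finset.set0)%SET ->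
    (cond_indep mu A B C <-> d_separated G A B C).

Definition row_tuple (T : Type) (n p : nat) (X : T -> 'M[R]_(n, p))
    (i : 'I_n) : T -> p.-tuple R :=
  fun w => [tuple X w i j | j < p].

End Probability.

Section Model.
Context {R : realType} {p : nat}.

(* (B, Omega) is the structural equation decomposition of Sigma along s. *)
Definition sem_decomposition (Sigma : 'M[R]_p) (s : 'S_p)
    (B Omega : 'M[R]_p) : Prop :=
  [/\ is_diag_mx Omega,
      forall j, 0 < Omega j j,
      forall i j, (s^-1%g j <= s^-1%g i)%N -> B i j = 0
    & invmx (1%:M - B^T) *m Omega *m invmx (1%:M - B) = Sigma].

Definition support_graph (B : 'M[R]_p) : digraph p :=
  [set e | B e.1 e.2 != 0]%SET.

End Model.

Section Score.
Context {R : realType} {n p : nat}.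
Variables (c1 c2 alpha gamma kappa : R) (X : 'M[R]_(n, p)).

Definition cols (S : {set 'I_p}) : 'M[R]_(n, #|S|) :=
  colsub (fun k : 'I_#|S| => enum_val k) X.

Definition proj_cols (S : {set 'I_p}) : 'M[R]_n :=
  cols S *m invmx ((cols S)^T *m cols S) *m (cols S)^T.

Definition rss (j : 'I_p) (S : {set 'I_p}) : R :=
  ((col j X)^T *m (1%:M - proj_cols S) *m col j X) 0 0.

Definition exp_node_score (j : 'I_p) (S : {set 'I_p}) : R :=
  (c1 * p%:R `^ c2) ^- #|S|
  * (1 + alpha * gamma^-1) `^ (- (#|S|%:R / 2))
  * rss j S `^ (- ((alpha * n%:R + kappa) / 2)).

(* Meaningful when [rss j S] is positive, which is the case almost surely when
   #|S| < n; [ln] is junk at 0. *)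
Definition node_score (j : 'I_p) (S : {set 'I_p}) : R :=
  ln (exp_node_score j S).

Definition graph_score (G : digraph p) : R :=
  \sum_(j < p) node_score j (parents G j).

End Score.

Section Operator.
Context {R : realType} {p : nat}.

(* The operator g_j^sigma for the local score psi = psi_j, with
   Sstar = S^*_{sigma,j}. The index j only serves as the default value of
   [arg max] when its range is empty. *)
Definition greedy_step (din : nat) (psi : {set 'I_p} -> R) (j : 'I_p)
    (Sstar S : {set 'I_p}) : {set 'I_p} :=
  let T := (Sstar :\: S)%SET in
  let Q := (S :\: Sstar)%SET in
  if S == Sstar then S
  else if Sstar \subset S then
    (S :\ [arg max_(l > j in Q) psi (S :\ l)%SET]%O)%SET
  else if (#|S| < din)%N then
    ([arg max_(k > j in T) psi (k |: S)%SET]%O |: S)%SET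
  else
    let kl := [arg max_(e > (j, j) | (e.1 \in T) && (e.2 \in Q))
                 psi ((e.1 |: S) :\ e.2)%SET]%O in
    ((kl.1 |: S) :\ kl.2)%SET.

End Operator.

(* Main.v *)
(* On an event of probability at least 1 - 3/p, the Gram matrix of X is close to
   n Sigma on all vectors with at most 2 din + 1 nonzero entries, and every population
   residual e_j - beta, beta supported in S, is almost orthogonal for the Gram matrix
   to all vectors supported in S, with a squared correlation of order |S| (log p) / n.
   Both follow from chi-square tail bounds, a grid in the coefficients of each sparse
   subspace and a union bound; by polarization no conditioning on X_S is needed.

   On this event everything is deterministic.  Residual sums of squares are distances
   to coordinate subspaces: deleting a superfluous parent increases them by a noise
   term of order din log p, which the penalty c2 outweighs, while a missing set T of
   parents makes some single addition, or some exchange when S is full, decrease them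
   by a multiple of |beta_T|^2 / |T|, which dominates the penalty by the condition on
   the coefficients.  So each greedy step multiplies the posterior weight by at least p^t.

   A model has at most p^2 preimages under the greedy step, so the weight of all models
   other than S^* is at most p^(2 - t) times the total weight.  The last claim follows
   by multiplying over the p vertices, the sum over graphs being at most the product
   of the sums over parent sets. *)

Require Import Defs.
From HB Require Import structures.
From mathcomp Require Import all_boot all_order all_fingroup all_algebra.
From mathcomp Require Import all_classical all_reals all_analysis.
From mathcomp Require Import measurable_realfun.
From mathcomp Require sesquilinear spectral complex.
From mathcomp Require Import zify ring lra.
Set Implicit Arguments.
Unset Strict Implicit.
Unset Printing Implicit Defensive.
Import Order.TTheory GRing.Theory Num.Theory.
Import numFieldNormedType.Exports.
Local Open Scope classical_set_scope.
Local Open Scope ring_scope.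

(** * Independence and Gaussian moments *)

(** Two obstacles shape the proof. The claims range over all p! orderings, too many for a union
    bound. But the structural residual of j along an ordering is Sigma-orthogonal to all
    predecessors, so it is also the population residual of j on every set between its parents and
    its predecessors. The correlation event is therefore indexed by a vertex and a set of size at
    most k, at a cost of p * p^k, and orderings enter only deterministically. Moreover the bound on
    c2 leaves little room: a deletion may raise the residual sum of squares by a relative (8 d + 12)
    log p / n only. Hence a chi-square exponent 9/40, close to the limiting 1/4, and two grids.
    Norms need a fixed relative accuracy, and since d log p = o(n) they can pay p^2 grid points per
    coordinate. Correlations live at the scale log p / n and can pay only about sqrt p points; this
    suffices because a linear form is nearly maximal at some grid point, with a multiplicative loss.
    Deletions use k = d; additions and exchanges use k = 2 d, since they involve both S and S^*. The
    factor nu_0 pays for exchanges: Euclidean-orthogonal unit vectors have a Gram product of at most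
    n (nh - nl) / 2. *)

Section Integration.
Context {R : realType} {d : measure_display} {T : measurableType d}
  (mu : {measure set T -> \bar R})
  {d' : measure_display} {U : measurableType d'}
  (nu : {measure set U -> \bar R}).
Local Open Scope ereal_scope.
Import HBNNSimple.

(** Simple functions and monotone convergence extend the identity from indicators. It serves twice:
    with [g] a product of the other independent factors, and with [Y] the identity and [g] a
    density. *)
Lemma integral_factor_ext (Y : T -> U) (g : T -> R) (C : \bar R) :
  measurable_fun setT Y -> measurable_fun setT g -> (forall x, 0 <= g x)%R ->
  0 <= C -> C \is a fin_num ->
  (forall A, measurable A ->
    \int[mu]_x (\1_A (Y x) * g x)%:E = nu A * C) ->
  forall f : U -> R, measurable_fun setT f -> (forall u, 0 <= f u)%R ->
  \int[mu]_x (f (Y x) * g x)%:E = \int[nu]_u (f u)%:E * C.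
Proof.
move=> mY mg g0 C0 Cfin H f mf f0.
have mfE : measurable_fun setT (EFin \o f) by exact/measurable_EFinP.
pose h := nnsfun_approx measurableT mfE.
have hcvg u : (h n u)%:E @[n --> \oo] --> (f u)%:E.
  by apply: (cvg_nnsfun_approx measurableT mfE) => // x _; rewrite lee_fin.
have hnd u : {homo (fun n => h n u) : a b / (a <= b)%N >-> (a <= b)%R}.
  by move=> a b ab; exact/lefP/nd_nnsfun_approx.
have mhY n : measurable_fun setT (fun x => h n (Y x)).
  exact: measurableT_comp.
have simple n : \int[mu]_x (h n (Y x) * g x)%:E = \int[nu]_u (h n u)%:E * C.
  have mI r : measurable_fun setT (fun x => \1_(h n @^-1` [set r]) (Y x) : R).
    by apply: measurableT_comp => //; apply: measurable_indic.
  transitivity (\int[mu]_x \sum_(r \in range (h n))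
      (r * (\1_(h n @^-1` [set r]) (Y x) * g x))%:E).
    apply: eq_integral => x _; rewrite fsumEFin//; congr EFin.
    rewrite [in LHS](fimfunE (h n)) mulr_fsuml.
    by apply: eq_fsbigr => r _; rewrite mulrA.
  transitivity (\int[nu]_u (\sum_(r \in range (h n))
      (r * \1_(h n @^-1` [set r]) u)%:E) * C); last first.
    congr (_ * _); apply: eq_integral => x _; rewrite fsumEFin//; congr EFin.
    by rewrite [in RHS](fimfunE (h n)).
  have r0 r u : (0 <= r * \1_(h n @^-1` [set r]) u)%R.
    rewrite indicE; case: (boolP (u \in _)); rewrite ?mulr0 ?mulr1//.
    by rewrite inE /= => <-.
  rewrite ge0_integral_fsum//; last 2 first.
  - move=> r; apply/measurable_EFinP/measurable_funM => //.
    exact: measurable_funM.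
  - by move=> r x _; rewrite lee_fin mulrA mulr_ge0.
  rewrite ge0_integral_fsum//; last 2 first.
  - move=> r; apply/measurable_EFinP/measurable_funM => //.
  - by move=> r x _; rewrite lee_fin.
  rewrite ge0_mule_fsuml; last first.
    by move=> r; apply: integral_ge0 => x _; rewrite lee_fin.
  apply: eq_fsbigr => r; rewrite inE => -[u _ <-].
  have hu0 : (0 <= h n u)%R by [].
  set A := h n @^-1` [set h n u].
  have mIA : measurable_fun setT (fun x => \1_A (Y x) : R) by exact: mI.
  have mA : measurable A by rewrite /A.
  have E2 : \int[nu]_v (h n u * \1_A v)%:E = (h n u)%:E * nu A.
    under eq_integral do rewrite EFinM.
    rewrite ge0_integralZl_EFin//.
      by rewrite -[X in nu X]setIT -integral_indic.
    by apply/measurable_EFinP; exact: measurable_indic.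
  rewrite [X in _ = X * C]E2.
  under eq_integral do rewrite EFinM.
  rewrite ge0_integralZl_EFin//; last 2 first.
  - by move=> x _; rewrite lee_fin mulr_ge0// indicE.
  - by apply/measurable_EFinP/measurable_funM.
  by rewrite H ?muleA//; rewrite /A.
have L1 : \int[mu]_x (h n (Y x) * g x)%:E @[n --> \oo] -->
          \int[mu]_x (f (Y x) * g x)%:E.
  rewrite (_ : (fun x => _) = (fun x => limn (fun n => (h n (Y x) * g x)%:E))); last first.
    apply/funext => x; apply/esym/cvg_lim => //.
    under eq_fun do rewrite EFinM.
    by rewrite EFinM; apply: cvgeZr => //.
  apply: cvg_monotone_convergence => //.
  - by move=> n; apply/measurable_EFinP/measurable_funM.
  - by move=> n x _; rewrite lee_fin mulr_ge0.
  - by move=> x _ a b ab; rewrite lee_fin ler_wpM2r ?hnd.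
have L2 : \int[nu]_u (h n u)%:E * C @[n --> \oo] -->
          \int[nu]_u (f u)%:E * C.
  apply: cvgeZr => //.
  rewrite (_ : (fun x => (f x)%:E) = (fun x => limn (fun n => (h n x)%:E))); last first.
    by apply/funext => x; apply/esym/cvg_lim.
  apply: cvg_monotone_convergence => //.
  - by move=> n; apply/measurable_EFinP.
  - by move=> n x _; rewrite lee_fin.
  - by move=> x _ a b ab; rewrite lee_fin hnd.
move: L1; under eq_fun do rewrite simple; move=> L1.
exact: (cvg_unique _ L1 L2).
Qed.

End Integration.

Section Independence.
Context {R : realType} {d : measure_display} {T : measurableType d}
  (P : probability T R) {d' : measure_display} {U : measurableType d'}
  (nu : probability U R).
Local Open Scope ereal_scope.

Lemma integral_prod_iid m (Y : 'I_m -> T -> U) (f : 'I_m -> U -> R) :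
  iid P Y nu ->
  (forall i, measurable_fun setT (f i)) -> (forall i u, (0 <= f i u)%R) ->
  (forall i, \int[nu]_u (f i u)%:E < +oo) ->
  \int[P]_x (\prod_(i < m) f i (Y i x))%:E = \prod_(i < m) \int[nu]_u (f i u)%:E.
Proof.
move=> [mY lawY indepY].
have mI A i : measurable A -> measurable (Y i @^-1` A).
  by move=> mA; rewrite -[X in measurable X]setTI; exact: mY.
(* Only the factors of index below [k] may differ from indicators. At [k = 0] the claim is
   independence itself; each further step frees one factor by [integral_factor_ext]. *)
suff H k : forall f : 'I_m -> U -> R, (forall i, measurable_fun setT (f i)) ->
    (forall i u, (0 <= f i u)%R) -> (forall i, \int[nu]_u (f i u)%:E < +oo) ->
    (forall i : 'I_m, (k <= i)%N -> exists2 A, measurable A & f i = \1_A) ->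
    \int[P]_x (\prod_(i < m) f i (Y i x))%:E = \prod_(i < m) \int[nu]_u (f i u)%:E.
  by move=> mf f0 foo; apply: (H m) => // i; rewrite leqNgt ltn_ord.
elim: k => [|k IH] {}f mf f0 foo find.
  have [A HA] : exists A : 'I_m -> set U, forall i, measurable (A i) /\ f i = \1_(A i).
    have H (i : 'I_m) : exists A : set U, measurable A /\ f i = \1_A.
      by have [A mA fA] := find i isT; exists A.
    by have [A HA] := boolp.choice H; exists A.
  transitivity (P (\bigcap_i (Y i @^-1` A i))).
    rewrite -[X in P X]setIT -integral_indic//; last first.
      apply: fin_bigcap_measurable => // i _; apply: mI.
      by case: (HA i).
    apply: eq_integral => x _; congr EFin.
    rewrite indicE; case: (boolP (x \in _)) => [|].
      rewrite inE => xA; rewrite big1// => i _.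
      by rewrite (HA i).2 indicE mem_set//; apply: xA.
    rewrite notin_setE => xA.
    have [i xi] : exists i, ~ A i (Y i x).
      by apply/not_existsP => H; apply: xA => i _; apply: contrapT; exact: H.
    by rewrite (bigD1 i)//= (HA i).2 indicE memNset// mul0r.
  rewrite indepY; last by move=> i; case: (HA i).
  apply: eq_bigr => i _; have [mA ->] := HA i.
  by rewrite integral_indic// setIT; exact: lawY.
have [mk|km] := leqP m k.
  by apply: IH => // i ki; move: (leq_trans mk ki); rewrite leqNgt ltn_ord.
pose k' := Ordinal km.
have int0 i : 0 <= \int[nu]_u (f i u)%:E.
  by apply: integral_ge0 => x _; rewrite lee_fin.
have mfY i : measurable_fun setT (fun x => f i (Y i x)) by exact: measurableT_comp.
rewrite (bigD1 k')//=; under eq_integral do rewrite (bigD1 k')//=.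
apply: (integral_factor_ext (nu := nu) (Y := Y k')) => //.
- rewrite (_ : (fun x => _) = fun x =>
      (\prod_(i < m) (if i != k' then f i (Y i x) else 1))%R); last first.
    by apply/funext => x; rewrite big_mkcond.
  by apply: measurable_prod => i _; case: (i != k') => //; exact: mfY.
- by move=> x; apply: prodr_ge0.
- exact: prode_ge0.
- by apply: prode_fin_num => i _; rewrite ge0_fin_numE.
move=> A mA; pose f' i := if i == k' then \1_A : U -> R else f i.
have E i : i != k' -> f' i = f i by rewrite /f' => /negbTE ->.
have Ek : f' k' = \1_A by rewrite /f' eqxx.
have := IH f'; rewrite (bigD1 k')//= Ek (eq_bigr (fun i => \int[nu]_u (f i u)%:E)); last first.
  by move=> i /E ->.
under eq_integral do rewrite (bigD1 k')//= Ek (eq_bigr _ (fun i ik => congr1 (fun h => h _) (E i ik))).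
move=> ->.
- by rewrite integral_indic// setIT.
- by move=> i; rewrite /f'; case: ifP => // _; exact: measurable_indic.
- by move=> i u; rewrite /f'; case: ifP => // _; rewrite indicE.
- move=> i; rewrite /f'; case: ifP => // _.
  by rewrite integral_indic// setIT (le_lt_trans (probability_le1 nu mA))// ltry.
- move=> i ki; rewrite /f'; case: eqP => [ik|/eqP ik]; first by exists A.
  by apply: find; rewrite ltn_neqAle ki andbT; apply: contra_neq ik => ik; apply: val_inj.
Qed.

End Independence.

Section Gaussian.
Context {R : realType}.
Local Open Scope ereal_scope.

Lemma integral_normal_prob (f : R -> R) :
  measurable_fun setT f -> (forall x, 0 <= f x)%R ->
  \int[normal_prob 0 1]_x (f x)%:E =
  \int[lebesgue_measure]_x (f x * normal_pdf 0 1 x)%:E.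
Proof.
move=> mf f0; rewrite -[LHS]mule1; apply/esym.
apply: (@integral_factor_ext _ _ _ lebesgue_measure _ _ (normal_prob 0 1) id) => //.
- exact: measurable_normal_pdf.
- by move=> x; exact: normal_pdf_ge0.
- move=> A mA; rewrite mule1 /normal_prob [RHS]integral_mkcond.
  apply: eq_integral => x _; rewrite patchE indicE.
  by case: ifP; rewrite ?mul1r ?mul0r.
Qed.

Lemma normal_mgf (l : R) :
  \int[normal_prob 0 1]_x (expR (l * x))%:E = (expR (l ^+ 2 / 2))%:E.
Proof.
rewrite integral_normal_prob; last 2 first.
- by apply: measurableT_comp => //; exact: measurable_funM.
- by move=> x; exact: expR_ge0.
transitivity (\int[lebesgue_measure]_x ((expR (l ^+ 2 / 2))%:E * (normal_pdf l 1 x)%:E)).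
  apply: eq_integral => x _; rewrite -EFinM; congr EFin.
  rewrite !normal_pdfE ?oner_neq0// mulrCA [RHS]mulrCA; congr (_ * _)%R.
  by rewrite /normal_fun -!expRD; congr expR; field.
rewrite ge0_integralZl_EFin ?expR_ge0//; last 2 first.
- by move=> x _; rewrite lee_fin normal_pdf_ge0.
- by apply/measurable_EFinP; exact: measurable_normal_pdf.
by rewrite integral_normal_pdf mule1.
Qed.

Lemma normal_mgf_sqr (s : R) : (s < 2^-1)%R ->
  \int[normal_prob 0 1]_x (expR (s * x ^+ 2))%:E = ((Num.sqrt (1 - 2 * s))^-1)%:E.
Proof.
move=> s2; have c0 : (0 < 1 - 2 * s)%R by lra.
set c := Num.sqrt (1 - 2 * s).
have c1 : (0 < c)%R by rewrite sqrtr_gt0.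
have cc : (c ^+ 2 = 1 - 2 * s)%R by rewrite sqr_sqrtr// ltW.
rewrite integral_normal_prob; last 2 first.
- apply: measurableT_comp => //; apply: measurable_funM => //.
- by move=> x; exact: expR_ge0.
transitivity (\int[lebesgue_measure]_x ((c^-1)%:E * (normal_pdf 0 c^-1 x)%:E)).
  apply: eq_integral => x _; rewrite -EFinM; congr EFin.
  rewrite !normal_pdfE ?oner_neq0 ?invr_eq0 ?gt_eqF//.
  rewrite mulrCA [RHS]mulrA; congr (_ * _)%R.
    rewrite /normal_peak expr1n mul1r -mulrnAr sqrtrM ?exprn_ge0 ?invr_ge0 ?(ltW c1)//.
    by rewrite sqrtr_sqr ger0_norm ?invr_ge0 ?(ltW c1)// invfM invrK mulrA mulVf ?mul1r ?gt_eqF.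
  rewrite /normal_fun -expRD; congr expR; rewrite !subr0 exprVn cc.
  by field; rewrite gt_eqF.
rewrite ge0_integralZl_EFin ?invr_ge0 ?(ltW c1)//; last 2 first.
- by move=> x _; rewrite lee_fin normal_pdf_ge0.
- by apply/measurable_EFinP; exact: measurable_normal_pdf.
by rewrite integral_normal_pdf mule1.
Qed.

Context {d : measure_display} {T : measurableType d} (mu : probability T R).

Lemma gaussian_linear_mgf p (Z : 'I_p -> T -> R) (a : 'I_p -> R) (l : R) :
  iid mu Z (normal_prob 0 1) ->
  \int[mu]_x (expR (l * \sum_(k < p) a k * Z k x))%:E =
  (expR (l ^+ 2 * (\sum_(k < p) a k ^+ 2) / 2))%:E.
Proof.
move=> iidZ.
transitivity (\int[mu]_x (\prod_(k < p) expR (l * a k * Z k x))%:E).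
  apply: eq_integral => x _; congr EFin; rewrite -expR_sum mulr_sumr.
  by congr expR; apply: eq_bigr => k _; rewrite mulrA.
rewrite (integral_prod_iid (nu := normal_prob 0 1) (f := fun k u => expR (l * a k * u)))//.
- under eq_bigr do rewrite normal_mgf.
  rewrite prodEFin -expR_sum; congr (expR _)%:E.
  by rewrite mulr_sumr mulr_suml; apply: eq_bigr => k _; rewrite exprMn.
- by move=> k; apply: measurableT_comp => //; exact: measurable_funM.
- by move=> k; rewrite normal_mgf ltry.
Qed.

(* Linearization: [exp (s y^2)] is the mean of [exp (sqrt (2 s) g y)] over a standard
   normal [g]. *)
Lemma gaussian_square_mgf p (Z : 'I_p -> T -> R) (a : 'I_p -> R) (s : R) :
  iid mu Z (normal_prob 0 1) -> (0 <= s)%R ->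
  (2 * s * \sum_(k < p) a k ^+ 2 < 1)%R ->
  \int[mu]_x (expR (s * (\sum_(k < p) a k * Z k x) ^+ 2))%:E =
  ((Num.sqrt (1 - 2 * s * \sum_(k < p) a k ^+ 2))^-1)%:E.
Proof.
move=> iidZ s0 slt; pose y x := (\sum_(k < p) a k * Z k x)%R.
have my : measurable_fun setT y.
  by apply: measurable_sum => k; apply: measurable_funM => //; case: iidZ.
set c := Num.sqrt (2 * s).
have cc : (c ^+ 2 = 2 * s)%R by rewrite sqr_sqrtr// mulr_ge0.
transitivity (\int[mu]_x \int[normal_prob 0 1]_g (expR (c * g * y x))%:E).
  apply: eq_integral => x _.
  under eq_integral do rewrite mulrAC.
  by rewrite normal_mgf exprMn cc; congr (expR _)%:E; rewrite /y; field.
rewrite (@fubini_tonelli _ _ _ _ _ mu (normal_prob 0 1)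
  (fun z => (expR (c * z.2 * y z.1))%:E))/=; last 2 first.
- apply/measurable_EFinP; apply: measurableT_comp => //; apply: measurable_funM.
    by apply: measurable_funM => //; exact: measurable_snd.
  by apply: measurableT_comp => //; exact: measurable_fst.
- by move=> z; rewrite lee_fin expR_ge0.
transitivity (\int[normal_prob 0 1]_g
   (expR ((s * \sum_(k < p) a k ^+ 2) * g ^+ 2))%:E).
  apply: eq_integral => g _.
  rewrite (gaussian_linear_mgf a (c * g) iidZ) exprMn cc; congr (expR _)%:E.
  by field.
rewrite normal_mgf_sqr ?mulrA//.
by rewrite -(ltr_pM2l (x := 2%R)) ?ltr0n// mulrA divff ?pnatr_eq0.
Qed.

End Gaussian.

(** * Numerical bounds on exponential moments *)

Section ExpBounds.
Context {R : realType}.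
Implicit Types x y s : R.

Lemma expR_ge_quad x : 0 <= x -> 1 + x + x ^+ 2 / 2 <= expR x.
Proof.
move=> x0; rewrite /expR.
have -> : 1 + x + x ^+ 2 / 2 = series (exp_coeff x) 3.
  rewrite /series/= big_mkord !big_ord_recr big_ord0/= /exp_coeff/=.
  by rewrite !factS fact0 expr0 expr1 !muln1 !divr1 add0r.
apply: nondecreasing_cvgn_le; last exact: is_cvg_series_exp_coeff.
apply/nondecreasing_seqP => n; rewrite /series/= big_nat_recr//= lerDl.
by rewrite /exp_coeff/= divr_ge0 ?exprn_ge0.
Qed.

(** The cubic is the truncation of (1 - y/8)^8, which is at most exp (- y) because 1 - u <= exp (-
    u): 7/16 is 28/8^2 and 7/64 is 56/8^3. *)
Lemma expRN_ge_cubic y : 0 <= y <= 1 ->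
  1 - y + 7 / 16 * y ^+ 2 - 7 / 64 * y ^+ 3 <= expR (- y).
Proof.
move=> /andP[y0 y1]; set u := y / 8.
have -> : y = u * 8 by rewrite /u; field.
rewrite -mulNr expRM_natr.
have u0 : 0 <= u by rewrite /u; lra.
have u1 : u <= 1 / 8 by rewrite /u; lra.
have h1 : 1 - u <= expR (- u) by have := expR_ge1Dx (- u).
have p1 : 0 <= 1 - u by lra.
apply: (@le_trans _ _ ((1 - u) ^+ 8)); last by rewrite lerXn2r ?nnegrE ?expR_ge0.
have -> : (1 - u) ^+ 8 = ((1 - 4 * u + 6 * u ^+ 2 - 4 * u ^+ 3) + u ^+ 4) ^+ 2 by ring.
set a := (1 - _ + _ - _).
have y2 : 0 <= u ^+ 2 <= u by rewrite exprn_ge0//= expr2 ler_piMl//; lra.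
have y3 : 0 <= u ^+ 3 <= u by rewrite exprn_ge0//= exprS; move: y2 => /andP[? ?]; rewrite ler_piMr//; lra.
have y4 : 0 <= u ^+ 4 by rewrite exprn_ge0.
have a0 : 0 <= a by rewrite /a; lra.
apply: (@le_trans _ _ (a ^+ 2)); last by rewrite lerXn2r ?nnegrE; lra.
rewrite -subr_ge0 [leRHS](_ : _ = u ^+ 4 * (68 - 48 * u + 16 * u ^+ 2)); last first.
  by rewrite /a; field.
by apply: mulr_ge0 => //; lra.
Qed.

(** Since - ln (1 - e) / 2 = e/2 + e^2/4 + O(e^3), the exponent on the left is - e^2/4 + O(e^3). The
    gap between 9/40 and 1/4 absorbs the remainder for e <= 1/400. *)
Lemma chi_square_mgf_upper (e : R) : 0 <= e <= 1 / 400 ->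
  (Num.sqrt (1 - e))^-1 * expR (- (e / 2 * (1 + e))) <= expR (- (9 / 40 * e ^+ 2)).
Proof.
move=> /andP[e0 e1].
have se0 : 0 < Num.sqrt (1 - e) by rewrite sqrtr_gt0; lra.
rewrite -ler_pdivlMr ?expR_gt0// -expRN -expRD opprK.
set z := e + 11 / 20 * e ^+ 2.
have -> : - (9 / 40 * e ^+ 2) + e / 2 * (1 + e) = z / 2 by rewrite /z; field.
rewrite -[leLHS]mul1r ler_pdivrMr//.
rewrite -(@ler_pXn2r _ 2) ?nnegrE ?mulr_ge0 ?expR_ge0 ?sqrtr_ge0//.
rewrite exprMn sqr_sqrtr; last by lra.
rewrite -expRM_natr expr1n divfK ?pnatr_eq0//.
have z0 : 0 <= z by rewrite /z addr_ge0// mulr_ge0 ?exprn_ge0//.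
apply: (@le_trans _ _ ((1 + z + z ^+ 2 / 2) * (1 - e))); last first.
  by rewrite ler_pM2r ?expR_ge_quad//; lra.
rewrite -subr_ge0 [leRHS](_ : _ = e ^+ 2 * (1 / 20 - (e / 2 + 319 / 800 * e ^+ 2 + 121 / 800 * e ^+ 3))); last first.
  by rewrite /z; field.
have e2 : 0 <= e ^+ 2 <= e by rewrite exprn_ge0//= expr2 ler_piMl//; lra.
have e3 : 0 <= e ^+ 3 <= e by rewrite exprn_ge0//= exprS; move: e2 => /andP[? ?]; rewrite ler_piMr//; lra.
by apply: mulr_ge0; [exact: exprn_ge0|lra].
Qed.

(* The left factor is [3 - 3 E exp v + E exp (2 v)] for [v = s y^2], [s = e / 2]: it
   bounds [E exp (- v)] using moments at positive arguments only. *)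
Lemma chi_square_mgf_lower (e : R) : 0 <= e <= 1 / 400 ->
  (3 - 3 * (Num.sqrt (1 - e))^-1 + (Num.sqrt (1 - 2 * e))^-1) * expR (e / 2 * (1 - e))
  <= expR (- (9 / 40 * e ^+ 2)).
Proof.
move=> /andP[e0 e1].
rewrite -ler_pdivlMr ?expR_gt0// -expRN -expRD.
set s := e / 2; have -> : e = 2 * s by rewrite /s; field.
have s0 : 0 <= s by rewrite /s; lra.
have s1 : s <= 1 / 800 by rewrite /s; lra.
have s2 : 0 <= s ^+ 2 <= s / 800.
  by rewrite exprn_ge0//= expr2 ler_wpM2l//; lra.
have c0 : 0 < Num.sqrt (1 - 2 * s) by rewrite sqrtr_gt0; lra.
have d0 : 0 < Num.sqrt (1 - 2 * (2 * s)) by rewrite sqrtr_gt0; lra.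
have s3 : 0 <= s ^+ 3 <= s / 800.
  rewrite exprn_ge0//= exprS; move: s2 => /andP[? ?].
  by rewrite ler_wpM2l//; lra.
have s4 : 0 <= s ^+ 4 <= s / 800.
  rewrite exprn_ge0//= exprS; move: s3 => /andP[? ?].
  by rewrite ler_wpM2l//; lra.
have ha : 1 + s + 3 / 2 * s ^+ 2 <= (Num.sqrt (1 - 2 * s))^-1.
  rewrite -[leRHS]mul1r ler_pdivlMr// -(@ler_pXn2r _ 2) ?nnegrE ?mulr_ge0 ?addr_ge0 ?sqrtr_ge0//; try lra.
  rewrite exprMn sqr_sqrtr; last by lra.
  rewrite expr1n -subr_ge0 [leRHS](_ : _ = s ^+ 3 * (5 + 15 / 4 * s + 9 / 2 * s ^+ 2)); last by field.
  by apply: mulr_ge0; [exact: exprn_ge0|lra].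
have hb : (Num.sqrt (1 - 2 * (2 * s)))^-1 <= 1 + 2 * s + 6 * s ^+ 2 + 25 * s ^+ 3.
  rewrite -[leLHS]mul1r ler_pdivrMr// -(@ler_pXn2r _ 2) ?nnegrE ?mulr_ge0 ?addr_ge0 ?sqrtr_ge0//; try lra.
  rewrite exprMn sqr_sqrtr; last by lra.
  rewrite expr1n -subr_ge0 [leRHS](_ : _ = s ^+ 3 * (10 - 160 * s - 244 * s ^+ 2 - 575 * s ^+ 3 - 2500 * s ^+ 4)); last by ring.
  by apply: mulr_ge0; [exact: exprn_ge0|lra].
have -> : - (9 / 40 * (2 * s) ^+ 2) - s * (1 - 2 * s) = - (s - 11 / 10 * s ^+ 2) by field.
apply: le_trans (expRN_ge_cubic _); last by lra.
apply: (@le_trans _ _ (1 - s + 3 / 2 * s ^+ 2 + 25 * s ^+ 3)); first by lra.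
rewrite -subr_ge0 [leRHS](_ : _ = s ^+ 2 * (3 / 80 - s * (25 + 77 / 80 + 7 / 64) + 847 / 1600 * s ^+ 2 + 7 / 64 * (33 / 10 * s ^+ 2 - 363 / 100 * s ^+ 3 + 1331 / 1000 * s ^+ 4))); last by field.
by apply: mulr_ge0; [exact: exprn_ge0|lra].
Qed.

End ExpBounds.

(** * Chernoff bounds for sums of squares *)

Section Tails.
Context {R : realType} {d : measure_display} {T : measurableType d}
  (P : probability T R) {d' : measure_display} {U : measurableType d'}
  (nu : probability U R).

Lemma iid_chernoff m (Y : 'I_m -> T -> U) (phi : U -> R) (c : R) :
  iid P Y nu -> measurable_fun setT phi ->
  (\int[nu]_u (expR (phi u))%:E <= (expR c)%:E)%E ->
  (P [set w | 0 <= \sum_(i < m) phi (Y i w)]%R <= (expR (m%:R * c))%:E)%E.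
Proof.
move=> iidY mphi le_c; have [mY _ _] := iidY.
have mS : measurable_fun setT (fun w => \sum_(i < m) phi (Y i w)).
  by apply: measurable_sum => i; exact: measurableT_comp.
have mA : measurable [set w | 0 <= \sum_(i < m) phi (Y i w)].
  rewrite -[X in measurable X]setTI; have := mS measurableT `[0, +oo[%classic (measurable_itv _).
  by congr measurable; apply/seteqP; split => w /=; rewrite in_itv/= andbT.
apply: (@le_trans _ _ (\int[P]_w (expR (\sum_(i < m) phi (Y i w)))%:E)%E).
  rewrite -[X in P X]setIT -integral_indic//; apply: ge0_le_integral => //.
  - by apply/measurable_EFinP; exact: measurable_indic.
  - by apply/measurable_EFinP; exact: measurableT_comp.
  - move=> w _; rewrite lee_fin indicE; case: (boolP (w \in _)) => [|_]; last exact: expR_ge0.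
    by rewrite inE/= => S0; rewrite -[leLHS]expR0 ler_expR.
have int_ge0 : (0 <= \int[nu]_u (expR (phi u))%:E)%E.
  by apply: integral_ge0 => u _; rewrite lee_fin expR_ge0.
have int_lty : (\int[nu]_u (expR (phi u))%:E < +oo)%E by rewrite (le_lt_trans le_c)// ltry.
under eq_integral do rewrite expR_sum.
rewrite (integral_prod_iid (nu := nu) (f := fun=> expR \o phi))//=; last first.
  by move=> _; exact: measurableT_comp.
rewrite big_const_ord iter_mule mule1.
have /fineK fE : (\int[nu]_u (expR (phi u))%:E)%E \is a fin_num by rewrite ge0_fin_numE.
move: int_ge0 le_c; rewrite -fE !lee_fin => v0 vc.
by rewrite -EFin_expe lee_fin mulrC expRM_natr lerXn2r ?nnegrE ?expR_ge0.
Qed.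

(** The moments of [V ^+ 2] are assumed for [s >= 0] only, the range reached by linearization with
    an auxiliary Gaussian. The lower tail must therefore be bounded through positive exponents as
    well. *)
Lemma chi_square_tail m (Y : 'I_m -> T -> U) (V : U -> R) (q e : R) :
  iid P Y nu -> measurable_fun setT V -> 0 < q -> 0 <= e <= 1 / 400 ->
  (forall s, 0 <= s -> 2 * s * q < 1 ->
    (\int[nu]_u (expR (s * V u ^+ 2))%:E = ((Num.sqrt (1 - 2 * s * q))^-1)%:E)%E) ->
  measurable [set w | m%:R * e * q <= `|\sum_(i < m) V (Y i w) ^+ 2 - m%:R * q|] /\
  (P [set w | (m%:R * e * q <= `|\sum_(i < m) V (Y i w) ^+ 2 - m%:R * q|)%R] <=
   (2 * expR (- (m%:R * (9 / 40 * e ^+ 2))))%:E)%E.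
Proof.
move=> iidY mV q0 e01 mgf; have [mY _ _] := iidY.
have /andP[e0 e1] := e01.
have qn0 : q != 0 by rewrite gt_eqF.
have mV2 : measurable_fun setT (fun u => V u ^+ 2) by exact: measurable_funX.
pose W w := \sum_(i < m) V (Y i w) ^+ 2.
have mW : measurable_fun setT W.
  by apply: measurable_sum => i; exact: (measurableT_comp mV2).
have mge (g : T -> R) : measurable_fun setT g -> measurable [set w | 0 <= g w].
  move=> mg; rewrite -[X in measurable X]setTI.
  have := mg measurableT `[0, +oo[%classic (measurable_itv _).
  by congr measurable; apply/seteqP; split => w /=; rewrite in_itv/= andbT.
set s := e / 2; have s0 : 0 <= s by rewrite /s; lra.
pose up u := s / q * V u ^+ 2 - e / 2 * (1 + e).
pose lo u := e / 2 * (1 - e) - s / q * V u ^+ 2.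
have mup : measurable_fun setT up by apply: measurable_funB => //; exact: measurable_funM.
have mlo : measurable_fun setT lo by apply: measurable_funB => //; exact: measurable_funM.
have mexp (g : U -> R) : measurable_fun setT g ->
    measurable_fun setT (fun u => (expR (g u))%:E).
  by move=> mg; apply/measurable_EFinP; exact: measurableT_comp.
have mgf1 : (\int[nu]_u (expR (s / q * V u ^+ 2))%:E = ((Num.sqrt (1 - e))^-1)%:E)%E.
  rewrite mgf ?divr_ge0 ?(ltW q0)//.
    by congr (Num.sqrt (1 - _))^-1%:E; rewrite /s; field.
  by rewrite [ltLHS](_ : _ = e); [lra|rewrite /s; field].
have mgf2 : (\int[nu]_u (expR (2 * (s / q * V u ^+ 2)))%:E = ((Num.sqrt (1 - 2 * e))^-1)%:E)%E.
  under eq_integral do rewrite mulrA.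
  rewrite mgf ?mulr_ge0 ?invr_ge0 ?(ltW q0)//.
    by congr (Num.sqrt (1 - _))^-1%:E; rewrite /s; field.
  by rewrite [ltLHS](_ : _ = 2 * e); [lra|rewrite /s; field].
have Bup : (\int[nu]_u (expR (up u))%:E <= (expR (- (9 / 40 * e ^+ 2)))%:E)%E.
  under eq_integral do rewrite /up expRD mulrC EFinM.
  rewrite ge0_integralZl_EFin ?expR_ge0//; last first.
    by apply: mexp; exact: measurable_funM.
  by rewrite mgf1 -EFinM lee_fin mulrC chi_square_mgf_upper.
have Blo : (\int[nu]_u (expR (lo u))%:E <= (expR (- (9 / 40 * e ^+ 2)))%:E)%E.
  set x := fun u => s / q * V u ^+ 2.
  have x0 u : 0 <= x u by rewrite mulr_ge0 ?divr_ge0 ?sqr_ge0 ?(ltW q0).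
  have mx : measurable_fun setT x by exact: measurable_funM.
  under eq_integral do rewrite /lo expRD EFinM.
  rewrite ge0_integralZl_EFin ?expR_ge0//; last first.
    by apply: mexp; exact: measurable_funN.
  (* Integrated form of (z - 1)^3 / z >= 0 for z = exp (x u) >= 1, arranged without subtraction
     because the integrals are extended reals. *)
  have h : (\int[nu]_u (expR (- x u))%:E + 3%:E * \int[nu]_u (expR (x u))%:E <=
            3%:E + \int[nu]_u (expR (2 * x u))%:E)%E.
    rewrite -ge0_integralZl_EFin//; last exact: (mexp _ mx).
    rewrite -ge0_integralD//; last 2 first.
    - by apply: mexp; exact: measurable_funN.
    - by apply: measurable_funeM; exact: (mexp _ mx).
    rewrite [X in (_ <= X + _)%E](_ : _ = \int[nu]_u 3%:E)%E; last first.
      by rewrite integral_cst//= probability_setT mule1.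
    rewrite -ge0_integralD//; last first.
      by apply: mexp; exact: measurable_funM.
    apply: ge0_le_integral => //.
    - by move=> u _; rewrite -EFinM -EFinD lee_fin addr_ge0 ?mulr_ge0 ?expR_ge0.
    - apply: emeasurable_funD; first by apply: mexp; exact: measurable_funN.
      by apply: measurable_funeM; exact: (mexp _ mx).
    - by apply: emeasurable_funD => //; apply: mexp; exact: measurable_funM.
    move=> u _; rewrite -EFinM -!EFinD lee_fin.
    rewrite expRN [2 * x u]mulrC expRM_natr.
    have z1 : 1 <= expR (x u) by rewrite -expR0 ler_expR.
    set z := expR (x u) in z1 *.
    have z0 : z != 0 by rewrite gt_eqF// (lt_le_trans _ z1).
    rewrite -subr_ge0 [leRHS](_ : _ = (z - 1) ^+ 3 / z); last by field.
    by rewrite divr_ge0 ?exprn_ge0 ?subr_ge0// (le_trans _ z1).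
  rewrite [X in (_ * X)%E](_ : _ = \int[nu]_u (expR (- x u))%:E)%E//.
  move: h; rewrite mgf1 mgf2.
  have : (0 <= \int[nu]_u (expR (- x u))%:E)%E.
    by apply: integral_ge0 => u _; rewrite lee_fin expR_ge0.
  case: (\int[nu]_u _)%E => [r||] //= _; rewrite -!EFinM -!EFinD !lee_fin => h.
  apply: le_trans (chi_square_mgf_lower e01).
  rewrite mulrC ler_wpM2r ?expR_ge0//; lra.
have Sup w : \sum_(i < m) up (Y i w) = s / q * (W w - m%:R * q - m%:R * e * q).
  rewrite /up big_split/= -mulr_sumr -/(W w) sumr_const card_ord -mulr_natr /s; field; exact: qn0.
have Slo w : \sum_(i < m) lo (Y i w) = s / q * (m%:R * q - W w - m%:R * e * q).
  rewrite /lo big_split/= sumr_const card_ord sumrN -mulr_sumr -/(W w) -mulr_natr /s; field; exact: qn0.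
have sq0 : 0 <= s / q by rewrite divr_ge0 ?(ltW q0).
have Sub : [set w | m%:R * e * q <= `|W w - m%:R * q|] `<=`
    [set w | 0 <= \sum_(i < m) up (Y i w)] `|` [set w | 0 <= \sum_(i < m) lo (Y i w)].
  move=> w /=; rewrite ler_normr => /orP[h|h]; [left|right]; rewrite ?Sup ?Slo mulr_ge0//; lra.
have mE : measurable [set w | m%:R * e * q <= `|W w - m%:R * q|].
  rewrite [X in measurable X](_ : _ = [set w | 0 <= `|W w - m%:R * q| - m%:R * e * q]).
    by apply: mge; apply: measurable_funB => //; apply: measurableT_comp => //; exact: measurable_funB.
  by apply/seteqP; split => w /=; rewrite subr_ge0.
split => //.
apply: (@le_trans _ _ (P ([set w | (0 <= \sum_(i < m) up (Y i w))%R] `|` [set w | (0 <= \sum_(i < m) lo (Y i w))%R]))).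
  apply: le_measure => //; rewrite inE//; apply: measurableU; apply: mge; apply: measurable_sum => i.
    exact: measurableT_comp.
  exact: measurableT_comp.
apply: (le_trans (measureU2 _ _ _)).
- by apply: mge; apply: measurable_sum => i; exact: measurableT_comp.
- by apply: mge; apply: measurable_sum => i; exact: measurableT_comp.
have -> : 2 * expR (- (m%:R * (9 / 40 * e ^+ 2))) = 
  expR (m%:R * - (9 / 40 * e ^+ 2)) + expR (m%:R * - (9 / 40 * e ^+ 2)).
  by rewrite mulrN mulr_natl mulr2n.
by rewrite EFinD; apply: leeD; exact: iid_chernoff.
Qed.

End Tails.

(** * Gram matrices *)

Section Bilinear.
Context {R : realType} {p : nat}.
Implicit Types (G : 'M[R]_p) (u v w : 'rV[R]_p).

Definition bil G u v : R := (u *m G *m v^T) 0 0.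

Lemma bilDl G u v w : bil G (u + v) w = bil G u w + bil G v w.
Proof. by rewrite /bil !mulmxDl mxE. Qed.

Lemma bilDr G u v w : bil G u (v + w) = bil G u v + bil G u w.
Proof. by rewrite /bil linearD mulmxDr mxE. Qed.

Lemma bilZl G a u v : bil G (a *: u) v = a * bil G u v.
Proof. by rewrite /bil -!scalemxAl mxE. Qed.

Lemma bilZr G a u v : bil G u (a *: v) = a * bil G u v.
Proof. by rewrite /bil linearZ -scalemxAr mxE. Qed.

Lemma bilNl G u v : bil G (- u) v = - bil G u v.
Proof. by rewrite -scaleN1r bilZl mulN1r. Qed.

Lemma bilNr G u v : bil G u (- v) = - bil G u v.
Proof. by rewrite -scaleN1r bilZr mulN1r. Qed.

Lemma bilBl G u v w : bil G (u - v) w = bil G u w - bil G v w.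
Proof. by rewrite bilDl bilNl. Qed.

Lemma bilBr G u v w : bil G u (v - w) = bil G u v - bil G u w.
Proof. by rewrite bilDr bilNr. Qed.

Lemma bil0l G u : bil G 0 u = 0.
Proof. by rewrite -(scale0r 0) bilZl mul0r. Qed.

Lemma bil0r G u : bil G u 0 = 0.
Proof. by rewrite -(scale0r 0) bilZr mul0r. Qed.

Lemma bil_suml G (I : Type) (r : seq I) (P : pred I) (F : I -> 'rV[R]_p) v :
  bil G (\sum_(i <- r | P i) F i) v = \sum_(i <- r | P i) bil G (F i) v.
Proof. by rewrite /bil !mulmx_suml summxE. Qed.

Lemma bil_sumr G (I : Type) (r : seq I) (P : pred I) (F : I -> 'rV[R]_p) u :
  bil G u (\sum_(i <- r | P i) F i) = \sum_(i <- r | P i) bil G u (F i).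
Proof. by rewrite /bil linear_sum mulmx_sumr summxE. Qed.

Lemma bilC G u v : G^T = G -> bil G u v = bil G v u.
Proof.
move=> sG; transitivity ((u *m G *m v^T)^T 0 0); first by rewrite mxE.
by rewrite !trmx_mul trmxK sG mulmxA.
Qed.

Definition gram m (M : 'M[R]_(m, p)) : 'M[R]_p := M^T *m M.

Lemma gram_sym m (M : 'M[R]_(m, p)) : (gram M)^T = gram M.
Proof. by rewrite /gram trmx_mul trmxK. Qed.

Lemma bil_gram m (M : 'M[R]_(m, p)) u v :
  bil (gram M) u v = \sum_i (u *m M^T) 0 i * (v *m M^T) 0 i.
Proof.
rewrite /bil /gram mulmxA -(mulmxA _ M) mxE; apply: eq_bigr => i _.
by congr (_ * _); rewrite -[M *m v^T]trmxK trmx_mul trmxK mxE.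
Qed.

Lemma bil_gram_ge0 m (M : 'M[R]_(m, p)) u : 0 <= bil (gram M) u u.
Proof. by rewrite bil_gram; apply: sumr_ge0 => i _; rewrite -expr2 sqr_ge0. Qed.

Lemma bil_sqrD G u v : G^T = G ->
  bil G (u + v) (u + v) = bil G u u + 2 * bil G u v + bil G v v.
Proof. by move=> sG; rewrite !bilDl !bilDr (bilC v u sG); ring. Qed.

Lemma bil_polar G u v : G^T = G ->
  bil G u v = (bil G (u + v) (u + v) - bil G (u - v) (u - v)) / 4.
Proof. by move=> sG; rewrite !bil_sqrD// !bilNr bilNl; field. Qed.

(* Cauchy-Schwarz, with the constant of proportionality as a parameter so that no
   square root appears. *)
Lemma bil_amgm m (M : 'M[R]_(m, p)) u v (c : R) : 0 < c ->
  2 * bil (gram M) u v <= c * bil (gram M) u u + c^-1 * bil (gram M) v v.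
Proof.
move=> c0; have := bil_gram_ge0 M (c *: u - v).
rewrite bil_sqrD ?gram_sym// !bilNr bilNl !bilZl !bilZr opprK => h.
rewrite -subr_ge0 (_ : _ - _ = c^-1 * (c * (c * bil (gram M) u u) + 2 * - (c * bil (gram M) u v) + bil (gram M) v v)).
  by rewrite mulr_ge0// invr_ge0 ltW.
by field; rewrite gt_eqF.
Qed.

Lemma bil_CS m (M : 'M[R]_(m, p)) u v :
  bil (gram M) u v ^+ 2 <= bil (gram M) u u * bil (gram M) v v.
Proof.
have [u0|un0] := eqVneq (bil (gram M) u u) 0.
  suff -> : bil (gram M) u v = 0 by rewrite u0 mul0r expr0n.
  move: u0; rewrite !bil_gram => /eqP.
  rewrite psumr_eq0; last by move=> i _; rewrite -expr2 sqr_ge0.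
  move=> /allP u0; rewrite big1// => i _.
  by have := u0 i (mem_index_enum _); rewrite /= mulf_eq0 orbb => /eqP ->; rewrite mul0r.
have up : 0 < bil (gram M) u u by rewrite lt_neqAle eq_sym un0 bil_gram_ge0.
have := bil_gram_ge0 M (bil (gram M) u v *: u - bil (gram M) u u *: v).
rewrite bil_sqrD ?gram_sym// !bilNr !bilNl !bilZl !bilZr opprK => h.
rewrite -subr_ge0 -(pmulr_rge0 _ up); apply: le_trans h _.
by rewrite le_eqVlt; apply/orP; left; apply/eqP; ring.
Qed.

End Bilinear.

Section GaussianRows.
Context {R : realType} {d : measure_display} {T : measurableType d}
  (P : probability T R) {n p : nat} (mu : probability (p.-tuple R) R).

Lemma gaussian_gram_tail (Sigma : 'M[R]_p) (X : T -> 'M[R]_(n, p)) (v : 'rV[R]_p) (e : R) :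
  centered_gaussian Sigma mu -> iid P (row_tuple X) mu ->
  0 < bil Sigma v v -> 0 <= e <= 1 / 400 ->
  let E := [set w | n%:R * e * bil Sigma v v <= `|bil (gram (X w)) v v - n%:R * bil Sigma v v|] in
  measurable E /\ (P E <= (2 * expR (- (n%:R * (9 / 40 * e ^+ 2))))%:E)%E.
Proof.
move=> [A [Z [AA iidZ xE]]] iidX v0 e01 /=.
pose a k := (v *m A) 0 k.
have aE : \sum_k a k ^+ 2 = bil Sigma v v.
  rewrite -AA (_ : A *m A^T = gram A^T); last by rewrite /gram trmxK.
  by rewrite bil_gram; apply: eq_bigr => k _; rewrite trmxK -expr2.
pose V (x : p.-tuple R) := \sum_k a k * Z k x.
have VE w i : V (row_tuple X i w) = (v *m (X w)^T) 0 i.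
  rewrite /V mxE; transitivity (\sum_j v 0 j * \sum_k A j k * Z k (row_tuple X i w)).
    under eq_bigr do rewrite /a mxE mulr_suml.
    rewrite exchange_big/=; apply: eq_bigr => j _.
    by rewrite mulr_sumr; apply: eq_bigr => k _; rewrite mulrA.
  by apply: eq_bigr => j _; rewrite -xE /row_tuple tnth_mktuple mxE.
have mV : measurable_fun setT V.
  by apply: measurable_sum => k; apply: measurable_funM => //; case: iidZ.
have GE w : bil (gram (X w)) v v = \sum_i V (row_tuple X i w) ^+ 2.
  by rewrite bil_gram; apply: eq_bigr => i _; rewrite VE -expr2.
rewrite (_ : [set w | _] = [set w | n%:R * e * bil Sigma v v <=
    `|\sum_i V (row_tuple X i w) ^+ 2 - n%:R * bil Sigma v v|]); last first.
  by apply/seteqP; split => w /=; rewrite GE.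
apply: chi_square_tail iidX mV v0 e01 _ => s s0 s1.
by rewrite (gaussian_square_mgf iidZ s0) aE.
Qed.

End GaussianRows.

(** * Orthonormal coordinates on a span *)

Section NetBasis.
Context {R : realType}.

(** Gram-Schmidt without a rank assumption: a row that depends on the following ones becomes zero,
    through the convention 0^-1 = 0. The last two identities say that [gram Q] is the orthogonal
    projection onto the row space of [Q], and that this space contains the rows of [M]. *)
Lemma gram_orthonormalization q k (M : 'M[R]_(k, q)) :
  exists (Q : 'M[R]_(k, q)) (C : 'M[R]_k),
    [/\ Q = C *m M, Q *m gram Q = Q & M *m gram Q = M].
Proof.
elim: k M => [|k IH] M.
  by exists M, 1%:M; split; rewrite ?mul1mx// !(flatmx0 (_ *m _)) (flatmx0 M).
suff H (N : 'M[R]_(1 + k, q)) : exists (Q : 'M[R]_(1 + k, q)) (C : 'M[R]_(1 + k)),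
  [/\ Q = C *m N, Q *m gram Q = Q & N *m gram Q = N] by exact: H M.
rewrite -(vsubmxK N); move: (usubmx N) (dsubmx N) => m M'.
have [Q' [C' [QC QQ MQ]]] := IH M'.
pose r := m - m *m gram Q'.
pose c := (Num.sqrt (bil 1%:M r r))^-1.
pose x := c *: r.
have gs : (gram Q')^T = gram Q' by exact: gram_sym.
have GG : gram Q' *m gram Q' = gram Q' by rewrite {1}/gram -mulmxA QQ.
have xg : x *m gram Q' = 0 by rewrite /x /r -scalemxAl mulmxBl -mulmxA GG subrr scaler0.
have Qx : Q' *m x^T = 0.
  by rewrite -[Q']QQ -mulmxA -gs -trmx_mul xg trmx0 mulmx0.
have xQ : x *m Q'^T = 0 by apply: trmx_inj; rewrite trmx_mul trmxK Qx trmx0.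
have rr : r *m r^T = (bil 1%:M r r)%:M by rewrite [LHS]mx11_scalar /bil mulmx1.
have rx : r *m gram x = r.
  have xT : x^T = c *: r^T by apply/matrixP => i j; rewrite !mxE.
  rewrite /gram mulmxA xT /x -!scalemxAr -scalemxAl rr mul_scalar_mx !scalerA.
  have [r0|rn0] := eqVneq (bil 1%:M r r) 0.
    suff -> : r = 0 by rewrite scaler0.
    apply/rowP => i; move: r0; rewrite /bil mulmx1 mxE => /eqP.
    rewrite psumr_eq0; last by move=> j _; rewrite [r^T _ _]mxE -expr2 sqr_ge0.
    move=> /allP/(_ i (mem_index_enum _)); rewrite /= [r^T _ _]mxE mulf_eq0 orbb => /eqP ->.
    by rewrite mxE.
  have rp : 0 <= bil 1%:M r r.
    by rewrite (_ : 1%:M = gram 1%:M) ?bil_gram_ge0// /gram trmx1 mul1mx.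
  have ct : c ^+ 2 * bil 1%:M r r = 1 by rewrite /c exprVn sqr_sqrtr// mulVf.
  by rewrite [X in X *: _](_ : _ = 1) ?scale1r// -ct; ring.
have gE : gram (col_mx x Q') = gram x + gram Q'.
  by rewrite /gram tr_col_mx mul_row_col.
exists (col_mx x Q'), (block_mx c%:M (- c *: (m *m Q'^T *m C')) 0 C'); split.
- rewrite mul_block_col mul0mx add0r -QC mul_scalar_mx -scalemxAl -mulmxA -QC -mulmxA.
  by rewrite scaleNr -scalerBr.
- rewrite gE mul_col_mx !mulmxDr xg addr0 QQ; congr col_mx.
    by rewrite {1}/x -scalemxAl rx.
  by rewrite /gram mulmxA Qx mul0mx add0r.
- rewrite gE mul_col_mx !mulmxDr MQ; congr col_mx.
    have mE : m = r + m *m gram Q' by rewrite /r subrK.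
    rewrite {1}mE mulmxDl rx -mulmxA /gram [Q'^T *m Q' *m _]mulmxA -(mulmxA Q'^T) Qx.
    by rewrite mulmx0 mul0mx mulmx0 addr0 -/(gram Q') -mE.
  by rewrite -{1}MQ /gram mulmxA -(mulmxA M') -(mulmxA _ Q') Qx !mulmx0 mul0mx add0r.
Qed.

Lemma bil_cholesky p q (A : 'M[R]_(p, q)) (u v : 'rV[R]_p) :
  bil (A *m A^T) u v = bil 1%:M (u *m A) (v *m A).
Proof. by rewrite /bil mulmx1 trmx_mul !mulmxA. Qed.

(** The factor [A] turns Sigma into the identity, so Gram-Schmidt on [F *m A] gives rows [N] that
    are Sigma-orthonormal up to zero rows. The clauses give contraction, isometric coordinates for
    the span, and the Sigma-projection. Dependent rows of [F] are allowed because a selection of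
    vertices may repeat one of them. *)
Lemma orthonormal_span p k (Sigma A : 'M[R]_p) (F : 'M[R]_(k, p)) :
  positive_definite Sigma -> A *m A^T = Sigma ->
  exists (N : 'M[R]_(k, p)) (C : 'M[R]_k),
  [/\ N = C *m F,
      forall b : 'rV_k, bil Sigma (b *m N) (b *m N) <= bil 1%:M b b,
      forall v : 'rV_k, exists2 b : 'rV_k, v *m F = b *m N &
        bil 1%:M b b = bil Sigma (v *m F) (v *m F)
    & forall v : 'rV_p, exists2 b : 'rV_k,
        bil 1%:M b b <= bil Sigma v v &
        forall a : 'rV_k, bil Sigma (v - b *m N) (a *m F) = 0].
Proof.
move=> [_ Spos] AA.
have [Q [C [QC QQ MQ]]] := gram_orthonormalization (F *m A).
have NA b : b *m (C *m F) *m A = b *m Q by rewrite QC !mulmxA.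
have proj (c : 'rV[R]_p) : bil 1%:M (c *m Q^T) (c *m Q^T) <= bil 1%:M c c.
  have gs : (gram Q)^T = gram Q by exact: gram_sym.
  have GG : gram Q *m gram Q = gram Q by rewrite {1}/gram -mulmxA QQ.
  have := bil_gram_ge0 1%:M (c - c *m gram Q).
  rewrite (_ : gram _ = 1%:M); last by rewrite /gram trmx1 mul1mx.
  rewrite /bil !mulmx1.
  have -> : (c - c *m gram Q) *m (c - c *m gram Q)^T = c *m c^T - c *m gram Q *m c^T.
    move: (gram Q) gs GG => G gs GG.
    have -> : (c - c *m G)^T = c^T - G *m c^T.
      by rewrite -[X in _ = _ - X *m _]gs -trmx_mul; apply/matrixP => i j; rewrite !mxE.
    by rewrite mulmxBl !mulmxBr !mulmxA -(mulmxA c _ G) GG subrr subr0.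
  rewrite mxE [X in _ + X]mxE subr_ge0 => h; apply: le_trans h.
  by rewrite trmx_mul trmxK /gram !mulmxA.
exists (C *m F), C; split => //.
- move=> b; rewrite -AA bil_cholesky NA.
  have := proj (b *m Q); rewrite -mulmxA => h.
  have h2 := bil_CS (1%:M : 'M[R]_k) b (b *m (Q *m Q^T)).
  move: h2; rewrite (_ : gram _ = 1%:M); last by rewrite /gram trmx1 mul1mx.
  have -> : bil 1%:M b (b *m (Q *m Q^T)) = bil 1%:M (b *m Q) (b *m Q).
    by rewrite /bil !mulmx1 !trmx_mul trmxK !mulmxA.
  set x := bil 1%:M (b *m Q) _ in h *; set y := bil 1%:M b b.
  have y0 : 0 <= y.
    by rewrite /y (_ : 1%:M = gram 1%:M) ?bil_gram_ge0// /gram trmx1 mul1mx.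
  have x0 : 0 <= x.
    by rewrite /x (_ : 1%:M = gram 1%:M) ?bil_gram_ge0// /gram trmx1 mul1mx.
  move=> h2; have h3 : x ^+ 2 <= y * x by apply: le_trans h2 _; rewrite ler_wpM2l.
  move: x0; rewrite le_eqVlt => /orP[/eqP <-//|x0].
  by rewrite -(ler_pM2r x0) -expr2.
- move=> v; exists (v *m F *m A *m Q^T).
    apply/eqP; rewrite -subr_eq0; apply: contraT => /Spos.
    rewrite -/(bil _ _ _) -AA bil_cholesky mulmxBl NA -mulmxA -/(gram Q) -!mulmxA.
    by rewrite (mulmxA F) MQ subrr bil0l ltxx.
  rewrite -AA bil_cholesky /bil !mulmx1 !trmx_mul trmxK !mulmxA.
  by rewrite -(mulmxA _ Q^T) -/(gram Q) -(mulmxA v F) -(mulmxA v) MQ !mulmxA.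
- move=> v; exists (v *m A *m Q^T).
    by rewrite -AA [leRHS]bil_cholesky; exact: proj.
  move=> a; rewrite -AA bil_cholesky mulmxBl NA -(mulmxA _ Q^T) -/(gram Q).
  have : a *m F *m A *m gram Q = a *m F *m A by rewrite -!mulmxA (mulmxA F) MQ.
  have gs : (gram Q)^T = gram Q by exact: gram_sym.
  have GG : gram Q *m gram Q = gram Q by rewrite {1}/gram -mulmxA QQ.
  move: (gram Q) (a *m F *m A) (v *m A) gs GG => G z y gs GG zG.
  rewrite /bil mulmx1 mulmxBl; have -> : z^T = G *m z^T by rewrite -{1}zG trmx_mul gs.
  by rewrite !mulmxA -(mulmxA y G G) GG subrr mxE.
Qed.

End NetBasis.

(** * High-probability events *)

Section HighProbability.
Context {R : realType} {d : measure_display} {T : measurableType d} (P : probability T R).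
Implicit Types (Q : T -> Prop) (c : R).

(** Here [c] bounds the probability of failure. The measurable event inside [Q] makes it unnecessary
    to show that [Q] itself, which may quantify over all vectors, is measurable. *)
Definition whp c Q : Prop :=
  exists E : set T, [/\ measurable E, (P (~` E) <= c%:E)%E & forall w, E w -> Q w].

Lemma whp_mono c c' Q Q' : c <= c' -> (forall w, Q w -> Q' w) -> whp c Q -> whp c' Q'.
Proof.
move=> cc' QQ' [E [mE PE EQ]]; exists E; split => //.
- by rewrite (le_trans PE)// lee_fin.
- by move=> w /EQ /QQ'.
Qed.

Lemma whp_sure c Q : 0 <= c -> (forall w, Q w) -> whp c Q.
Proof. by move=> c0 HQ; exists setT; split => //; rewrite setCT measure0 lee_fin. Qed.

Lemma whp_and c1 c2 Q1 Q2 : whp c1 Q1 -> whp c2 Q2 -> whp (c1 + c2) (fun w => Q1 w /\ Q2 w).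
Proof.
move=> [E1 [mE1 P1 E1Q]] [E2 [mE2 P2 E2Q]]; exists (E1 `&` E2); split.
- exact: measurableI.
- rewrite setCI EFinD (le_trans (measureU2 _ _ _))//; try exact: measurableC.
  exact: leeD.
- by move=> w [/E1Q ? /E2Q ?].
Qed.

Lemma whp_all (I : finType) c (Q : I -> T -> Prop) :
  (forall i, whp c (Q i)) -> whp (#|I|%:R * c) (fun w => forall i, Q i w).
Proof.
move=> HQ; suff H (s : seq I) : whp ((size s)%:R * c) (fun w => forall i, i \in s -> Q i w).
  have := H (enum I); rewrite -cardT; apply: whp_mono => // w Hw i.
  by apply: Hw; rewrite mem_enum.
elim: s => [|i s IH]; first by apply: whp_sure; rewrite ?mul0r.
have := whp_and (HQ i) IH; apply: whp_mono => [|w [Qi Qs] j].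
  by rewrite /= -add1n natrD mulrDl mul1r.
by rewrite inE => /orP[/eqP ->|/Qs].
Qed.

End HighProbability.

Section GramConcentration.
Context {R : realType} {d : measure_display} {T : measurableType d}
  (P : probability T R) {n p : nat} (mu : probability (p.-tuple R) R)
  (Sigma : 'M[R]_p) (X : T -> 'M[R]_(n, p)).
Hypothesis Sigma_pos : positive_definite Sigma.
Hypothesis gauss : centered_gaussian Sigma mu.
Hypothesis rows : iid P (row_tuple X) mu.

Let Spos v : v != 0 -> 0 < bil Sigma v v.
Proof. by case: Sigma_pos => _; exact. Qed.

Let Ssym : Sigma^T = Sigma. Proof. by case: Sigma_pos. Qed.

Lemma whp_norm (v : 'rV[R]_p) (e : R) : 0 <= e <= 1 / 400 ->
  whp P (2 * expR (- (n%:R * (9 / 40 * e ^+ 2))))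
    (fun w => `|bil (gram (X w)) v v - n%:R * bil Sigma v v| <= n%:R * e * bil Sigma v v).
Proof.
move=> e01; have [->|vn0] := eqVneq v 0.
  apply: whp_sure; first by rewrite mulr_ge0 ?expR_ge0.
  by move=> w; rewrite !bil0l !mulr0 subrr normr0.
have [mE PE] := gaussian_gram_tail gauss rows (Spos vn0) e01.
exists (~` [set w | n%:R * e * bil Sigma v v <=
  `|bil (gram (X w)) v v - n%:R * bil Sigma v v|]); split.
- exact: measurableC.
- by rewrite setCK.
- by move=> w /= /negP; rewrite -ltNge => /ltW.
Qed.

(* Polarization reduces the inner product of two orthogonal directions to
   two squared norms, at the cost of a factor 2 in the exponent. *)
Lemma whp_cross (u v : 'rV[R]_p) (e : R) : 0 <= e <= 1 / 400 -> bil Sigma u v = 0 ->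
  whp P (4 * expR (- (n%:R * (9 / 40 * e ^+ 2))))
    (fun w => bil (gram (X w)) u v ^+ 2 <= (n%:R * e) ^+ 2 * bil Sigma u u * bil Sigma v v).
Proof.
move=> e01 uv; have p4 : 0 <= 4 * expR (- (n%:R * (9 / 40 * e ^+ 2))) by rewrite mulr_ge0 ?expR_ge0.
have [->|un0] := eqVneq u 0.
  by apply: whp_sure => // w; rewrite !bil0l mulr0 mul0r expr0n.
have [->|vn0] := eqVneq v 0.
  by apply: whp_sure => // w; rewrite !bil0r mulr0 expr0n.
have qu := Spos un0; have qv := Spos vn0.
(* This scaling gives [c *: u] the Sigma-norm of [v]. By orthogonality [c *: u + v] and [c *: u - v]
   then have the same Sigma-norm, so the population terms cancel in the polarization identity. *)
set c := Num.sqrt (bil Sigma v v / bil Sigma u u).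
have cc : c ^+ 2 = bil Sigma v v / bil Sigma u u by rewrite sqr_sqrtr// divr_ge0 ?ltW.
have aa : bil Sigma (c *: u) (c *: u) = bil Sigma v v.
  by rewrite bilZl bilZr mulrA -expr2 cc divfK ?gt_eqF.
have := whp_and (whp_norm (c *: u + v) e01) (whp_norm (c *: u - v) e01).
apply: whp_mono => [|w]; first by rewrite -mulrDl; apply: ler_wpM2r; rewrite ?expR_ge0//; lra.
rewrite !(bil_sqrD _ _ Ssym) !bilNr !bilNl opprK aa !bilZl uv mulr0 oppr0 mulr0 addr0.
set q := bil Sigma v v in qv aa *; set G := gram (X w) => -[h1 h2].
have h : `|c * bil G u v| <= n%:R * e * q.
  have -> : c * bil G u v = ((bil G (c *: u + v) (c *: u + v) - n%:R * (q + q)) -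
      (bil G (c *: u - v) (c *: u - v) - n%:R * (q + q))) / 4.
    by rewrite -bilZl bil_polar ?gram_sym//; field.
  rewrite normrM (@ger0_norm _ 4^-1)// ler_pdivrMr//.
  by apply: le_trans (ler_normB _ _) _; lra.
have e0 : 0 <= e by case/andP: e01.
have : c ^+ 2 * bil G u v ^+ 2 <= (n%:R * e) ^+ 2 * q ^+ 2.
  by rewrite -!exprMn -(real_normK (num_real (c * _))) lerXn2r ?nnegrE ?mulr_ge0 ?(ltW qv).
rewrite cc -/q -ler_pdivlMl ?divr_gt0// => /le_trans; apply.
have un : bil Sigma u u != 0 by rewrite gt_eqF.
by rewrite le_eqVlt; apply/orP; left; apply/eqP; field; rewrite un gt_eqF.
Qed.

End GramConcentration.

(** * Grids and uniform bounds on a span *)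

Section Grid.
Context {R : realType}.

Lemma bil1E k (u v : 'rV[R]_k) : bil 1%:M u v = \sum_i u 0 i * v 0 i.
Proof. by rewrite /bil mulmx1 mxE; apply: eq_bigr => i _; rewrite mxE. Qed.

Lemma gram1 k : gram (1%:M : 'M[R]_k) = 1%:M.
Proof. by rewrite /gram trmx1 mul1mx. Qed.

Lemma bil1_ge0 k (u : 'rV[R]_k) : 0 <= bil 1%:M u u.
Proof. by rewrite -gram1 bil_gram_ge0. Qed.

Lemma bil1_CS k (u v : 'rV[R]_k) : bil 1%:M u v ^+ 2 <= bil 1%:M u u * bil 1%:M v v.
Proof. by rewrite -gram1 bil_CS. Qed.

Lemma bil1_gt0 k (u : 'rV[R]_k) : u != 0 -> 0 < bil 1%:M u u.
Proof.
move=> u0; rewrite lt_neqAle bil1_ge0 andbT eq_sym; apply: contra_neq u0.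
rewrite bil1E => /eqP; rewrite psumr_eq0; last by move=> i _; rewrite -expr2 sqr_ge0.
move=> /allP u0; apply/rowP => i; rewrite mxE.
by have := u0 i (mem_index_enum _); rewrite /= mulf_eq0 orbb => /eqP.
Qed.

Definition grid k (K : nat) (g : {ffun 'I_k -> 'I_(2 * K + 1)}) : 'rV[R]_k :=
  \row_i (((g i : nat)%:R - K%:R) / K%:R).

Lemma grid_approx k K (b : 'rV[R]_k) : (0 < K)%N -> bil 1%:M b b <= 1 ->
  exists g : {ffun 'I_k -> 'I_(2 * K + 1)},
    bil 1%:M (b - grid g) (b - grid g) <= k%:R / K%:R ^+ 2.
Proof.
move=> K0 b1; have KR : 0 < K%:R :> R by rewrite ltr0n.
have bi i : -1 <= b 0 i <= 1.
  rewrite -ler_norml -(@ler_pXn2r _ 2) ?nnegrE//.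
  rewrite real_normK ?num_real// expr1n; apply: le_trans b1.
  rewrite bil1E (bigD1 i)//= -expr2 lerDl sumr_ge0// => j _.
  by rewrite -expr2 sqr_ge0.
pose m i := Num.truncn (K%:R * (b 0 i + 1)).
have x0 i : 0 <= K%:R * (b 0 i + 1).
  by rewrite mulr_ge0// ?(ltW KR)//; have := bi i; lra.
have mP i : (m i)%:R <= K%:R * (b 0 i + 1) < (m i)%:R + 1.
  by have := truncn_itv (x0 i); rewrite -/(m i) -natr1.
have mle i : (m i < 2 * K + 1)%N.
  rewrite addn1 ltnS -(ler_nat R) natrM; have /andP[h _] := mP i; apply: le_trans h _.
  by rewrite mulrC ler_pM2r//; have := bi i; lra.
exists [ffun i => Ordinal (mle i)].
rewrite bil1E; apply: (@le_trans _ _ (\sum_(i < k) (K%:R ^+ 2)^-1)).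
  apply: ler_sum => i _; rewrite !mxE ffunE/= -expr2.
  have /andP[h1 h2] := mP i.
  rewrite (_ : _ - _ = (K%:R * (b 0 i + 1) - (m i)%:R) / K%:R); last first.
    by field; rewrite gt_eqF.
  rewrite exprMn exprVn ler_piMl ?invr_ge0 ?exprn_ge0 ?(ltW KR)//.
  by rewrite expr_le1// ?subr_ge0// lerBlDl ltW.
by rewrite sumr_const card_ord -[leLHS]mulr_natl.
Qed.

(** The coordinate vectors being grid points, the event on the grid also bounds the trace of the
    empirical form; this controls the discretization error in [whp_norm_span]. *)
Lemma grid_delta k K (i : 'I_k) : (0 < K)%N ->
  exists g : {ffun 'I_k -> 'I_(2 * K + 1)}, grid g = delta_mx 0 i.
Proof.
move=> K0; have h2 : (2 * K < 2 * K + 1)%N by rewrite addn1.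
have h1 : (K < 2 * K + 1)%N by rewrite addn1 ltnS leq_pmull.
exists [ffun j => if j == i then Ordinal h2 else Ordinal h1].
apply/rowP => j; rewrite !mxE ffunE eqxx/= [in RHS]eq_sym.
have Kn0 : K%:R != 0 :> R by rewrite pnatr_eq0 -lt0n.
rewrite eq_sym; case: eqP => _ /=; last by rewrite subrr mul0r.
by rewrite natrM; field.
Qed.

(** By Cauchy-Schwarz on each row of [M]. The factor [k] lost by bounding the operator norm by the
    trace is why the grid for norms needs a mesh of order tau / k. *)
Lemma bil_gram_le_trace m k (M : 'M[R]_(m, k)) (c : 'rV[R]_k) :
  bil (gram M) c c <= bil 1%:M c c * \sum_i bil (gram M) (delta_mx 0 i) (delta_mx 0 i).
Proof.
have -> : \sum_i bil (gram M) (delta_mx 0 i) (delta_mx 0 i) =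
          \sum_r bil 1%:M (row r M) (row r M).
  under eq_bigr do rewrite bil_gram.
  rewrite exchange_big; apply: eq_bigr => r _; rewrite bil1E; apply: eq_bigr => i _.
  by rewrite -rowE !mxE.
rewrite bil_gram mulr_sumr; apply: ler_sum => r _.
apply: le_trans (bil1_CS _ _); rewrite bil1E -expr2 le_eqVlt; apply/orP; left.
by apply/eqP; congr (_ ^+ 2); rewrite mxE; apply: eq_bigr => j _; rewrite !mxE.
Qed.

End Grid.

(** The arithmetic behind [whp_norm_span]: [x] and [z] are the empirical squared norms of a unit
    vector and of its grid approximation, [y] is the population squared norm of the latter, and [D1]
    to [D4] are the discretization errors left by Young's inequality with parameter tau. *)
Lemma perturbed_norm_bounds (R : realFieldType) (tau N x y z D1 D2 D3 D4 : R) :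
  0 < tau <= 1 / 20 -> 0 <= N ->
  - (N * tau * y) <= z - N * y <= N * tau * y ->
  D1 <= tau ^+ 2 + tau -> D2 <= tau ^+ 2 + tau ->
  D3 <= N * (tau ^+ 2 + tau) -> D4 <= N * (tau ^+ 2 + tau) ->
  1 <= (1 + tau) * y + D1 -> y <= (1 + tau) * 1 + D2 ->
  x <= (1 + tau) * z + D3 -> z <= (1 + tau) * x + D4 ->
  (1 - 10 * tau) * N <= x <= (1 + 10 * tau) * N.
Proof.
move=> /andP[t0 t1] N0.
have t2 : 0 <= tau ^+ 2 <= tau / 20.
  by rewrite sqr_ge0/= expr2; apply: ler_wpM2l; [exact: ltW | lra].
have t3 : 0 <= tau ^+ 3 <= tau / 20.
  rewrite exprn_ge0 ?(ltW t0)//= exprS; apply: ler_wpM2l; [exact: ltW | lra].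
have t4 : 0 <= tau ^+ 4 <= tau / 20.
  rewrite exprn_ge0 ?(ltW t0)//= exprS; apply: ler_wpM2l; [exact: ltW | lra].
have tp : 0 < 1 + tau by lra.
move=> /andP[z1 z2] d1 d2 d3 d4 y1 y2 y3 y4; apply/andP; split.
  rewrite -(ler_pM2l tp) -(ler_pM2l tp).
  have a1 : (1 - tau - tau ^+ 2) * N <= (1 + tau) * y * N by apply: ler_wpM2r => //; lra.
  have tm : 0 <= 1 - tau by lra.
  have := ler_wpM2l tm a1.
  have a2 : z - N * (tau ^+ 2 + tau) <= (1 + tau) * x by lra.
  have := ler_wpM2l (ltW tp) a2; have := ler_wpM2l (ltW tp) z1.
  have : 0 <= N * (8 * tau - 15 * tau ^+ 2 - 15 * tau ^+ 3) by apply: mulr_ge0 => //; lra.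
  have : 0 <= N * tau ^+ 2 by apply: mulr_ge0 => //; lra.
  have : 0 <= N * tau ^+ 3 by apply: mulr_ge0 => //; lra.
  lra.
have a1 : y * N <= (1 + tau) ^+ 2 * N by apply: ler_wpM2r => //; lra.
have a2 : z <= (1 + tau) * (y * N) by lra.
have a3 := ler_wpM2l (ltW tp) (ler_wpM2l (ltW tp) a1).
have a4 := ler_wpM2l (ltW tp) a2.
have : 0 <= N * (5 * tau - 7 * tau ^+ 2 - 4 * tau ^+ 3 - tau ^+ 4) by apply: mulr_ge0 => //; lra.
lra.
Qed.

Section SpanConcentration.
Context {R : realType} {d : measure_display} {T : measurableType d}
  (P : probability T R) {n p : nat} (mu : probability (p.-tuple R) R)
  (Sigma : 'M[R]_p) (X : T -> 'M[R]_(n, p)).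
Hypothesis Sigma_pos : positive_definite Sigma.
Hypothesis gauss : centered_gaussian Sigma mu.
Hypothesis rows : iid P (row_tuple X) mu.
Context {k K : nat} (F : 'M[R]_(k, p)).
Hypothesis K_gt0 : (0 < K)%N.

(** In orthonormal coordinates the linear form has norm [|phi|], attained at [phi / |phi|]. A grid
    point within eps of this direction keeps a fraction 1 - eps of the value and has norm at most 1
    + eps. The loss is multiplicative, so a mesh of order eps / sqrt k is enough. *)
Lemma whp_cross_span (u : 'rV[R]_p) (e eps : R) :
  0 <= e <= 1 / 400 -> 0 < eps < 1 -> k%:R <= eps ^+ 2 * K%:R ^+ 2 ->
  (forall a : 'rV_k, bil Sigma u (a *m F) = 0) ->
  whp P (((2 * K + 1) ^ k)%:R * (4 * expR (- (n%:R * (9 / 40 * e ^+ 2)))))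
    (fun w => forall a : 'rV_k, bil (gram (X w)) u (a *m F) ^+ 2 <=
      ((1 + eps) / (1 - eps)) ^+ 2 * (n%:R * e) ^+ 2 * bil Sigma u u
      * bil Sigma (a *m F) (a *m F)).
Proof.
move=> e01 /andP[eps0 eps1] kK uF.
have [A [_ [AA _ _]]] := gauss.
have [N [C [NE Nle FN _]]] := orthonormal_span F Sigma_pos AA.
have := whp_all (fun g : {ffun 'I_k -> 'I_(2 * K + 1)} =>
  whp_cross Sigma_pos gauss rows (v := grid g *m N) e01 _).
rewrite card_ffun !card_ord => /(_ u) H; apply: whp_mono (H _) => // [w {}H a|g]; last first.
  by rewrite NE mulmxA.
set G := gram (X w) in H *; set U := bil Sigma u u in H *.
have [b -> <-] := FN a.
pose phi : 'rV[R]_k := \row_i bil G u (row i N).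
have phiE c : bil G u (c *m N) = bil 1%:M c phi.
  rewrite mulmx_sum_row bil_sumr bil1E; apply: eq_bigr => i _.
  by rewrite bilZr mxE.
have U0 : 0 <= U by rewrite /U -AA bil_cholesky bil1_ge0.
rewrite phiE; apply: le_trans (bil1_CS _ _) _; rewrite mulrC.
apply: ler_wpM2r; first exact: bil1_ge0.
have [p0|pn0] := eqVneq (bil 1%:M phi phi) 0.
  by rewrite p0; apply: mulr_ge0 => //; apply: mulr_ge0; exact: sqr_ge0.
have pp : 0 < bil 1%:M phi phi by rewrite lt_neqAle eq_sym pn0 bil1_ge0.
set s := Num.sqrt (bil 1%:M phi phi).
have s0 : 0 < s by rewrite sqrtr_gt0.
have ss : s ^+ 2 = bil 1%:M phi phi by rewrite sqr_sqrtr// ltW.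
have sn0 : s != 0 by rewrite gt_eqF.
pose b0 := s^-1 *: phi.
have b0b0 : bil 1%:M b0 b0 = 1 by rewrite bilZl bilZr -ss; field.
have b0p : bil 1%:M b0 phi = s by rewrite bilZl -ss; field.
have b0le : bil 1%:M b0 b0 <= 1 by rewrite b0b0.
have [g hg] := grid_approx K_gt0 b0le.
set D := b0 - grid g in hg.
have KR : 0 < K%:R :> R by rewrite ltr0n.
have {}hg : bil 1%:M D D <= eps ^+ 2 by apply: le_trans hg _; rewrite ler_pdivrMr ?exprn_gt0.
have gE : grid g = b0 - D by rewrite /D subKr.
clearbody D b0.
have nle (x y : R) : 0 <= y -> x ^+ 2 <= y ^+ 2 -> `|x| <= y.
  by move=> y0 xy; rewrite -(@ler_pXn2r _ 2) ?nnegrE// real_normK ?num_real.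
have h1 : `|bil 1%:M D phi| <= eps * s.
  apply: nle; first by apply: mulr_ge0; exact: ltW.
  by apply: le_trans (bil1_CS _ _) _; rewrite exprMn ss ler_wpM2r ?bil1_ge0.
have h2 : `|bil 1%:M D b0| <= eps.
  by apply: nle; [exact: ltW | apply: le_trans (bil1_CS _ _) _; rewrite b0b0 mulr1].
have h3 : (1 - eps) * s <= bil 1%:M (grid g) phi.
  by rewrite gE bilBl b0p; move: h1; rewrite ler_norml => /andP[? ?]; lra.
have h4 : bil 1%:M (grid g) (grid g) <= (1 + eps) ^+ 2.
  rewrite gE bilBl !bilBr b0b0 (bilC b0 D) ?trmx1//.
  by move: h2; rewrite ler_norml => /andP[? ?]; lra.
have h5 : (1 - eps) ^+ 2 * s ^+ 2 <= (n%:R * e) ^+ 2 * U * (1 + eps) ^+ 2.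
  apply: (@le_trans _ _ (bil G u (grid g *m N) ^+ 2)).
    rewrite phiE -exprMn lerXn2r ?nnegrE//; last by apply: le_trans h3; apply: mulr_ge0; lra.
    by apply: mulr_ge0; lra.
  apply: le_trans (H g) _; apply: ler_wpM2l; first by rewrite mulr_ge0 ?sqr_ge0.
  exact: le_trans (Nle _) h4.
have c0 : 0 < (1 - eps) ^+ 2 by rewrite exprn_gt0// subr_gt0.
rewrite -ss exprMn exprVn -(ler_pM2l c0); apply: le_trans h5 _.
rewrite le_eqVlt; apply/orP; left; apply/eqP; field; lra.
Qed.

(** Here tau is at once the deviation at grid points, the parameter of Young's inequality and the
    accuracy of the grid; together these losses stay below 10 tau. *)
Lemma whp_norm_span (tau : R) :
  0 < tau <= 1 / 400 -> (0 < k)%N -> 2 * k%:R ^+ 2 <= tau ^+ 2 * K%:R ^+ 2 ->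
  whp P (((2 * K + 1) ^ k)%:R * (2 * expR (- (n%:R * (9 / 40 * tau ^+ 2)))))
    (fun w => forall a : 'rV_k, let v := a *m F in
      (1 - 10 * tau) * n%:R * bil Sigma v v <= bil (gram (X w)) v v
      <= (1 + 10 * tau) * n%:R * bil Sigma v v).
Proof.
move=> /andP[t0 t1] k0 kK.
have t01 : 0 <= tau <= 1 / 400 by rewrite (ltW t0).
have [A [_ [AA _ _]]] := gauss.
have [N [C [NE Nle FN _]]] := orthonormal_span F Sigma_pos AA.
have := whp_all (fun g : {ffun 'I_k -> 'I_(2 * K + 1)} =>
  whp_norm Sigma_pos gauss rows (grid g *m N) t01).
rewrite card_ffun !card_ord; apply: whp_mono => // w H a /=.
set G := gram (X w) in H *.
have [b aE bb] := FN a; rewrite aE in bb *; rewrite -bb.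
have SG : G^T = G by exact: gram_sym.
have scale_inv (c : R) (x : 'rV[R]_p) : (1 - 10 * tau) * n%:R <= bil G x x <= (1 + 10 * tau) * n%:R ->
    (1 - 10 * tau) * n%:R * c ^+ 2 <= bil G (c *: x) (c *: x) <= (1 + 10 * tau) * n%:R * c ^+ 2.
  move=> /andP[h1 h2]; rewrite bilZl bilZr mulrA -expr2 (mulrC _ (bil G x x)).
  by rewrite !ler_wpM2r ?sqr_ge0.
have [->|bn0] := eqVneq b 0; first by rewrite mul0mx !bil0l !mulr0 lexx.
have q0 := bil1_gt0 bn0; set s := Num.sqrt (bil 1%:M b b).
have s0 : 0 < s by rewrite sqrtr_gt0.
have ss : s ^+ 2 = bil 1%:M b b by rewrite sqr_sqrtr// ltW.
have sn0 : s != 0 by rewrite gt_eqF.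
pose b0 := s^-1 *: b.
have b0b0 : bil 1%:M b0 b0 = 1 by rewrite bilZl bilZr -ss; field.
have bE : b *m N = s *: (b0 *m N) by rewrite /b0 -scalemxAl scalerA divff// scale1r.
rewrite bE -ss; apply: scale_inv.
have b0le : bil 1%:M b0 b0 <= 1 by rewrite b0b0.
have [g hg] := grid_approx K_gt0 b0le.
set D := b0 - grid g in hg.
have KR : 0 < K%:R :> R by rewrite ltr0n.
have kR : 0 < k%:R :> R by rewrite ltr0n.
have kR1 : 1 <= k%:R :> R by rewrite ler1n.
have {}hg : 2 * k%:R * bil 1%:M D D <= tau ^+ 2.
  apply: (@le_trans _ _ (2 * k%:R * (k%:R / K%:R ^+ 2))).
    by apply: ler_wpM2l => //; apply: mulr_ge0 => //; exact: ltW.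
  rewrite (_ : 2 * k%:R * (k%:R / K%:R ^+ 2) = 2 * k%:R ^+ 2 / K%:R ^+ 2); last by field; rewrite gt_eqF.
  by rewrite ler_pdivrMr ?exprn_gt0.
have n0 : 0 <= n%:R :> R by [].
have v0E : b0 *m N = grid g *m N + D *m N by rewrite -mulmxDl /D subrKC.
have wE : grid g *m N = b0 *m N + (- D) *m N by rewrite -mulmxDl /D opprB subrKC.
have young (H' : 'M[R]_p) (x y : 'rV[R]_p) : (exists m (M : 'M[R]_(m, p)), H' = gram M) ->
    bil H' (x + y) (x + y) <= (1 + tau) * bil H' x x + (1 + tau^-1) * bil H' y y.
  move=> [m [M ->]]; have := bil_amgm M x y t0; rewrite bil_sqrD ?gram_sym//; lra.
have gG : exists m (M : 'M[R]_(m, p)), G = gram M by exists n, (X w).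
have gS : exists m (M : 'M[R]_(m, p)), Sigma = gram M.
  by exists p, A^T; rewrite /gram trmxK.
have basisG i : bil G (delta_mx 0 i *m N) (delta_mx 0 i *m N) <= 2 * n%:R.
  have [gi giE] := grid_delta (R := R) i K_gt0; have := H gi; rewrite giE ler_norml => /andP[_ h].
  have h2 : bil Sigma (delta_mx 0 i *m N) (delta_mx 0 i *m N) <= 1.
    apply: le_trans (Nle _) _; rewrite bil1E (bigD1 i)//= mxE !eqxx mulr1 big1 ?addr0// => j ji.
    by rewrite mxE eqxx (negbTE ji) mulr0.
  have := ler_wpM2l n0 h2; have := ler_wpM2l (mulr_ge0 n0 (ltW t0)) h2.
  have : n%:R * tau <= n%:R * 1 by apply: ler_wpM2l => //; lra.
  lra.
have DG c : bil 1%:M c c = bil 1%:M D D -> bil G (c *m N) (c *m N) <= n%:R * tau ^+ 2.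
  move=> cD; have -> : bil G (c *m N) (c *m N) = bil (gram (X w *m N^T)) c c.
    by rewrite /bil /G /gram !trmx_mul trmxK !mulmxA.
  apply: le_trans (bil_gram_le_trace _ _) _; rewrite cD.
  apply: (@le_trans _ _ (bil 1%:M D D * (k%:R * (2 * n%:R)))).
    apply: ler_wpM2l; first exact: bil1_ge0.
    apply: (@le_trans _ _ (\sum_(i < k) 2 * n%:R)); last by rewrite sumr_const card_ord -[leLHS]mulr_natl.
    apply: ler_sum => i _; apply: le_trans (basisG i).
    by rewrite /bil /G /gram !trmx_mul trmxK !mulmxA.
  have := ler_wpM2l n0 hg; lra.
have DS c : bil 1%:M c c = bil 1%:M D D -> bil Sigma (c *m N) (c *m N) <= tau ^+ 2.
  move=> cD; apply: le_trans (Nle _) _; rewrite cD; apply: le_trans hg.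
  by apply: ler_peMl; [exact: bil1_ge0 | lra].
have DN : bil 1%:M (- D) (- D) = bil 1%:M D D by rewrite bilNl bilNr opprK.
have v0S : bil Sigma (b0 *m N) (b0 *m N) = 1.
  move: bb; rewrite bE bilZl bilZr mulrA -expr2 ss => /esym/(canRL (mulKf _)) ->.
    by rewrite mulVf // gt_eqF.
  by rewrite gt_eqF.
set v0 := b0 *m N in v0E wE v0S *; set w0 := grid g *m N in v0E wE.
have Hg := H g; rewrite -/w0 ler_norml in Hg.
have y1 := young _ w0 (D *m N) gS; have y2 := young _ v0 ((- D) *m N) gS.
have y3 := young _ w0 (D *m N) gG; have y4 := young _ v0 ((- D) *m N) gG.
have d1 := DS _ (erefl _); have d2 := DS _ DN.
have d3 := DG _ (erefl _); have d4 := DG _ DN.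
move: y1 y2 y3 y4; rewrite -v0E -wE v0S.
have tinv : (1 + tau^-1) * tau ^+ 2 = tau ^+ 2 + tau by field; rewrite gt_eqF.
have ti0 : 0 <= 1 + tau^-1 by rewrite addr_ge0// invr_ge0 ltW.
have {}d1 := ler_wpM2l ti0 d1; have {}d2 := ler_wpM2l ti0 d2.
have {}d3 := ler_wpM2l ti0 d3; have {}d4 := ler_wpM2l ti0 d4.
rewrite tinv in d1 d2; rewrite mulrCA tinv in d3 d4.
move: Hg d1 d2 d3 d4.
have t20 : 0 < tau <= 1 / 20 by rewrite t0/=; lra.
exact: perturbed_norm_bounds t20 n0.
Qed.

End SpanConcentration.

(** * Sparse vectors and union bounds over supports *)

Section Supports.
Context {R : realType} {p : nat}.
Implicit Types (S : {set 'I_p}) (u v : 'rV[R]_p).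

Definition supp_in S v : Prop := forall i, i \notin S -> v 0 i = 0.

Definition unit_rv (j : 'I_p) : 'rV[R]_p := delta_mx 0 j.

Lemma supp_in0 S : supp_in S 0.
Proof. by move=> i _; rewrite mxE. Qed.

Lemma supp_inD S u v : supp_in S u -> supp_in S v -> supp_in S (u + v).
Proof. by move=> Su Sv i iS; rewrite mxE Su ?Sv ?addr0. Qed.

Lemma supp_inZ S a v : supp_in S v -> supp_in S (a *: v).
Proof. by move=> Sv i iS; rewrite mxE Sv ?mulr0. Qed.

Lemma supp_inN S v : supp_in S v -> supp_in S (- v).
Proof. by move=> Sv i iS; rewrite mxE Sv ?oppr0. Qed.

Lemma supp_inB S u v : supp_in S u -> supp_in S v -> supp_in S (u - v).
Proof. by move=> Su Sv; apply: supp_inD => //; exact: supp_inN. Qed.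

Lemma supp_inS S S' v : S \subset S' -> supp_in S v -> supp_in S' v.
Proof. by move=> SS Sv i iS'; apply: Sv; apply: contra iS' => /(fintype.subsetP SS). Qed.

Lemma supp_unit S j : j \in S -> supp_in S (unit_rv j).
Proof. by move=> jS i iS; rewrite mxE eqxx; case: eqP iS => // ->; rewrite jS. Qed.

Lemma supp_sum S (I : Type) (r : seq I) (Q : pred I) (F : I -> 'rV[R]_p) :
  (forall i, Q i -> supp_in S (F i)) -> supp_in S (\sum_(i <- r | Q i) F i).
Proof.
move=> SF; elim/big_rec: _ => [|i v Qi Sv]; first exact: supp_in0.
by apply: supp_inD => //; exact: SF.
Qed.

Lemma supp_decomp S v : supp_in S v -> v = \sum_(i in S) v 0 i *: unit_rv i.
Proof.
move=> Sv; rewrite [LHS]row_sum_delta (bigID (mem S))/= [X in _ + X]big1 ?addr0//.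
by move=> i iS; rewrite Sv// scale0r.
Qed.

Lemma supp_eq0 v : supp_in finset.set0 v -> v = 0.
Proof. by move=> Sv; apply/rowP => i; rewrite mxE Sv ?inE. Qed.

(** Supports are indexed by functions, repetitions allowed: p^k of them reach every nonempty set of
    at most k vertices, smaller sets by repeating a vertex. *)
Definition selection k (f : {ffun 'I_k -> 'I_p}) : 'M[R]_(k, p) := \matrix_i unit_rv (f i).

Lemma selection_delta k (f : {ffun 'I_k -> 'I_p}) i :
  delta_mx 0 i *m selection f = unit_rv (f i).
Proof. by rewrite -rowE rowK. Qed.

Lemma selection_supp S k : S != finset.set0 -> (#|S| <= k)%N ->
  exists f : {ffun 'I_k -> 'I_p},
    (forall a : 'rV_k, supp_in S (a *m selection f)) /\
    (forall v, supp_in S v -> exists a : 'rV_k, v = a *m selection f).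
Proof.
move=> /set0Pn[x0 x0S] Sk; pose f := [ffun i : 'I_k => nth x0 (enum S) i].
have fS i : f i \in S.
  rewrite ffunE; have [iS|Si] := ltnP i (size (enum S)).
    by rewrite -(mem_enum S) mem_nth.
  by rewrite nth_default.
exists f; split => [a|v Sv].
  rewrite mulmx_sum_row; apply: supp_sum => i _; apply: supp_inZ.
  by rewrite rowK; exact: supp_unit.
have k0 : (0 < k)%N by apply: leq_trans Sk; apply/card_gt0P; exists x0.
have idx x : x \in S -> exists i : 'I_k, f i = x.
  move=> xS; have xk : (index x (enum S) < k)%N.
    by apply: leq_trans Sk; rewrite cardE index_mem mem_enum.
  by exists (Ordinal xk); rewrite ffunE/= nth_index// mem_enum.
have [g gP] : exists g : 'I_p -> 'I_k, forall x, x \in S -> f (g x) = x.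
  have H x : exists i : 'I_k, x \in S -> f i = x.
    by case: (boolP (x \in S)) => [/idx[i fi]|_]; [exists i|exists (Ordinal k0)].
  by have [g gP] := boolp.choice H; exists g.
exists (\sum_(x in S) v 0 x *: delta_mx 0 (g x)).
rewrite {1}(supp_decomp Sv) mulmx_suml; apply: eq_bigr => x xS.
by rewrite -scalemxAl selection_delta gP.
Qed.

End Supports.

Section SparseConcentration.
Context {R : realType} {d : measure_display} {T : measurableType d}
  (P : probability T R) {n p : nat} (mu : probability (p.-tuple R) R)
  (Sigma : 'M[R]_p) (X : T -> 'M[R]_(n, p)).
Hypothesis Sigma_pos : positive_definite Sigma.
Hypothesis gauss : centered_gaussian Sigma mu.
Hypothesis rows : iid P (row_tuple X) mu.
Context (k K : nat).
Hypothesis K_gt0 : (0 < K)%N.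

Lemma whp_norm_sparse (tau : R) :
  0 < tau <= 1 / 400 -> (0 < k)%N -> 2 * k%:R ^+ 2 <= tau ^+ 2 * K%:R ^+ 2 ->
  whp P ((p ^ k)%:R * (((2 * K + 1) ^ k)%:R * (2 * expR (- (n%:R * (9 / 40 * tau ^+ 2))))))
    (fun w => forall (S : {set 'I_p}) v, (#|S| <= k)%N -> supp_in S v ->
      (1 - 10 * tau) * n%:R * bil Sigma v v <= bil (gram (X w)) v v
      <= (1 + 10 * tau) * n%:R * bil Sigma v v).
Proof.
move=> tau01 k0 kK.
have := whp_all (fun f : {ffun 'I_k -> 'I_p} =>
  whp_norm_span Sigma_pos gauss rows (selection f) K_gt0 tau01 k0 kK).
rewrite card_ffun !card_ord; apply: whp_mono => // w H S v Sk Sv.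
have [S0|S0] := eqVneq S finset.set0.
  by move: Sv; rewrite S0 => /supp_eq0 ->; rewrite !bil0l !mulr0 lexx.
have [f [_ fv]] := selection_supp (R := R) S0 Sk.
by have [a ->] := fv _ Sv; exact: H.
Qed.

(** This is the vector e_j - beta of the population regression of j on S. Positive definiteness
    makes it unique, so it depends on j and S only and not on the ordering from which it arises. *)
Definition residual_direction (j : 'I_p) (S : {set 'I_p}) (u : 'rV[R]_p) : Prop :=
  supp_in S (unit_rv j - u) /\ forall v, supp_in S v -> bil Sigma u v = 0.

Lemma whp_cross_sparse (e eps : R) :
  0 <= e <= 1 / 400 -> 0 < eps < 1 -> k%:R <= eps ^+ 2 * K%:R ^+ 2 ->
  whp P ((p * p ^ k)%:R * (((2 * K + 1) ^ k)%:R * (4 * expR (- (n%:R * (9 / 40 * e ^+ 2))))))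
    (fun w => forall j (S : {set 'I_p}) u v, (#|S| <= k)%N -> residual_direction j S u -> supp_in S v ->
      bil (gram (X w)) u v ^+ 2 <=
      ((1 + eps) / (1 - eps)) ^+ 2 * (n%:R * e) ^+ 2 * bil Sigma u u * bil Sigma v v).
Proof.
move=> e01 eps01 kK.
have [A [_ [AA _ _]]] := gauss.
have H (z : 'I_p * {ffun 'I_k -> 'I_p}) : exists u : 'rV[R]_p,
    (exists b : 'rV_k, unit_rv z.1 - u = b *m selection z.2) /\
    forall a : 'rV_k, bil Sigma u (a *m selection z.2) = 0.
  have [N [C [NE _ _ proj]]] := orthonormal_span (selection z.2) Sigma_pos AA.
  have [b _ ub] := proj (unit_rv z.1); exists (unit_rv z.1 - b *m N); split => //.
  by exists (b *m C); rewrite subKr NE mulmxA.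
have [U UP] := boolp.choice H.
have := whp_all (fun z => whp_cross_span Sigma_pos gauss rows K_gt0 e01 eps01 kK (UP z).2).
rewrite card_prod card_ffun !card_ord; apply: whp_mono => // w {}H j S u v Sk [uj uS] Sv.
have [S0|S0] := eqVneq S finset.set0.
  by move: Sv; rewrite S0 => /supp_eq0 ->; rewrite !bil0r !mulr0 expr0n.
have [f [fS fv]] := selection_supp (R := R) S0 Sk.
(* The event was built for one chosen residual per pair. Any other one agrees with it: their
   difference lies in the span and is Sigma-orthogonal to it. *)
suff -> : u = U (j, f) by have [a ->] := fv _ Sv; exact: H.
have [[b ub] Uf] := UP (j, f).
have [a ab] : exists a : 'rV_k, U (j, f) - u = a *m selection f.
  apply: fv; have -> : U (j, f) - u = (unit_rv j - u) - (unit_rv j - U (j, f)).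
    by apply/rowP => i; rewrite !mxE; ring.
  by apply: supp_inB => //; rewrite ub; exact: fS.
have : bil Sigma (U (j, f) - u) (U (j, f) - u) = 0.
  by rewrite bilBl {1}ab Uf uS ?subr0// ab; exact: fS.
move=> H0; apply/eqP; rewrite eq_sym -subr_eq0; apply: contraT => /(proj2 Sigma_pos).
by rewrite -/(bil _ _ _) H0 ltxx.
Qed.

End SparseConcentration.

(** * Residual sums of squares *)

Section LeastSquares.
Context {R : realType} {n p : nat} (X : 'M[R]_(n, p)).
Implicit Types (S : {set 'I_p}) (b v y : 'rV[R]_p).
Let G := gram X.

(** These are the normal equations, with coefficients kept in the full coordinate space so that
    regressions on different sets can be subtracted. *)
Definition least_squares y S b : Prop :=
  supp_in S b /\ forall v, supp_in S v -> bil G (y - b) v = 0.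

Definition set_rows S : 'M[R]_(#|S|, p) := \matrix_k unit_rv (enum_val k).

Lemma set_rowsK S : set_rows S *m (set_rows S)^T = 1%:M.
Proof.
apply/row_matrixP => k; rewrite row_mul rowK -[in RHS](mul1mx 1%:M) row_mul mulmx1.
apply/rowP => l; rewrite !mxE (bigD1 (enum_val k))//= !mxE !eqxx mul1r big1 => [|i ik].
  by rewrite addr0 (inj_eq enum_val_inj).
by rewrite !mxE (negbTE ik) mul0r.
Qed.

Lemma set_rows_supp S (a : 'rV_#|S|) : supp_in S (a *m set_rows S).
Proof.
rewrite mulmx_sum_row; apply: supp_sum => k _; apply: supp_inZ.
by rewrite rowK; apply: supp_unit; exact: enum_valP.
Qed.

Lemma supp_set_rows S v : supp_in S v -> exists a : 'rV_#|S|, v = a *m set_rows S.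
Proof.
move=> Sv; exists (\row_k v 0 (enum_val k)).
rewrite {1}(supp_decomp Sv) mulmx_sum_row big_enum_val/=.
by apply: eq_bigr => k _; rewrite rowK mxE.
Qed.

Lemma cols_set_rows S : cols X S = X *m (set_rows S)^T.
Proof.
apply/matrixP => i k; rewrite !mxE (bigD1 (enum_val k))//= !mxE !eqxx mulr1.
by rewrite big1 ?addr0// => l lk; rewrite !mxE (negbTE lk) mulr0.
Qed.

Hypothesis (S : {set 'I_p}).
Hypothesis G_pos : forall v, supp_in S v -> v != 0 -> 0 < bil G v v.

Let W := (cols X S)^T *m cols X S.

Let WE : W = set_rows S *m G *m (set_rows S)^T.
Proof. by rewrite /W cols_set_rows trmx_mul trmxK /G /gram !mulmxA. Qed.

Let W_unit : W \in unitmx.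
Proof.
rewrite unitmxE unitfE; apply/negP => /det0P[a a0 aW].
have aE : a *m set_rows S != 0.
  apply: contra_neq a0 => aE.
  by rewrite -(mulmx1 a) -set_rowsK mulmxA aE mul0mx.
have := G_pos (set_rows_supp a) aE.
have -> : bil G (a *m set_rows S) (a *m set_rows S) = (a *m W *m a^T) 0 0.
  by rewrite /bil WE trmx_mul !mulmxA.
by rewrite aW mul0mx mxE ltxx.
Qed.

Lemma least_squares_ex y : exists b, least_squares y S b.
Proof.
exists (y *m G *m (set_rows S)^T *m invmx W *m set_rows S); split.
  exact: set_rows_supp.
move=> _ /supp_set_rows[a ->].
rewrite bilBl /bil trmx_mul; set E := set_rows S; set y1 := y *m G *m E^T.
have -> : y1 *m invmx W *m E *m G *m (E^T *m a^T) =
          y1 *m invmx W *m (E *m G *m E^T) *m a^T by rewrite !mulmxA.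
by rewrite -WE mulmxKV// /y1 !mulmxA subrr.
Qed.

Lemma rss_least_squares j b : least_squares (unit_rv j) S b ->
  rss X j S = bil G (unit_rv j - b) (unit_rv j - b).
Proof.
move=> [Sb bS]; rewrite bilBr (bS b Sb) subr0.
have XE : X *m (unit_rv j)^T = col j X.
  apply/colP => i; rewrite !mxE (bigD1 j)//= !mxE !eqxx mulr1.
  by rewrite big1 ?addr0// => l lk; rewrite !mxE (negbTE lk) mulr0.
have [a aE] := supp_set_rows Sb; set E := set_rows S in aE.
have aW : a *m W = unit_rv j *m G *m E^T.
  apply/eqP; rewrite eq_sym -subr_eq0; apply/eqP/rowP => k.
  have := bS (unit_rv (enum_val k)) (supp_unit (enum_valP k)).
  rewrite aE /bil WE -/E => h; rewrite [RHS]mxE -[RHS]h.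
  have -> : a *m (E *m G *m E^T) = a *m E *m G *m E^T by rewrite !mulmxA.
  rewrite -!mulmxBl; rewrite [in RHS](_ : unit_rv (enum_val k) = row k E); last by rewrite rowK.
  by rewrite tr_row colE mulmxA -colE [RHS]mxE.
have -> : b = unit_rv j *m G *m E^T *m invmx W *m E by rewrite -aW mulmxK.
rewrite /rss /proj_cols -/W cols_set_rows -/E -XE bilBl /bil mulmxBr mulmx1 mulmxBl.
rewrite mxE [X in _ + X]mxE; congr (_ - _); first by rewrite trmx_mul trmxK /G /gram !mulmxA.
by rewrite !trmx_mul !trmxK /G /gram !mulmxA.
Qed.

End LeastSquares.

Lemma leq_2d1 m d : (m <= d -> m <= 2 * d + 1)%N. Proof. lia. Qed.

Lemma leq_2d m d : (m <= d -> m <= 2 * d)%N. Proof. lia. Qed.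

Lemma leq_2d_2d1 m d : (m <= 2 * d -> m <= 2 * d + 1)%N. Proof. lia. Qed.

Lemma unit_rvE (R : realType) p (j i : 'I_p) : unit_rv (R := R) j 0 i = (i == j)%:R.
Proof. by rewrite mxE. Qed.

Lemma unit_norm (R : realType) p (i : 'I_p) : bil 1%:M (unit_rv i) (unit_rv i) = 1 :> R.
Proof.
rewrite bil1E (bigD1 i)//= unit_rvE eqxx mulr1 big1 ?addr0// => l li.
by rewrite unit_rvE (negbTE li) mulr0.
Qed.

Lemma unit_combE (R : realType) p (T : {set 'I_p}) (c : 'I_p -> R) i :
  (\sum_(l in T) c l *: unit_rv l) 0 i = if i \in T then c i else 0.
Proof.
rewrite summxE; case: ifPn => iT.
  rewrite (bigD1 i)//= mxE unit_rvE eqxx mulr1 big1 ?addr0// => l /andP[_ li].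
  by rewrite mxE unit_rvE eq_sym (negbTE li) mulr0.
rewrite big1// => l lT; rewrite mxE unit_rvE; case: eqP iT => [->|_ _]; last by rewrite mulr0.
by rewrite lT.
Qed.

Lemma swap_gain_bound (R : realFieldType) (N nl nh q t dd P y2 B' B2 V x1 x2 bl I D L : R) :
  0 < N -> 0 < nl -> nl <= nh -> 0 <= dd -> 0 <= L -> 0 <= V -> 0 <= B2 -> 0 <= y2 ->
  P = 14 / 13 * (14 * dd + 10) * L * nh ->
  20 * (8 * dd + 12) * nh * L <= N * nl * B2 ->
  y2 = x1 + x2 -> x1 ^+ 2 <= P * y2 -> x2 ^+ 2 <= (N * (nh - nl) / 2) ^+ 2 * B' * V ->
  B' <= B2 -> N * nl * V <= y2 ->
  1 <= t -> (4 * nh ^+ 2 * nl ^- 4 * (nh - nl) ^+ 2 + 1) * t <= q ->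
  q * bl ^+ 2 <= V -> I <= bl ^+ 2 * (N * nh) ->
  4 * (N * nl ^+ 2 * B2) <= 9 * (t * nh * D) ->
  N * nl ^+ 2 * B2 <= 9 * (t * nh * (D - I)).
Proof.
move=> N0 nl0 nlh dd0 L0 V0 B20 y20 PE B2min yE x1P x2P BB yV t1 qt qV IN D4.
have nh0 : 0 < nh by exact: lt_le_trans nlh.
have t0 : 0 < t by exact: lt_le_trans t1.
set h := nh - nl; have h0 : 0 <= h by rewrite subr_ge0.
have nhE : nh = nl + h by rewrite /h subrKC.
have nl4 : 0 < nl ^+ 4 by rewrite exprn_gt0.
have q0 : 0 < q.
  apply: lt_le_trans qt; apply: mulr_gt0 => //.
  apply: ltr_wpDl => //; apply: mulr_ge0; last exact: sqr_ge0.
  by rewrite mulr_ge0 ?mulr_ge0 ?sqr_ge0 ?invr_ge0 ?ltW.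
have Nnl : 0 < N * nl by rewrite mulr_gt0.
have P0 : 0 <= P.
  by rewrite PE; apply: mulr_ge0; [apply: mulr_ge0 => //; lra | exact: ltW].
(* From [y2 ^+ 2 <= 2 * x1 ^+ 2 + 2 * x2 ^+ 2]; both bounds on the right become linear in [y2] once
   [V] is replaced by [y2 / (N * nl)], and one factor [y2] cancels. *)
have y2_le : nl * y2 <= 2 * (nl * P) + N * h ^+ 2 / 2 * B2.
  move: y20; rewrite le_eqVlt => /orP[/eqP <-|y2p].
    rewrite mulr0; apply: addr_ge0.
      by apply: mulr_ge0 => //; apply: mulr_ge0 => //; exact: ltW.
    by apply: mulr_ge0 => //; apply: mulr_ge0 => //; apply: mulr_ge0; [exact: ltW | exact: sqr_ge0].
  have e1 : y2 ^+ 2 <= 2 * (P * y2) + 2 * ((N * h / 2) ^+ 2 * B2 * V).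
    apply: (@le_trans _ _ (2 * x1 ^+ 2 + 2 * x2 ^+ 2)).
      rewrite -subr_ge0 yE [leRHS](_ : _ = (x1 - x2) ^+ 2) ?sqr_ge0//; ring.
    apply: lerD; apply: ler_wpM2l => //; apply: le_trans x2P _.
    by apply: ler_wpM2r => //; apply: ler_wpM2l => //; exact: sqr_ge0.
  have c0 : 0 <= 2 * ((N * h / 2) ^+ 2 * B2).
    by apply: mulr_ge0 => //; apply: mulr_ge0 => //; exact: sqr_ge0.
  have e2 := ler_wpM2l c0 yV.
  have e3 := ler_wpM2l (ltW Nnl) e1.
  rewrite -(ler_pM2l (mulr_gt0 N0 y2p)).
  rewrite [leLHS](_ : _ = N * nl * y2 ^+ 2); last by ring.
  apply: le_trans e3 _; rewrite mulrDr.
  rewrite [leLHS](_ : _ = 2 * N * nl * P * y2 + 2 * ((N * h / 2) ^+ 2 * B2) * (N * nl * V)); last by ring.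
  rewrite [leRHS](_ : _ = 2 * N * nl * P * y2 + 2 * ((N * h / 2) ^+ 2 * B2) * y2); last by field.
  by rewrite lerD2l.
(* The noise constant 14 dd + 10 meets the signal constant 20 (8 dd + 12); their ratio, with the
   factors 2 and 14/13, is below 19/100 for every dd >= 0. *)
have PB : 2 * (nl * P) <= 19 / 100 * (N * nl ^+ 2 * B2).
  have nlB := ler_wpM2l (ltW nl0) B2min.
  have k1 : 0 <= nl * (L * nh) by apply: mulr_ge0; [exact: ltW | apply: mulr_ge0 => //; exact: ltW].
  have k2 : 0 <= dd * (nl * (L * nh)) by apply: mulr_ge0.
  rewrite PE; lra.
have qI : q * nl ^+ 2 * I <= N * B2 * nh * (19 / 100 * nl ^+ 2 + h ^+ 2 / 2).
  have f1 : q * nl ^+ 2 * I <= q * nl ^+ 2 * (bl ^+ 2 * (N * nh)).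
    by apply: ler_wpM2l => //; apply: mulr_ge0; [exact: ltW | exact: sqr_ge0].
  have f2 : N * nh * nl ^+ 2 * (q * bl ^+ 2) <= N * nh * nl ^+ 2 * V.
    by apply: ler_wpM2l => //; rewrite !mulr_ge0 ?sqr_ge0 ?ltW.
  have f3 : nh * nl * (N * nl * V) <= nh * nl * y2.
    by apply: ler_wpM2l => //; apply: mulr_ge0; exact: ltW.
  have f4 := ler_wpM2l (ltW nh0) (le_trans y2_le (lerD PB (lexx _))).
  lra.
(* A homogeneous quartic inequality in [nl] and [h], proved by substituting [nh = nl + h] and
   writing the difference as a sum of nonnegative terms. *)
have key : 9 * nh ^+ 2 * (19 / 100 * nl ^+ 2 + h ^+ 2 / 2) <= 3 * (4 * nh ^+ 2 * h ^+ 2 + nl ^+ 4).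
  rewrite -subr_ge0 nhE [leRHS](_ : _ = nl ^+ 2 * (129 / 100 * (nl - 4 / 3 * h) ^+ 2
    + nl * h / 50 + 1049 / 300 * h ^+ 2) + nl * h ^+ 3 * 15 + 15 / 2 * h ^+ 4); last by field.
  have g1 : 0 <= nl * h by apply: mulr_ge0 => //; exact: ltW.
  have g2 : 0 <= h ^+ 2 by exact: sqr_ge0.
  have g3 : 0 <= (nl - 4 / 3 * h) ^+ 2 by exact: sqr_ge0.
  have g4 : 0 <= h ^+ 4 by exact: exprn_ge0.
  have g5 : 0 <= nl * h ^+ 3 by apply: mulr_ge0; [exact: ltW | exact: exprn_ge0].
  have g6 : 0 <= nl ^+ 2 * (129 / 100 * (nl - 4 / 3 * h) ^+ 2 + nl * h / 50 + 1049 / 300 * h ^+ 2).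
    by apply: mulr_ge0; [exact: sqr_ge0 | lra].
  lra.
have qnl : t * (4 * nh ^+ 2 * h ^+ 2 + nl ^+ 4) <= q * nl ^+ 4.
  have := ler_wpM2r (ltW nl4) qt.
  by rewrite [leLHS](_ : _ = t * (4 * nh ^+ 2 * h ^+ 2 + nl ^+ 4)) -/h//; field; rewrite gt_eqF.
have NB0 : 0 <= N * B2 by apply: mulr_ge0 => //; exact: ltW.
have tnh : 0 <= 9 * t * nh by apply: mulr_ge0; [apply: mulr_ge0 => //; exact: ltW | exact: ltW].
have : 9 * (t * nh * I) <= 3 * (N * nl ^+ 2 * B2).
  have qn : 0 < q * nl ^+ 2 by rewrite mulr_gt0 ?exprn_gt0.
  rewrite -(ler_pM2l qn).
  have f1 := ler_wpM2l tnh qI.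
  have f2 := ler_wpM2l NB0 (ler_wpM2l (ltW t0) key).
  have f3 := ler_wpM2l NB0 qnl.
  lra.
lra.
Qed.

(** * Deletion, addition and exchange of parents *)

Section Geometry.
Context {R : realType} {n p : nat} (X : 'M[R]_(n, p)) (Sigma : 'M[R]_p) (d : nat)
  (nl nh dl L : R).
Let G := gram X.
Let N : R := n%:R.
Hypothesis N_gt0 : 0 < N.
Hypothesis nl_gt0 : 0 < nl.
Hypothesis nl_le : nl <= nh.
Hypothesis dl_bounds : 0 <= dl <= 1 / 40.
Hypothesis L_ge0 : 0 <= L.
Hypothesis Sigma_pos : positive_definite Sigma.
Hypothesis G_lower : forall (S : {set 'I_p}) v, (#|S| <= 2 * d + 1)%N -> supp_in S v ->
  N * nl * bil 1%:M v v <= bil G v v.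
Hypothesis G_upper : forall (S : {set 'I_p}) v, (#|S| <= 2 * d + 1)%N -> supp_in S v ->
  bil G v v <= N * nh * bil 1%:M v v.
Hypothesis G_Sigma : forall (S : {set 'I_p}) v, (#|S| <= 2 * d + 1)%N -> supp_in S v ->
  (1 - dl) * N * bil Sigma v v <= bil G v v.
Hypothesis G_cross : forall k, (k = d \/ k = 2 * d)%N ->
  forall j (S : {set 'I_p}) u v, (#|S| <= k)%N -> residual_direction Sigma j S u -> supp_in S v ->
  bil G u v ^+ 2 <= 21 / 20 * (7 * k%:R + 10) * L * N * bil Sigma u u * bil Sigma v v.

Variables (j : 'I_p) (A Sstar : {set 'I_p}) (u : 'rV[R]_p).
Hypothesis Sstar_A : Sstar \subset A.
Hypothesis Sstar_d : (#|Sstar| <= d)%N.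
Hypothesis u_supp : supp_in Sstar (unit_rv j - u).
Hypothesis u_orth : forall v, supp_in A v -> bil Sigma u v = 0.
Hypothesis u_norm : bil Sigma u u <= nh.

Let SG : G^T = G. Proof. exact: gram_sym. Qed.
Let SS : Sigma^T = Sigma. Proof. by case: Sigma_pos. Qed.
Let G_ge0 v : 0 <= bil G v v. Proof. exact: bil_gram_ge0. Qed.
Let nh_gt0 : 0 < nh. Proof. exact: lt_le_trans nl_gt0 nl_le. Qed.

Lemma bilSigma_ge0 v : 0 <= bil Sigma v v.
Proof.
have [->|v0] := eqVneq v 0; first by rewrite bil0l.
by case: Sigma_pos => _ /(_ v v0) /ltW.
Qed.

Lemma sparse_gram_gt0 (S : {set 'I_p}) v : (#|S| <= 2 * d + 1)%N -> supp_in S v -> v != 0 ->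
  0 < bil G v v.
Proof.
move=> Sd Sv v0; apply: lt_le_trans (G_lower Sd Sv).
by rewrite !mulr_gt0 ?bil1_gt0.
Qed.

Lemma unit_gram_le (i : 'I_p) : bil G (unit_rv i) (unit_rv i) <= N * nh.
Proof.
have := @G_upper [set i]%SET (unit_rv i); rewrite unit_norm mulr1; apply.
  by rewrite cards1 addn1.
by apply: supp_unit; rewrite inE.
Qed.

Lemma ls_ex (S : {set 'I_p}) y : (#|S| <= 2 * d + 1)%N -> exists b, least_squares X y S b.
Proof. by move=> Sd; apply: least_squares_ex => v; exact: sparse_gram_gt0. Qed.

Lemma rss_ls (S : {set 'I_p}) b : (#|S| <= 2 * d + 1)%N -> least_squares X (unit_rv j) S b ->
  rss X j S = bil G (unit_rv j - b) (unit_rv j - b).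
Proof. by move=> Sd; apply: rss_least_squares => v; exact: sparse_gram_gt0. Qed.

Lemma rss_min (S : {set 'I_p}) c : (#|S| <= 2 * d + 1)%N -> supp_in S c ->
  rss X j S <= bil G (unit_rv j - c) (unit_rv j - c).
Proof.
move=> Sd Sc; have [b lsb] := ls_ex (unit_rv j) Sd; rewrite (rss_ls Sd lsb).
have [Sb bS] := lsb.
have -> : unit_rv j - c = (unit_rv j - b) + (b - c).
  by apply/rowP => i; rewrite !mxE; ring.
rewrite (bil_sqrD _ (b - c))// (bS (b - c)); last exact: supp_inB.
by rewrite mulr0 addr0 lerDl.
Qed.

(** The fitted residual e_j - b is supported in S with j added, hence the sparsity 2 d + 1. It
    equals u plus a vector supported in A, which is Sigma-orthogonal to u, so its Sigma-norm is at
    least that of u. *)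
Lemma rss_lower (S : {set 'I_p}) : S \subset A -> (#|S| <= 2 * d)%N ->
  (1 - dl) * N * bil Sigma u u <= rss X j S.
Proof.
move=> SA Sd; have Sd1 : (#|S| <= 2 * d + 1)%N by rewrite (leq_trans Sd)// leq_addr.
have [b lsb] := ls_ex (unit_rv j) Sd1; rewrite (rss_ls Sd1 lsb); have [Sb _] := lsb.
have jS : (#|j |: S| <= 2 * d + 1)%N.
  by apply: leq_trans (leq_card_setU _ _) _; rewrite cards1 add1n addn1 ltnS.
have jSb : supp_in (j |: S) (unit_rv j - b).
  apply: supp_inB; first by apply: supp_unit; rewrite !inE eqxx.
  exact: supp_inS (finset.subsetUr _ _) Sb.
apply: le_trans (G_Sigma jS jSb); apply: ler_wpM2l.
  by apply: mulr_ge0; [move: dl_bounds; lra | exact: ltW].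
have -> : unit_rv j - b = u + ((unit_rv j - u) - b).
  by apply/rowP => i; rewrite !mxE; ring.
have Aw : supp_in A (unit_rv j - u - b); last first.
  by rewrite bil_sqrD// (u_orth Aw) mulr0 addr0 lerDl bilSigma_ge0.
by apply: supp_inB; [exact: supp_inS Sstar_A u_supp | exact: supp_inS SA Sb].
Qed.

Lemma rss_upper (S : {set 'I_p}) : (#|S| <= 2 * d + 1)%N -> rss X j S <= N * nh.
Proof.
by move=> Sd; apply: le_trans (rss_min Sd (@supp_in0 _ _ S)) _; rewrite subr0 unit_gram_le.
Qed.

Lemma residual_u (S : {set 'I_p}) : Sstar \subset S -> S \subset A ->
  residual_direction Sigma j S u.
Proof.
move=> sS SA; split; first exact: supp_inS sS u_supp.
by move=> v Sv; apply: u_orth; exact: supp_inS SA Sv.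
Qed.

(** Replaces the population norm of v by the empirical one, at the price of 40/39: 21/20 * 40/39 =
    14/13. *)
Lemma cross_bound k (S : {set 'I_p}) v : (k = d \/ k = 2 * d)%N ->
  Sstar \subset S -> S \subset A -> (#|S| <= k)%N -> supp_in S v ->
  bil G u v ^+ 2 <= 14 / 13 * (7 * k%:R + 10) * L * bil Sigma u u * bil G v v.
Proof.
move=> kd sS SA Sk Sv; apply: le_trans (G_cross kd Sk (residual_u sS SA) Sv) _.
have Sd : (#|S| <= 2 * d + 1)%N.
  by case: kd Sk => ->; [exact: leq_2d1 | exact: leq_2d_2d1].
have := G_Sigma Sd Sv; have w0 := bilSigma_ge0 u.
have k0 : 0 <= k%:R :> R by [].
set C := (7 * k%:R + 10) * L * bil Sigma u u.
have C0 : 0 <= C.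
  by apply: mulr_ge0 => //; apply: mulr_ge0 => //; lra.
move=> h; have vS := bilSigma_ge0 v.
have h1 : 39 / 40 * (N * bil Sigma v v) <= bil G v v.
  apply: le_trans h; rewrite -[leRHS]mulrA; apply: ler_wpM2r; last by move: dl_bounds; lra.
  by apply: mulr_ge0 => //; exact: ltW.
have h2 := ler_wpM2l C0 h1.
have h3 : 0 <= C * (N * bil Sigma v v).
  by apply: mulr_ge0 => //; apply: mulr_ge0 => //; exact: ltW.
rewrite (_ : 21 / 20 * _ * _ * _ * _ * _ = 21 / 20 * (C * (N * bil Sigma v v))); last by rewrite /C; ring.
rewrite (_ : 14 / 13 * _ * _ * _ * _ = 14 / 13 * (C * bil G v v)); last by rewrite /C; ring.
lra.
Qed.

(** The increase is the squared Gram norm of D = b - b'. Since u differs from e_j - b' by a vector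
    supported in S without l, to which D is Gram-orthogonal, this squared norm equals the Gram
    product of u and D. The correlation bound thus controls a quantity by its own square root, and
    one factor cancels. Finally 14/13 * 40/39 * (7 d + 10) <= 8 d + 12. *)
Lemma rss_remove_overfit (S : {set 'I_p}) (l : 'I_p) :
  Sstar \subset S -> S \subset A -> (#|S| <= d)%N -> l \in S -> l \notin Sstar ->
  N * (rss X j (S :\ l)%SET - rss X j S) <= (8 * d%:R + 12) * L * rss X j S.
Proof.
move=> sS SA Sd lS lstar.
have Sd1 : (#|S| <= 2 * d + 1)%N by exact: leq_2d1.
have Sld : (#|(S :\ l)%SET| <= 2 * d + 1)%N.
  by apply: leq_trans Sd1; exact: subset_leq_card (subD1set _ _).
have SlS : (S :\ l)%SET \subset S by exact: subD1set.
have [b lsb] := ls_ex (unit_rv j) Sd1; have [b' lsb'] := ls_ex (unit_rv j) Sld.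
have rE := rss_ls Sd1 lsb.
rewrite (rss_ls Sld lsb') {1}rE; have [Sb bS] := lsb; have [Sb' bS'] := lsb'.
set D := b - b'.
have SD : supp_in S D by apply: supp_inB => //; exact: supp_inS SlS Sb'.
have rD : unit_rv j - b' = (unit_rv j - b) + D.
  by apply/rowP => i; rewrite !mxE; ring.
have -> : bil G (unit_rv j - b') (unit_rv j - b') -
    bil G (unit_rv j - b) (unit_rv j - b) = bil G D D.
  by rewrite {1 2}rD (bil_sqrD _ D)// (bS _ SD) mulr0 addr0 addrC addKr.
have DD : bil G D D = bil G u D.
  have -> : bil G D D = bil G (unit_rv j - b') D by rewrite rD bilDl (bS _ SD) add0r.
  have -> : unit_rv j - b' = u + ((unit_rv j - u) - b').
    by apply/rowP => i; rewrite !mxE; ring.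
  have Sw : supp_in (S :\ l)%SET ((unit_rv j - u) - b').
    apply: supp_inB => //; apply: supp_inS u_supp.
    by apply/fintype.subsetP => i iS; rewrite !inE (fintype.subsetP sS _ iS) andbT; apply: contraNneq lstar => <-.
  rewrite bilDl; set w := _ - b' in Sw *.
  have -> : D = (unit_rv j - b') - (unit_rv j - b).
    by apply/rowP => i; rewrite !mxE; ring.
  rewrite (bilC w _ SG) [in X in _ + X]bilBl bS'// (bS w) ?subr0 ?addr0//.
  exact: supp_inS SlS Sw.
have low := rss_lower SA (leq_2d Sd).
have d0 : 0 <= d%:R :> R by [].
have c0 : 0 <= (7 * d%:R + 10) * L by apply: mulr_ge0 => //; lra.
have h : bil G D D <= 14 / 13 * ((7 * d%:R + 10) * L * bil Sigma u u).
  have := cross_bound (or_introl erefl) sS SA Sd SD.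
  rewrite -DD expr2; have := G_ge0 D; rewrite le_eqVlt => /orP[/eqP <- _|D0].
    by apply: mulr_ge0; [lra | apply: mulr_ge0 => //; exact: bilSigma_ge0].
  by rewrite ler_pM2r// !mulrA.
have {}low : 39 / 40 * (N * bil Sigma u u) <= rss X j S.
  apply: le_trans low; rewrite -[leRHS]mulrA; apply: ler_wpM2r; last by move: dl_bounds; lra.
  by apply: mulr_ge0; [exact: ltW | exact: bilSigma_ge0].
have h2 := ler_wpM2l c0 low; have h3 := ler_wpM2l (ltW N_gt0) h.
have h4 : 0 <= L * rss X j S by apply: mulr_ge0 => //; rewrite rE.
have h5 : 0 <= d%:R * (L * rss X j S) by apply: mulr_ge0.
lra.
Qed.


Let beta := unit_rv j - u.
Hypothesis beta_min : forall i, i \in Sstar -> 20 * (8 * d%:R + 12) * nh * L <= N * nl * beta 0 i ^+ 2.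

Hypothesis beta_neq0 : forall i, i \in Sstar -> beta 0 i != 0.

Let betaT (S : {set 'I_p}) : 'rV[R]_p := \sum_(i in Sstar :\: S) beta 0 i *: unit_rv i.

Lemma betaTE (S : {set 'I_p}) i : betaT S 0 i = if i \in (Sstar :\: S)%SET then beta 0 i else 0.
Proof.
exact: unit_combE.
Qed.

Lemma betaT_supp (S : {set 'I_p}) : supp_in (Sstar :\: S)%SET (betaT S).
Proof. by move=> i iT; rewrite betaTE (negbTE iT). Qed.

Lemma beta_split (S : {set 'I_p}) : supp_in S (beta - betaT S).
Proof.
move=> i iS; rewrite mxE [X in _ + X]mxE betaTE inE iS/=.
by case: ifPn => [_|/u_supp ->]; rewrite ?subrr ?oppr0 ?addr0.
Qed.

Lemma betaT_norm (S : {set 'I_p}) :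
  bil 1%:M (betaT S) (betaT S) = \sum_(i in (Sstar :\: S)%SET) beta 0 i ^+ 2.
Proof.
rewrite bil1E [RHS]big_mkcond; apply: eq_bigr => i _; rewrite betaTE.
by case: ifP => _; rewrite ?mulr0 ?expr2.
Qed.

Lemma betaT_norm_ge (S : {set 'I_p}) i : i \in (Sstar :\: S)%SET ->
  beta 0 i ^+ 2 <= bil 1%:M (betaT S) (betaT S).
Proof.
move=> iT; rewrite betaT_norm (bigD1 i)//= lerDl sumr_ge0// => l _.
exact: sqr_ge0.
Qed.

Lemma unit_cost_bound (m : 'rV[R]_p) (S : {set 'I_p}) :
  Sstar \subset S -> S \subset A -> (#|S| <= 2 * d)%N -> supp_in S m ->
  bil G u m ^+ 2 <= 14 / 13 * (14 * d%:R + 10) * L * nh * bil G m m.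
Proof.
move=> sS SA Sd Sm; apply: le_trans (cross_bound (or_intror erefl) sS SA Sd Sm) _.
apply: ler_wpM2r => //; rewrite natrM mulrA.
have d0 : 0 <= d%:R :> R by [].
apply: ler_pM => //; [|exact: bilSigma_ge0|lra].
by apply: mulr_ge0 => //; lra.
Qed.

(** Let m be the part of the missing signal [betaT S] that is Gram-orthogonal to S. On the missing
    vertices m coincides with beta, so its squared norm is at least [N * nl] times that of
    [betaT S], which dwarfs the noise product of u and m. The residual r then has a product with
    [betaT S] of at least two thirds of that squared norm. By Cauchy-Schwarz some missing vertex
    carries its share of the product, and a step along this coordinate lowers the residual sum of
    squares. The ratio 4/9 is (2/3)^2. *)
Lemma rss_add_underfit (S : {set 'I_p}) :
  S \subset A -> (#|S| <= d)%N -> ~~ (Sstar \subset S) ->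
  exists2 k, k \in (Sstar :\: S)%SET &
    4 * (N * nl ^+ 2 * bil 1%:M (betaT S) (betaT S)) <=
    9 * (#|(Sstar :\: S)%SET|%:R * nh * (rss X j S - rss X j (k |: S)%SET)).
Proof.
move=> SA Sd nsS; have Sd1 := leq_2d1 Sd.
set U := (S :|: Sstar)%SET; set T := (Sstar :\: S)%SET.
have Ud : (#|U| <= 2 * d)%N.
  by apply: leq_trans (leq_card_setU _ _) _; rewrite mul2n -addnn leq_add.
have UA : U \subset A by rewrite finset.subUset SA.
have SU : S \subset U by exact: finset.subsetUl.
have sU : Sstar \subset U by exact: finset.subsetUr.
have TU : T \subset U by apply: fintype.subset_trans sU; exact: finset.subsetDl.
have [i0 i0T] : exists i0, i0 \in T.
  by move: nsS => /fintype.subsetPn[i iS niS]; exists i; rewrite inE niS.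
have [b lsb] := ls_ex (unit_rv j) Sd1; have [Sb bS] := lsb.
have [q lsq] := ls_ex (betaT S) Sd1; have [Sq qS] := lsq.
rewrite (rss_ls Sd1 lsb); set r := unit_rv j - b in bS *.
set m := betaT S - q in qS; set B2 := bil 1%:M (betaT S) (betaT S).
have Um : supp_in U m.
  by apply: supp_inB; [exact: supp_inS TU (@betaT_supp S) | exact: supp_inS SU Sq].
have rT : bil G r (betaT S) = bil G u m + bil G m m.
  have -> : bil G r (betaT S) = bil G r m.
    by rewrite [RHS]bilBr (bS _ Sq) subr0.
  rewrite /r bilBl (bilC b m SG) (qS _ Sb) subr0.
  have -> : unit_rv j = u + ((beta - betaT S) + (q + m)).
    by apply/rowP => i; rewrite !mxE; ring.
  rewrite bilDl bilDl (bilDl _ q m) (bilC (beta - _) m SG) (qS _ (@beta_split S)) add0r.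
  by rewrite (bilC q m SG) (qS _ Sq) add0r.
have mB : N * nl * B2 <= bil G m m.
  apply: le_trans (G_lower (leq_2d_2d1 Ud) Um); apply: ler_wpM2l.
    by apply: mulr_ge0; exact: ltW.
  rewrite /B2 betaT_norm bil1E [leLHS]big_mkcond; apply: ler_sum => i _.
  case: ifPn => iT; last by rewrite -expr2 sqr_ge0.
  have iS : i \notin S by move: iT; rewrite inE => /andP[].
  have -> : m 0 i = beta 0 i by rewrite /m mxE [X in _ + X]mxE (Sq _ iS) oppr0 addr0 betaTE iT.
  by rewrite expr2.
have B2min : 20 * (8 * d%:R + 12) * nh * L <= N * nl * B2.
  have i0s : i0 \in Sstar by move: i0T; rewrite inE => /andP[].
  apply: le_trans (beta_min i0s) _; apply: ler_wpM2l; last exact: betaT_norm_ge.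
  by apply: mulr_ge0; exact: ltW.
have d0 : 0 <= d%:R :> R by [].
have nhL : 0 <= nh * L by apply: mulr_ge0 => //; exact: ltW.
have um : - bil G m m <= 3 * bil G u m.
  have h := unit_cost_bound sU UA Ud Um.
  suff : `|3 * bil G u m| <= bil G m m by rewrite ler_norml => /andP[].
  rewrite -(@ler_pXn2r _ 2) ?nnegrE// real_normK ?num_real// exprMn.
  apply: (@le_trans _ _ (9 * (14 / 13 * (14 * d%:R + 10) * L * nh * bil G m m))).
    by rewrite (_ : 3 ^+ 2 = 9) ?ler_wpM2l//; ring.
  rewrite mulrA expr2; apply: ler_wpM2r => //.
  apply: le_trans mB; apply: le_trans B2min.
  have : 0 <= d%:R * (nh * L) by apply: mulr_ge0.
  lra.
have rT23 : 2 * bil G m m <= 3 * bil G r (betaT S) by rewrite rT; lra.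
pose y k := bil G r (unit_rv k).
have rTy : bil G r (betaT S) = \sum_(k in T) beta 0 k * y k.
  by rewrite bil_sumr; apply: eq_bigr => k _; rewrite bilZr.
have B20 : 0 <= B2 by exact: bil1_ge0.
have [k kT ky] : exists2 k, k \in T & bil G r (betaT S) ^+ 2 <= B2 * (#|T|%:R * y k ^+ 2).
  pose k := [arg max_(k > i0 in T) (y k ^+ 2)]%O.
  have [kT kmax] : k \in T /\ forall l, l \in T -> y l ^+ 2 <= y k ^+ 2.
    by rewrite /k; case: arg_maxP => //= k' k'T H; split.
  exists k => //; pose yT : 'rV[R]_p := \row_l y l.
  have -> : bil G r (betaT S) = bil 1%:M (betaT S) (\sum_(l in T) y l *: unit_rv l).
    rewrite rTy bil1E [LHS]big_mkcond; apply: eq_bigr => l _; rewrite betaTE unit_combE.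
    by case: ifPn => lT //; rewrite mul0r.
  apply: le_trans (bil1_CS _ _) _; apply: ler_wpM2l => //.
  rewrite bil_suml; apply: (@le_trans _ _ (\sum_(l in T) y k ^+ 2)); last first.
    by rewrite sumr_const mulr_natl.
  apply: ler_sum => l lT; rewrite bilZl bil_sumr (bigD1 l)//= bilZr unit_norm mulr1.
  rewrite big1 ?addr0; first by rewrite -expr2 kmax.
  move=> i /andP[_ il]; rewrite bilZr bil1E big1 ?mulr0// => c _.
  by rewrite !unit_rvE; case: eqP => [->|]; rewrite ?mul0r// eq_sym (negbTE il) mulr0.
exists k => //.
have kA : (#|k |: S| <= 2 * d + 1)%N.
  by apply: leq_trans (leq_card_setU _ _) _; rewrite cards1 add1n addn1 ltnS; exact: leq_2d.
set E := bil G (unit_rv k) (unit_rv k).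
have E0 : 0 < E.
  apply: (@sparse_gram_gt0 [set k]%SET); first by rewrite cards1 addn1.
    by apply: supp_unit; rewrite inE.
  by apply/eqP => /rowP/(_ k)/eqP; rewrite unit_rvE eqxx mxE oner_eq0.
(* The trial coefficient [y k / E] is the optimal step along e_k, with decrease [y k ^+ 2 / E]. *)
have drop : y k ^+ 2 <= N * nh * (bil G r r - rss X j (k |: S)%SET).
  have := rss_min (S := (k |: S)%SET) (c := b + (y k / E) *: unit_rv k) kA.
  have -> : unit_rv j - (b + (y k / E) *: unit_rv k) = r - (y k / E) *: unit_rv k.
    by rewrite opprD addrA.
  rewrite bil_sqrD// !bilNr !bilNl opprK !bilZr bilZl -/(y k) -/E => h.
  have {}h : rss X j (k |: S)%SET <= bil G r r - y k ^+ 2 / E.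
    have -> : bil G r r - y k ^+ 2 / E = bil G r r + 2 * - (y k / E * y k) + y k / E * (y k / E * E).
      by field; rewrite gt_eqF.
    apply: h; apply: supp_inD; last by apply: supp_inZ; apply: supp_unit; rewrite !inE eqxx.
    exact: supp_inS (finset.subsetUr _ _) Sb.
  have h2 : y k ^+ 2 / E <= bil G r r - rss X j (k |: S)%SET by lra.
  apply: (@le_trans _ _ (E * (y k ^+ 2 / E))); first by rewrite mulrC divfK ?gt_eqF.
  apply: ler_pM => //; [exact: ltW | by rewrite divr_ge0 ?sqr_ge0 ?ltW | exact: unit_gram_le].
have B2p : 0 < B2.
  apply: lt_le_trans (betaT_norm_ge i0T); rewrite exprn_even_gt0//= beta_neq0//.
  by move: i0T; rewrite inE => /andP[].
have T0 : 0 <= #|T|%:R :> R by [].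
have NB : 0 < N * B2 by rewrite mulr_gt0.
rewrite -(ler_pM2l NB).
apply: (@le_trans _ _ (4 * bil G m m ^+ 2)).
  rewrite [leLHS](_ : _ = 4 * (N * nl * B2) ^+ 2); last by ring.
  apply: ler_wpM2l => //; rewrite lerXn2r ?nnegrE ?G_ge0//.
  by apply: mulr_ge0 => //; apply: mulr_ge0; exact: ltW.
apply: (@le_trans _ _ (9 * bil G r (betaT S) ^+ 2)).
  rewrite [leLHS](_ : _ = (2 * bil G m m) ^+ 2); last by ring.
  rewrite [leRHS](_ : _ = (3 * bil G r (betaT S)) ^+ 2); last by ring.
  have := G_ge0 m => mm0; rewrite lerXn2r ?nnegrE//; lra.
rewrite [leRHS](_ : _ = 9 * (B2 * (#|T|%:R * (N * nh * (bil G r r - rss X j (k |: S)%SET))))); last by ring.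
apply: ler_wpM2l => //; apply: le_trans ky _; apply: ler_wpM2l => //.
exact: ler_wpM2l.
Qed.

(** After equalizing norms, polarization leaves half the spread between the upper and lower isometry
    constants. This is the origin of (nh - nl)^2 in nu_0. *)
Lemma cross_disjoint (U : {set 'I_p}) (a c : 'rV[R]_p) :
  (#|U| <= 2 * d + 1)%N -> supp_in U a -> supp_in U c -> bil 1%:M a c = 0 ->
  bil G a c ^+ 2 <= (N * (nh - nl) / 2) ^+ 2 * bil 1%:M a a * bil 1%:M c c.
Proof.
move=> Ud Ua Uc ac.
have [->|a0] := eqVneq a 0; first by rewrite !bil0l mulr0 mul0r expr0n.
have [->|c0] := eqVneq c 0; first by rewrite !bil0r mulr0 expr0n.
have qa := bil1_gt0 a0; have qc := bil1_gt0 c0.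
have an : bil 1%:M a a != 0 by rewrite gt_eqF.
set s := Num.sqrt (bil 1%:M c c / bil 1%:M a a).
have ss : s ^+ 2 = bil 1%:M c c / bil 1%:M a a by rewrite sqr_sqrtr// divr_ge0 ?ltW.
have I1 : (1%:M : 'M[R]_p)^T = 1%:M by exact: trmx1.
have aa : bil 1%:M (s *: a) (s *: a) = bil 1%:M c c.
  by rewrite bilZl bilZr mulrA -expr2 ss divfK.
have Usa : supp_in U (s *: a) by exact: supp_inZ.
have q1 : bil 1%:M (s *: a + c) (s *: a + c) = 2 * bil 1%:M c c.
  by rewrite bil_sqrD// aa bilZl ac; ring.
have q2 : bil 1%:M (s *: a - c) (s *: a - c) = 2 * bil 1%:M c c.
  by rewrite bil_sqrD// aa !bilNr bilNl bilZl ac; ring.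
have := G_lower Ud (supp_inD Usa Uc); have := G_upper Ud (supp_inD Usa Uc).
have := G_lower Ud (supp_inB Usa Uc); have := G_upper Ud (supp_inB Usa Uc).
rewrite q1 q2 => h1 h2 h3 h4.
set h := N * (nh - nl) / 2.
have H0 : 0 <= h.
  by apply: mulr_ge0 => //; apply: mulr_ge0; [exact: ltW | rewrite subr_ge0].
have H : `|s * bil G a c| <= h * bil 1%:M c c.
  by rewrite -(bilZl G) bil_polar// ler_norml /h; apply/andP; split; lra.
have : (s * bil G a c) ^+ 2 <= (h * bil 1%:M c c) ^+ 2.
  rewrite -(real_normK (num_real (s * _))) lerXn2r ?nnegrE//.
  by apply: mulr_ge0 => //; exact: ltW.
rewrite exprMn ss => H1.
have := ler_wpM2l (ltW qa) H1.
rewrite [leLHS](_ : _ = bil 1%:M c c * bil G a c ^+ 2) => [H2|]; last by field.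
rewrite -(ler_pM2l qc); apply: le_trans H2 _.
by rewrite le_eqVlt; apply/orP; left; apply/eqP; ring.
Qed.

Lemma rss_swap_underfit (S : {set 'I_p}) : (0 < d)%N ->
  S \subset A -> #|S| = d -> ~~ (Sstar \subset S) ->
  (4 * nh ^+ 2 * nl ^- 4 * (nh - nl) ^+ 2 + 1) * #|Sstar|%:R <= d%:R ->
  exists k l, [/\ k \in (Sstar :\: S)%SET, l \in (S :\: Sstar)%SET &
    N * nl ^+ 2 * bil 1%:M (betaT S) (betaT S) <=
    9 * (#|(Sstar :\: S)%SET|%:R * nh * (rss X j S - rss X j ((k |: S) :\ l)%SET))].
Proof.
move=> d0 SA Sd nsS nu0; have Sled : (#|S| <= d)%N by rewrite Sd.
have [k kT Hk] := rss_add_underfit SA Sled nsS.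
set T := (Sstar :\: S)%SET in kT Hk *; set Q := (S :\: Sstar)%SET.
set B2 := bil 1%:M (betaT S) (betaT S) in Hk *.
have /andP[kS kstar] : (k \notin S) && (k \in Sstar) by move: kT; rewrite inE.
have TpR : 1 <= #|T|%:R :> R.
  by rewrite ler1n; apply/card_gt0P; exists k.
set nu := 4 * nh ^+ 2 * nl ^- 4 * (nh - nl) ^+ 2 in nu0.
have nu_ge0 : 0 <= nu.
  by rewrite /nu mulr_ge0 ?sqr_ge0// mulr_ge0 ?invr_ge0 ?exprn_ge0 ?(ltW nl_gt0)// mulr_ge0 ?sqr_ge0.
(* As S is full, |Q| = d - |S^*| + |T|, and d - |S^*| >= nu |S^*| >= nu |T|. *)
have Q_card : (nu + 1) * #|T|%:R <= #|Q|%:R.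
  have hQ : (#|Q| + #|Sstar|)%:R = d%:R + #|T|%:R :> R.
    rewrite -natrD; congr _%:R.
    have := cardsID S Sstar; have := cardsID Sstar S; rewrite finset.setIC Sd -/T -/Q.
    by move=> <- <-; rewrite addnC addnAC.
  have Ts : #|T|%:R <= #|Sstar|%:R :> R by rewrite ler_nat subset_leq_card ?finset.subsetDl.
  have := ler_wpM2l nu_ge0 Ts; move: hQ; rewrite natrD; lra.
have Qp : 0 < #|Q|%:R :> R.
  apply: lt_le_trans Q_card; apply: mulr_gt0; lra.
have [l0 l0Q] : exists l0, l0 \in Q by apply/card_gt0P; rewrite -(ltr_nat R).
set S1 := (k |: S)%SET in Hk *.
have S1A : S1 \subset A by rewrite finset.subUset SA finset.sub1set (fintype.subsetP Sstar_A).
have S1card : (#|S1| <= 2 * d + 1)%N.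
  by rewrite /S1 cardsU1 kS add1n addn1 ltnS Sd; exact: leq_2d.
set U := (S :|: Sstar)%SET.
have Ud : (#|U| <= 2 * d)%N.
  by apply: leq_trans (leq_card_setU _ _) _; rewrite mul2n -addnn leq_add.
have UA : U \subset A by rewrite finset.subUset SA.
have sU : Sstar \subset U by exact: finset.subsetUr.
have S1U : S1 \subset U.
  by rewrite finset.subUset finset.subsetUl finset.sub1set (fintype.subsetP sU).
have [b lsb] := ls_ex (unit_rv j) S1card; have [Sb bS] := lsb.
have rE := rss_ls S1card lsb.
(* The error of the fit on [S1] against the true coefficients restricted to [S1]. The normal
   equations tested against [a] express its squared Gram norm as noise plus bias. *)
set a := b - (beta - betaT S1).
have Sa : supp_in S1 a by apply: supp_inB => //; exact: beta_split.
have Ua : supp_in U a by exact: supp_inS S1U Sa.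
have S1T : (Sstar :\: S1)%SET \subset T.
  by apply: finset.setDS; exact: finset.subsetUr.
have UT : supp_in U (betaT S1).
  apply: supp_inS (@betaT_supp S1); apply: fintype.subset_trans sU.
  exact: finset.subsetDl.
have aE : bil G a a = bil G u a + bil G (betaT S1) a.
  have h : bil G (unit_rv j - b) a = 0 by exact: bS.
  have bE : unit_rv j - b = u + betaT S1 - a.
    by apply/rowP => i; rewrite !mxE; ring.
  by move: h; rewrite bE bilBl bilDl => /eqP; rewrite subr_eq0 => /eqP.
have h2 := unit_cost_bound sU UA Ud Ua.
have aT : bil 1%:M (betaT S1) a = 0.
  rewrite bil1E big1// => i _; rewrite betaTE; case: ifPn => [|_]; last by rewrite mul0r.
  by rewrite inE => /andP[iS1 _]; rewrite (Sa _ iS1) mulr0.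
have h3 := cross_disjoint (leq_2d_2d1 Ud) UT Ua aT.
have h4 := G_lower (leq_2d_2d1 Ud) Ua.
have B2' : bil 1%:M (betaT S1) (betaT S1) <= B2.
  rewrite /B2 !betaT_norm [leLHS]big_mkcond [leRHS]big_mkcond; apply: ler_sum => i _.
  case: ifPn => [/(fintype.subsetP S1T) -> //|_]; case: ifP => // _; exact: sqr_ge0.
(* On Q the true coefficients vanish, so [a] and [b] agree there and the least square is at most the
   average. *)
have [l lQ hl] : exists2 l, l \in Q & #|Q|%:R * b 0 l ^+ 2 <= bil 1%:M a a.
  pose l := [arg min_(l < l0 in Q) (b 0 l ^+ 2)]%O.
  have [lQ lmin] : l \in Q /\ forall i, i \in Q -> b 0 l ^+ 2 <= b 0 i ^+ 2.
    by rewrite /l; case: arg_minP => //= l' l'Q H; split.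
  exists l => //; apply: (@le_trans _ _ (\sum_(i in Q) b 0 i ^+ 2)).
    by rewrite mulr_natl -sumr_const; apply: ler_sum => i; exact: lmin.
  rewrite bil1E [leLHS]big_mkcond; apply: ler_sum => i _.
  case: ifPn => iQ; last by rewrite -expr2 sqr_ge0.
  have iS : i \notin Sstar by move: iQ; rewrite inE => /andP[].
  suff -> : a 0 i = b 0 i by rewrite expr2.
  have bi : beta 0 i = 0 by exact: u_supp.
  rewrite /a mxE [X in _ + X]mxE [X in - X]mxE bi add0r.
  by rewrite [X in _ - X]mxE betaTE inE (negbTE iS) andbF !oppr0 addr0.
exists k, l; split => //.
have /andP[lS lstar] : (l \in S) && (l \notin Sstar) by move: lQ; rewrite inE andbC.
have lS1 : l \in S1 by rewrite inE lS orbT.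
have B2min : 20 * (8 * d%:R + 12) * nh * L <= N * nl * B2.
  apply: le_trans (beta_min kstar) _; apply: ler_wpM2l; last exact: betaT_norm_ge.
  by apply: mulr_ge0; exact: ltW.
set Inc := rss X j (S1 :\ l)%SET - rss X j S1.
have hInc : Inc <= b 0 l ^+ 2 * (N * nh).
  have lcard : (#|(S1 :\ l)%SET| <= 2 * d + 1)%N.
    by apply: leq_trans S1card; apply: subset_leq_card; exact: subD1set.
  have := rss_min (S := (S1 :\ l)%SET) (c := b - b 0 l *: unit_rv l) lcard.
  have -> : unit_rv j - (b - b 0 l *: unit_rv l) = (unit_rv j - b) + b 0 l *: unit_rv l.
    by rewrite opprB addrCA addrC.
  rewrite (bil_sqrD _ (b 0 l *: _))// (bS (b 0 l *: unit_rv l)); last first.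
    by apply: supp_inZ; exact: supp_unit.
  rewrite mulr0 addr0 -rE bilZl bilZr mulrA -expr2 => h.
  have {}h : rss X j (S1 :\ l)%SET <= rss X j S1 + b 0 l ^+ 2 * bil G (unit_rv l) (unit_rv l).
    apply: h => i; rewrite inE negb_and !inE => /orP[|iS1].
      rewrite negbK => /eqP ->; rewrite mxE [X in _ + X]mxE [X in - X]mxE unit_rvE eqxx mulr1.
      exact: subrr.
    have il : (i == l) = false by apply: contraNF iS1 => /eqP ->; rewrite lS orbT.
    rewrite mxE [X in _ + X]mxE [X in - X]mxE unit_rvE il mulr0 oppr0 addr0.
    by apply: Sb; rewrite !inE.
  have := ler_wpM2l (sqr_ge0 (b 0 l)) (unit_gram_le l); rewrite /Inc; lra.
move: Hk aE h2 h3 h4 B2' hl hInc B2min Q_card Qp.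
rewrite -/Inc.
have -> : rss X j S - rss X j (S1 :\ l)%SET = (rss X j S - rss X j S1) - Inc.
  by rewrite /Inc; ring.
have := G_ge0 a; have : 0 <= B2 by exact: bil1_ge0.
have := bil1_ge0 a; have := bil1_ge0 (betaT S1).
move: (bil 1%:M (betaT S1) _) (bil 1%:M a a) B2 (bil G a a) (bil G u a) (bil G (betaT S1) a).
move: (rss X j S - rss X j S1) Inc (b 0 l) => D1 I bl B' V B2 y2 x1 x2.
rewrite -/nu => B'0 V0 B20 y20 Hk aE h2 h3 h4 B2' hl hInc B2min Q_card Qp.
have P0 : 0 <= d%:R :> R by [].
exact: (swap_gain_bound N_gt0 nl_gt0 nl_le P0 L_ge0 V0 B20 y20 erefl B2min aE h2 h3 B2' h4
  TpR Q_card hl hInc Hk).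
Qed.

Lemma rss_gt0 (S : {set 'I_p}) : j \notin A -> S \subset A -> (#|S| <= 2 * d)%N -> 0 < rss X j S.
Proof.
move=> jA SA Sd; apply: lt_le_trans (rss_lower SA Sd).
apply: mulr_gt0; first by apply: mulr_gt0 => //; move: dl_bounds; lra.
apply: (proj2 Sigma_pos); apply/eqP => u0.
have := u_supp (i := j); rewrite u0 subr0 unit_rvE eqxx => /(_ _)/eqP; rewrite oner_eq0 => h.
suff : false by []; apply: h; apply: contra jA => /(fintype.subsetP Sstar_A); exact.
Qed.

Lemma betaT_norm_sum (bm : R) (S : {set 'I_p}) : (forall i, i \in Sstar -> bm <= beta 0 i ^+ 2) ->
  #|(Sstar :\: S)%SET|%:R * bm <= bil 1%:M (betaT S) (betaT S).
Proof.
move=> hb; rewrite betaT_norm mulr_natl -sumr_const; apply: ler_sum => i.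
by rewrite inE => /andP[_]; exact: hb.
Qed.

(** The squared norm of the missing signal is at least |T| times [bm], so the factor |T| lost by
    choosing a single vertex cancels. *)
Lemma rss_add_gain (bm : R) (S : {set 'I_p}) : (forall i, i \in Sstar -> bm <= beta 0 i ^+ 2) ->
  S \subset A -> (#|S| <= d)%N -> ~~ (Sstar \subset S) ->
  exists2 k, k \in (Sstar :\: S)%SET &
    4 * (N * nl ^+ 2 * bm) <= 9 * (nh * (rss X j S - rss X j (k |: S)%SET)).
Proof.
move=> hb SA Sd nsS; have [k kT Hk] := rss_add_underfit SA Sd nsS; exists k => //.
have T0 : 0 < #|(Sstar :\: S)%SET|%:R :> R by rewrite ltr0n; apply/card_gt0P; exists k.
rewrite -(ler_pM2l T0); have c0 : 0 <= 4 * (N * nl ^+ 2).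
  by apply: mulr_ge0 => //; apply: mulr_ge0; [exact: ltW | exact: sqr_ge0].
have := ler_wpM2l c0 (betaT_norm_sum S hb); lra.
Qed.

Lemma rss_swap_gain (bm : R) (S : {set 'I_p}) : (forall i, i \in Sstar -> bm <= beta 0 i ^+ 2) ->
  (0 < d)%N -> S \subset A -> #|S| = d -> ~~ (Sstar \subset S) ->
  (4 * nh ^+ 2 * nl ^- 4 * (nh - nl) ^+ 2 + 1) * #|Sstar|%:R <= d%:R ->
  exists k l, [/\ k \in (Sstar :\: S)%SET, l \in (S :\: Sstar)%SET &
    N * nl ^+ 2 * bm <= 9 * (nh * (rss X j S - rss X j ((k |: S) :\ l)%SET))].
Proof.
move=> hb d0 SA Sd nsS nu; have [k [l [kT lQ Hk]]] := rss_swap_underfit d0 SA Sd nsS nu.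
exists k, l; split => //.
have T0 : 0 < #|(Sstar :\: S)%SET|%:R :> R by rewrite ltr0n; apply/card_gt0P; exists k.
rewrite -(ler_pM2l T0); have c0 : 0 <= N * nl ^+ 2.
  by apply: mulr_ge0; [exact: ltW | exact: sqr_ge0].
have := ler_wpM2l c0 (betaT_norm_sum S hb); lra.
Qed.

End Geometry.

(** * Greedy steps and posterior weights *)

Section Greedy.
Context {R : realType} {p : nat}.
Implicit Types (S Sstar : {set 'I_p}) (psi : {set 'I_p} -> R).

(** The default [i0] may violate [Q], as the vertex j does in [greedy_step]; a witness [x] is enough
    for the result to be a true maximizer. *)
Lemma arg_max_default (I : finType) (i0 x : I) (Q : pred I) (F : I -> R) : Q x ->
  Q [arg max_(i > i0 | Q i) F i]%O /\ forall i, Q i -> F i <= F [arg max_(i > i0 | Q i) F i]%O.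
Proof.
move=> Qx; have [y Qy ymax] := arg_maxP F Qx.
rewrite /Order.arg_max /extremum; case: pickP => [z /andP[Qz /forallP zmax]|none] /=.
  by split=> // i Qi; have := zmax i; rewrite Qi.
have /negbT := none y; rewrite negb_and Qy/= => /forallPn[i].
by rewrite negb_imply => /andP[Qi] /negP[]; exact: ymax.
Qed.

Lemma greedy_step_gain (d : nat) psi j Sstar S (g : R) : S != Sstar ->
  (Sstar \subset S -> exists2 l, l \in (S :\: Sstar)%SET & g <= psi (S :\ l)%SET - psi S) ->
  (~~ (Sstar \subset S) -> (#|S| < d)%N ->
     exists2 k, k \in (Sstar :\: S)%SET & g <= psi (k |: S)%SET - psi S) ->
  (~~ (Sstar \subset S) -> (d <= #|S|)%N ->
     exists k l, [/\ k \in (Sstar :\: S)%SET, l \in (S :\: Sstar)%SET &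
       g <= psi ((k |: S) :\ l)%SET - psi S]) ->
  g <= psi (greedy_step d psi j Sstar S) - psi S.
Proof.
move=> SS over add swap; rewrite /greedy_step (negbTE SS).
have [sS|nsS] := boolP (Sstar \subset S).
  have [l lQ gl] := over sS; apply: le_trans gl _; rewrite lerD2r.
  by have [_ ->] := arg_max_default j (fun l => psi (S :\ l)%SET) lQ.
have [Sd|Sd] := ltnP #|S| d.
  have [k kT gk] := add nsS Sd; apply: le_trans gk _; rewrite lerD2r.
  by have [_ ->] := arg_max_default j (fun k => psi (k |: S)%SET) kT.
have [k [l [kT lQ gkl]]] := swap nsS Sd; apply: le_trans gkl _; rewrite lerD2r.
have h : ((k, l).1 \in (Sstar :\: S)%SET) && ((k, l).2 \in (S :\: Sstar)%SET) by rewrite kT lQ.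
by have [_ /(_ _ h)] := arg_max_default (x := (k, l)) (j, j)
  (Q := fun e => (e.1 \in (Sstar :\: S)%SET) && (e.2 \in (S :\: Sstar)%SET))
  (fun e => psi ((e.1 |: S) :\ e.2)%SET) h.
Qed.

(* Every preimage of a model under the greedy step is a toggle (a = b) or an
   exchange of two vertices, hence has one of p^2 codes. *)
Definition neighbour S (e : 'I_p * 'I_p) : {set 'I_p} :=
  if e.1 == e.2 then (if e.1 \in S then S :\ e.1 else e.1 |: S)%SET
  else (e.2 |: (S :\ e.1))%SET.

Lemma greedy_step_spec (d : nat) psi j Sstar S : S != Sstar -> (#|S| <= d)%N ->
  (#|Sstar| <= d)%N ->
  [/\ greedy_step d psi j Sstar S \subset S :|: Sstar,
      (#|greedy_step d psi j Sstar S| <= d)%N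
    & exists e, S = neighbour (greedy_step d psi j Sstar S) e].
Proof.
move=> SS Sd sd; rewrite /greedy_step (negbTE SS).
have [sS|nsS] := boolP (Sstar \subset S).
  have [x xQ] : exists x, x \in (S :\: Sstar)%SET.
    apply/fintype.existsP; apply: contra_neqT SS => /existsPn h.
    apply/eqP; rewrite finset.eqEsubset sS andbT; apply/fintype.subsetP => i iS.
    by have := h i; rewrite inE iS andbT negbK.
  have [lQ _] := arg_max_default j (fun l => psi (S :\ l)%SET) xQ.
  move: lQ; set l := [arg max_(_ > _ | _) _]%O.
  move=> lQ; have := (lQ : l \in (S :\: Sstar)%SET); rewrite inE => /andP[_ lS].
  split.
  - by apply: fintype.subset_trans (subD1set _ _) _; exact: finset.subsetUl.
  - by apply: leq_trans Sd; apply: subset_leq_card; exact: subD1set.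
  - by exists (l, l); rewrite /neighbour/= eqxx !inE eqxx/= finset.setD1K.
have [x xT] : exists x, x \in (Sstar :\: S)%SET.
  by move: nsS => /fintype.subsetPn[i iS niS]; exists i; rewrite inE niS.
have [ltSd|leSd] := ltnP #|S| d.
  have [kT _] := arg_max_default j (fun k => psi (k |: S)%SET) xT.
  move: kT; set k := [arg max_(_ > _ | _) _]%O.
  move=> kT; have := (kT : k \in (Sstar :\: S)%SET); rewrite inE => /andP[kS ks].
  split.
  - by rewrite finset.subUset finset.subsetUl andbT finset.sub1set inE ks orbT.
  - by rewrite cardsU1 kS.
  - exists (k, k); rewrite /neighbour/= eqxx !inE eqxx/=.
    by rewrite finset.setU1K.
have [y yQ] : exists y, y \in (S :\: Sstar)%SET.
  apply/fintype.existsP; apply: contraNT nsS => /existsPn h.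
  have SsubS : S \subset Sstar.
    by apply/fintype.subsetP => i iS; have := h i; rewrite inE iS andbT negbK.
  have /eqP -> : S == Sstar by rewrite eqEcard SsubS (leq_trans sd leSd).
  exact: subxx.
have h : ((x, y).1 \in (Sstar :\: S)%SET) && ((x, y).2 \in (S :\: Sstar)%SET) by rewrite xT yQ.
have [kl _] := arg_max_default (x := (x, y)) (j, j)
  (Q := fun e => (e.1 \in (Sstar :\: S)%SET) && (e.2 \in (S :\: Sstar)%SET))
  (fun e => psi ((e.1 |: S) :\ e.2)%SET) h.
move: kl; set e := [arg max_(_ > _ | _) _]%O; case: e => k l /=.
rewrite !inE => /andP[/andP[kS ks] /andP[ls lS]].
have lk : l != k by apply: contraNneq kS => <-.
split.
- apply: fintype.subset_trans (subD1set _ _) _.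
  by rewrite finset.subUset finset.subsetUl andbT finset.sub1set inE ks orbT.
- have := cardsD1 l (k |: S)%SET; rewrite !inE lS orbT cardsU1 kS/= add1n add1n => -[<-].
  exact: Sd.
- exists (k, l); rewrite /neighbour/= eq_sym (negbTE lk).
  apply/finset.setP => i; rewrite !inE.
  case: (eqVneq i l) => [->|il]; first by rewrite lS.
  case: (eqVneq i k) => [->|ik]/=; first by rewrite (negbTE kS).
  by [].
Qed.

Lemma card_greedy_preimage (d : nat) psi j Sstar (M : {set {set 'I_p}}) S' :
  (#|Sstar| <= d)%N -> (forall S, S \in M -> (#|S| <= d)%N) ->
  (#|[set S in M | (S != Sstar) && (greedy_step d psi j Sstar S == S')]%SET| <= p ^ 2)%N.
Proof.
move=> sd Md; have -> : (p ^ 2)%N = #|{: 'I_p * 'I_p}| by rewrite card_prod card_ord.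
rewrite -cardsT; apply: leq_trans (leq_imset_card (neighbour S') _).
apply: subset_leq_card; apply/fintype.subsetP => S; rewrite inE => /and3P[SM SS /eqP <-].
have [_ _ [e Se]] := greedy_step_spec psi j SS (Md _ SM) sd.
by apply/imsetP; exists e.
Qed.

Lemma greedy_posterior (d : nat) psi j Sstar (A : {set 'I_p}) (r : R) :
  0 <= r -> Sstar \subset A -> (#|Sstar| <= d)%N ->
  let M := [set S : {set 'I_p} | (S \subset A) && (#|S| <= d)%N]%SET in
  (forall S, S \in M -> S != Sstar ->
     expR (psi S) <= r * expR (psi (greedy_step d psi j Sstar S))) ->
  1 - p%:R ^+ 2 * r <= expR (psi Sstar) / \sum_(S in M) expR (psi S).
Proof.
move=> r0 sA sd M step.
have sM : Sstar \in M by rewrite inE sA.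
set W := \sum_(S in M) _.
have W0 : 0 < W.
  by rewrite /W (bigD1 Sstar)//= ltr_pwDl ?expR_gt0// sumr_ge0// => S _; exact: expR_ge0.
rewrite ler_pdivlMr// mulrBl mul1r lerBlDr -lerBlDl.
have -> : W - expR (psi Sstar) = \sum_(S in M | S != Sstar) expR (psi S).
  by rewrite /W (bigD1 Sstar)//= addrAC subrr add0r.
have gM S : S \in M -> S != Sstar -> greedy_step d psi j Sstar S \in M.
  rewrite !inE => /andP[SA Sd] SS; have [gA gd _] := greedy_step_spec psi j SS Sd sd.
  by rewrite gd andbT (fintype.subset_trans gA)// finset.subUset SA.
apply: (@le_trans _ _ (\sum_(S in M | S != Sstar) r * expR (psi (greedy_step d psi j Sstar S)))).
  by apply: ler_sum => S /andP[SM SS]; exact: step.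
rewrite -mulr_sumr [leRHS](_ : _ = r * (p%:R ^+ 2 * W)); last by ring.
apply: ler_wpM2l => //.
rewrite (partition_big (greedy_step d psi j Sstar) (mem M))/=; last first.
  by move=> S /andP[]; exact: gM.
rewrite mulr_sumr; apply: ler_sum => S' _.
under eq_bigr => S /andP[_ /eqP ->] do over.
rewrite sumr_const -[leLHS]mulr_natl; apply: ler_wpM2r; first exact: expR_ge0.
rewrite -natrX ler_nat.
apply: leq_trans (card_greedy_preimage psi j (M := M) S' sd _); last first.
  by move=> S; rewrite inE => /andP[].
apply: eq_leq; apply: eq_card => S.
by rewrite [RHS]inE unfold_in andbA.
Qed.

End Greedy.

(** * From residual sums of squares to scores *)

Section NodeScore.
Context {R : realType} {n p : nat} (c1 c2 alpha gamma kappa : R) (X : 'M[R]_(n, p)).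
Hypothesis p_gt0 : (0 < p)%N.
Hypothesis c1_gt0 : 0 < c1.
Hypothesis alpha01 : 0 < alpha < 1.
Hypothesis gamma_gt0 : 0 < gamma.
Hypothesis kappa_ge0 : 0 <= kappa.

Definition penalty : R := ln c1 + c2 * ln p%:R + ln (1 + alpha / gamma) / 2.

Let ag_gt0 : 0 < 1 + alpha / gamma.
Proof. by case/andP: alpha01 => a0 _; rewrite addr_gt0// divr_gt0. Qed.

Let pR : 0 < p%:R :> R. Proof. by rewrite ltr0n. Qed.

Lemma node_scoreE j S : 0 < rss X j S ->
  node_score c1 c2 alpha gamma kappa X j S =
  - (#|S|%:R * penalty) - (alpha * n%:R + kappa) / 2 * ln (rss X j S).
Proof.
move=> r0; rewrite /node_score /exp_node_score.
have cp : 0 < c1 * p%:R `^ c2 by rewrite mulr_gt0 ?powR_gt0.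
rewrite !lnM ?posrE ?mulr_gt0 ?powR_gt0 ?invr_gt0 ?exprn_gt0//.
rewrite lnV ?posrE ?exprn_gt0// lnXn// lnM ?posrE ?powR_gt0// !ln_powR.
by rewrite /penalty -mulr_natl; field.
Qed.

Lemma penalty_bounds : 1 <= c1 * Num.sqrt (1 + alpha / gamma) <= p%:R ->
  c2 * ln p%:R <= penalty <= (c2 + 1) * ln p%:R.
Proof.
have s0 : 0 < Num.sqrt (1 + alpha / gamma) by rewrite sqrtr_gt0.
have E : ln (c1 * Num.sqrt (1 + alpha / gamma)) = ln c1 + ln (1 + alpha / gamma) / 2.
  rewrite lnM ?posrE//; congr (_ + _).
  by rewrite -powR12_sqrt ?(ltW ag_gt0)// ln_powR mulrC.
have cs : 0 < c1 * Num.sqrt (1 + alpha / gamma) by rewrite mulr_gt0.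
move=> /andP[h1 h2].
have l1 : 0 <= ln (c1 * Num.sqrt (1 + alpha / gamma)) by exact: ln_ge0.
have l2 : ln (c1 * Num.sqrt (1 + alpha / gamma)) <= ln p%:R by rewrite ler_ln ?posrE.
by rewrite E in l1 l2; rewrite /penalty; apply/andP; split; lra.
Qed.

End NodeScore.

Lemma ln_ratio_le (R : realType) (x y : R) : 0 < x -> 0 < y -> ln y - ln x <= (y - x) / x.
Proof.
move=> x0 y0; rewrite -ln_div ?posrE//.
have -> : y / x = 1 + (y - x) / x by field; rewrite gt_eqF.
apply: le_ln1Dx; rewrite mulrBl divff ?gt_eqF//.
by have : 0 < y / x by [rewrite divr_gt0]; lra.
Qed.

Section NodeGain.
Context {R : realType} {n p d : nat} (c1 c2 alpha gamma kappa nh t : R) (X : 'M[R]_(n, p)).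
Let N : R := n%:R.
Let L : R := ln p%:R.
Hypothesis N_gt0 : 0 < N.
Hypothesis p_gt1 : (1 < p)%N.
Hypothesis c1_gt0 : 0 < c1.
Hypothesis alpha01 : 0 < alpha < 1.
Hypothesis gamma_gt0 : 0 < gamma.
Hypothesis kappa_bounds : 0 <= kappa <= N.
Hypothesis t_gt0 : 0 < t.
Hypothesis c1_bounds : 1 <= c1 * Num.sqrt (1 + alpha / gamma) <= p%:R.
Hypothesis c2_large : (alpha + 1) * (4 * d%:R + 6) + t <= c2.
Hypothesis nh_gt0 : 0 < nh.
Variables (j : 'I_p) (A Sstar : {set 'I_p}).
Hypothesis Sstar_A : Sstar \subset A.
Hypothesis rss_pos : forall S : {set 'I_p}, S \subset A -> (#|S| <= d + 1)%N -> 0 < rss X j S.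
Hypothesis rss_le : forall S : {set 'I_p}, S \subset A -> (#|S| <= d)%N -> rss X j S <= N * nh.
Hypothesis over : forall (S : {set 'I_p}) l, Sstar \subset S -> S \subset A -> (#|S| <= d)%N ->
  l \in S -> l \notin Sstar ->
  N * (rss X j (S :\ l)%SET - rss X j S) <= (8 * d%:R + 12) * L * rss X j S.
Hypothesis add : forall S : {set 'I_p}, S \subset A -> (#|S| <= d)%N -> ~~ (Sstar \subset S) ->
  exists2 k, k \in (Sstar :\: S)%SET &
    80 * (c2 * nh * L) <= 9 * (alpha * (rss X j S - rss X j (k |: S)%SET)).
Hypothesis swap : forall S : {set 'I_p}, S \subset A -> #|S| = d -> ~~ (Sstar \subset S) ->
  exists k l, [/\ k \in (Sstar :\: S)%SET, l \in (S :\: Sstar)%SET &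
    20 * (c2 * nh * L) <= 9 * (alpha * (rss X j S - rss X j ((k |: S) :\ l)%SET))].

Let psi := node_score c1 c2 alpha gamma kappa X j.
Let w := (alpha * N + kappa) / 2.

Let L_gt0 : 0 < L. Proof. by rewrite /L ln_gt0// ltr1n. Qed.
Let a0 : 0 < alpha. Proof. by case/andP: alpha01. Qed.

Let w_ge : alpha * N / 2 <= w.
Proof. by rewrite /w; case/andP: kappa_bounds; lra. Qed.

Let w_le : w <= (alpha + 1) * N / 2.
Proof. by rewrite /w; case/andP: kappa_bounds; lra. Qed.

Let w_ge0 : 0 <= w.
Proof. by apply: le_trans w_ge; rewrite divr_ge0 ?mulr_ge0 ?ltW. Qed.

Let psiE (S : {set 'I_p}) : S \subset A -> (#|S| <= d + 1)%N ->
  psi S = - (#|S|%:R * penalty c1 c2 alpha gamma (p := p)) - w * ln (rss X j S).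
Proof.
move=> SA Sd; apply: node_scoreE => //; [exact: ltnW | exact: rss_pos].
Qed.

(** The logarithm falls by at least the relative decrease, the denominator is at most [N * nh], and
    the weight of the logarithm is at least [alpha * N / 2]. *)
Let drop_gain (S S' : {set 'I_p}) (g : R) : S \subset A -> (#|S| <= d)%N ->
  0 < rss X j S' -> 0 <= g -> g * nh <= alpha * (rss X j S - rss X j S') ->
  g / 2 <= w * (ln (rss X j S) - ln (rss X j S')).
Proof.
move=> SA Sd r'0 g0 gle; have r0 : 0 < rss X j S by apply: rss_pos => //; rewrite (leq_trans Sd)// leq_addr.
have drop0 : 0 <= rss X j S - rss X j S'.
  have h : 0 <= alpha * (rss X j S - rss X j S') by apply: le_trans gle; rewrite mulr_ge0// ltW.
  by rewrite -(pmulr_rge0 _ a0).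
have h1 : (rss X j S - rss X j S') / (N * nh) <= ln (rss X j S) - ln (rss X j S').
  have := ln_ratio_le r0 r'0.
  have : (rss X j S - rss X j S') / (N * nh) <= (rss X j S - rss X j S') / rss X j S.
    by apply: ler_wpM2l => //; rewrite lef_pV2 ?posrE ?mulr_gt0// rss_le.
  rewrite (_ : (rss X j S' - _) / _ = - ((rss X j S - rss X j S') / rss X j S)); last by rewrite -mulNr opprB.
  lra.
have q0 : 0 <= (rss X j S - rss X j S') / (N * nh).
  by apply: divr_ge0 => //; apply: mulr_ge0; exact: ltW.
apply: le_trans (ler_wpM2l w_ge0 h1); apply: le_trans (ler_wpM2r q0 w_ge).
rewrite (_ : alpha * N / 2 * _ = alpha * (rss X j S - rss X j S') / nh / 2); last first.
  by field; rewrite !gt_eqF.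
by rewrite ler_pM2r ?invr_gt0// ler_pdivlMr.
Qed.

Lemma node_greedy_gain (S : {set 'I_p}) : S \subset A -> (#|S| <= d)%N -> S != Sstar ->
  t * L <= psi (greedy_step d psi j Sstar S) - psi S.
Proof.
move=> SA Sd SS.
have p0 : (0 < p)%N by exact: ltnW.
have L0 := L_gt0; have t0 := t_gt0.
have /andP[pen1 pen2] := penalty_bounds c2 p0 c1_gt0 alpha01 gamma_gt0 c1_bounds.
have psiE' := psiE; rewrite -/L in pen1 pen2; set pen := penalty _ _ _ _ in pen1 pen2 psiE'.
have d0 : 0 <= d%:R :> R by [].
have c2t : 6 + t <= c2.
  have ad : 0 <= alpha * (4 * d%:R + 6) by apply: mulr_ge0; [exact: ltW | lra].
  by move: c2_large ad; lra.
have c2L : (6 + t) * L <= c2 * L by apply: ler_wpM2r => //; exact: ltW.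
have tL : 0 <= t * L by apply: mulr_ge0; exact: ltW.
have Sd1 : (#|S| <= d + 1)%N by rewrite (leq_trans Sd)// leq_addr.
have kA k : k \in (Sstar :\: S)%SET -> (k |: S)%SET \subset A.
  rewrite inE => /andP[_ ks].
  by rewrite finset.subUset SA andbT finset.sub1set (fintype.subsetP Sstar_A).
have kc k : k \in (Sstar :\: S)%SET -> #|(k |: S)%SET| = (#|S| + 1)%N.
  by rewrite inE => /andP[kS _]; rewrite cardsU1 kS addnC.
apply: greedy_step_gain => //.
- move=> sS; have [l lQ] : exists l, l \in (S :\: Sstar)%SET.
    apply/fintype.existsP; apply: contra_neqT SS => /existsPn h.
    apply/eqP; rewrite finset.eqEsubset sS andbT; apply/fintype.subsetP => i iS.
    by have := h i; rewrite inE iS andbT negbK.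
  exists l => //; move: lQ; rewrite inE => /andP[ls lS].
  have lA : (S :\ l)%SET \subset A by apply: fintype.subset_trans SA; exact: subD1set.
  have lc : (#|S| = #|(S :\ l)%SET| + 1)%N by rewrite (cardsD1 l S) lS addnC.
  have ld : (#|(S :\ l)%SET| <= d + 1)%N by apply: leq_trans Sd1; rewrite lc leq_addr.
  rewrite (psiE' _ lA ld) (psiE' _ SA Sd1) lc natrD.
  have r0 := rss_pos SA Sd1; have r'0 := rss_pos lA ld.
  have h1 := ln_ratio_le r0 r'0.
  have h2 : (rss X j (S :\ l)%SET - rss X j S) / rss X j S <= (8 * d%:R + 12) * L / N.
    by rewrite ler_pdivlMr// mulrAC ler_pdivrMr// mulrC over.
  have h3 := ler_wpM2l w_ge0 (le_trans h1 h2).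
  have b0 : 0 <= (8 * d%:R + 12) * L / N.
    by apply: divr_ge0; [apply: mulr_ge0; [lra | exact: ltW] | exact: ltW].
  have h4 := ler_wpM2r b0 w_le.
  (* As [kappa <= N], the weight is at most [(alpha + 1) * N / 2], and the noise 8 d + 12 becomes
     exactly the constant (alpha + 1) (4 d + 6) in the condition on c2. What remains of the penalty
     is t L. *)
  have h5 : (alpha + 1) * N / 2 * ((8 * d%:R + 12) * L / N) = (alpha + 1) * (4 * d%:R + 6) * L.
    by field; rewrite gt_eqF.
  have h6 := ler_wpM2r (ltW L_gt0) c2_large.
  rewrite h5 in h4; lra.
- move=> nsS _; have [k kT Hk] := add SA Sd nsS; exists k => //.
  have kd : (#|(k |: S)%SET| <= d + 1)%N by rewrite kc// leq_add2r.
  rewrite (psiE' _ (kA _ kT) kd) (psiE' _ SA Sd1) kc// natrD.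
  (* The fit gains 40/9 c2 L and the new parent costs at most (c2 + 1) L; the rest exceeds t L
     because c2 >= 6 + t. *)
  have := drop_gain (S' := (k |: S)%SET) (g := 80 / 9 * (c2 * L)) SA Sd (rss_pos (kA _ kT) kd).
  have g0 : 0 <= 80 / 9 * (c2 * L) by lra.
  move=> /(_ g0) h; have {h} := h ltac:(lra); lra.
move=> nsS dS; have Sde : #|S| = d by apply/eqP; rewrite eqn_leq Sd dS.
have [k [l [kT lQ Hk]]] := swap SA Sde nsS; exists k, l; split => //.
move: (lQ); rewrite inE => /andP[_ lS].
have lA : ((k |: S) :\ l)%SET \subset A by apply: fintype.subset_trans (kA _ kT); exact: subD1set.
have lc : #|((k |: S) :\ l)%SET| = #|S|.
  have := cardsD1 l (k |: S)%SET; rewrite kc// !inE lS orbT/= addnC => /eqP.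
  by rewrite eqn_add2l => /eqP.
have ld : (#|((k |: S) :\ l)%SET| <= d + 1)%N by rewrite lc.
rewrite (psiE' _ lA ld) (psiE' _ SA Sd1) lc.
(* An exchange leaves the penalty unchanged, so the gain 10/9 c2 L alone exceeds t L. *)
have := drop_gain (S' := ((k |: S) :\ l)%SET) (g := 20 / 9 * (c2 * L)) SA Sd (rss_pos lA ld).
have g0 : 0 <= 20 / 9 * (c2 * L) by lra.
move=> /(_ g0) h; have {h} := h ltac:(lra); lra.
Qed.

End NodeGain.

(** * From parent sets to graphs *)

Section GraphPosterior.
Context {R : realType} {p : nat}.
Implicit Types (s : 'S_p) (G : digraph p).

Lemma prod_near1 (I : Type) (r : seq I) (x : I -> R) (e : R) :
  (forall i, 0 <= x i <= 1) -> (forall i, 1 - e <= x i) ->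
  1 - (size r)%:R * e <= \prod_(i <- r) x i <= 1.
Proof.
move=> x01 xe; elim: r => [|i r /andP[IH1 IH2]]; first by rewrite big_nil mul0r subr0 lexx.
rewrite big_cons /= -addn1 natrD; have /andP[x0 x1] := x01 i; have xei := xe i.
have P0 : 0 <= \prod_(l <- r) x l by apply: prodr_ge0 => l _; case/andP: (x01 l).
move: (\prod_(_ <- _) _) IH1 IH2 P0 => y IH1 IH2 y0; apply/andP; split; last exact: mulr_ile1.
have : 0 <= (1 - x i) * (1 - y) by apply: mulr_ge0; lra.
lra.
Qed.

Lemma sparse_dags_parents s din dout G j : G \in sparse_dags s din dout ->
  parents G j \in models s j din.
Proof.
rewrite inE => /andP[]; rewrite inE => /andP[/forallP acG /forallP ordG] /andP[dG _].
rewrite inE; apply/andP; split; last first.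
  by apply: leq_trans dG; exact: (leq_bigmax j).
apply/fintype.subsetP => k; rewrite !inE => kj; rewrite ltnNge; apply/negP.
rewrite leq_eqVlt => /orP[/eqP/val_inj/perm_inj jk|jk].
  have /forallP/(_ j) := acG k; rewrite /edge kj -{}jk.
  by rewrite connect0.
have /forallP/(_ (s^-1%g k)) := ordG (s^-1%g j); rewrite jk/= !permKV.
by rewrite kj.
Qed.

Lemma parents_inj G G' : (forall j, parents G j = parents G' j) -> G = G'.
Proof.
move=> GG; apply/finset.setP => -[i j].
by have := congr1 (fun A : {set 'I_p} => i \in A) (GG j); rewrite !inE.
Qed.

Lemma set0_sparse s din dout : finset.set0 \in sparse_dags s din dout.
Proof.
rewrite !inE; apply/andP; split.
  apply/andP; split; first by apply/forallP => i; apply/forallP => j; rewrite /edge inE.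
  by apply/forallP => i; apply/forallP => j; rewrite inE implybT.
apply/andP; split; apply/bigmax_leqP => j _.
  by rewrite (_ : parents _ _ = finset.set0) ?cards0//; apply/finset.setP => i; rewrite !inE.
by rewrite (_ : children _ _ = finset.set0) ?cards0//; apply/finset.setP => i; rewrite !inE.
Qed.

Lemma graph_posterior s din dout (psi : 'I_p -> {set 'I_p} -> R) (Gs : digraph p) (e : R) :
  (forall j, parents Gs j \in models s j din) ->
  (forall j, 1 - e <= expR (psi j (parents Gs j)) / \sum_(S in models s j din) expR (psi j S)) ->
  1 - p%:R * e <= expR (\sum_(j < p) psi j (parents Gs j)) /
    \sum_(G in sparse_dags s din dout) expR (\sum_(j < p) psi j (parents G j)).
Proof.
move=> GsM He; set W := fun j => \sum_(S in models s j din) expR (psi j S).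
have W0 j : 0 < W j.
  by rewrite /W (bigD1 (parents Gs j))//= ltr_pwDl ?expR_gt0// sumr_ge0// => S _; exact: expR_ge0.
have xle j : 0 <= expR (psi j (parents Gs j)) / W j <= 1.
  rewrite divr_ge0 ?expR_ge0 ?(ltW (W0 j))//= ler_pdivrMr// mul1r.
  by rewrite /W (bigD1 (parents Gs j))//= lerDl sumr_ge0// => S _; exact: expR_ge0.
have /andP[h _] := prod_near1 (index_enum 'I_p) xle He.
apply: le_trans (le_trans _ h) _.
  by rewrite [index_enum _]unlock -enumT size_enum_ord.
rewrite expR_sum big_split/= prodfV; apply: ler_wpM2l.
  by apply: prodr_ge0 => j _; exact: expR_ge0.
set Z := \sum_(G in _) _.
have Z0 : 0 < Z.
  rewrite /Z (bigD1 finset.set0)/=; last exact: set0_sparse.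
  by rewrite ltr_pwDl ?expR_gt0// sumr_ge0// => G _; exact: expR_ge0.
rewrite lef_pV2 ?posrE//; last by apply: prodr_gt0 => j _; exact: W0.
rewrite /W bigA_distr_big_dep/=.
pose f G : {ffun 'I_p -> {set 'I_p}} := [ffun j => parents G j].
have f_inj : injective f.
  by move=> G G' /ffunP ff; apply: parents_inj => j; have := ff j; rewrite !ffunE.
have -> : Z = \sum_(g in f @: sparse_dags s din dout) \prod_(j < p) expR (psi j (g j)).
  rewrite big_imset/=; last by move=> x y _ _; exact: f_inj.
  apply: eq_bigr => G _; rewrite expR_sum; apply: eq_bigr => j _.
  by rewrite ffunE.
rewrite [leLHS]big_mkcond [leRHS]big_mkcond/=; apply: ler_sum => g _.
case: ifPn => [/imsetP[G GM ->]|_].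
  rewrite ifT//; apply/familyP => j; rewrite ffunE; exact: sparse_dags_parents GM.
by case: ifP => // _; apply: prodr_ge0 => j _; exact: expR_ge0.
Qed.

End GraphPosterior.

(** * Eigenvalues and structural equations *)

Section RealSpectral.
Import sesquilinear spectral complex.
Local Open Scope complex_scope.
Context {R : realType} {p : nat}.

(** Obtained from the unitary diagonalization of the complexified matrix. The weights [w v i] are
    squared moduli of complex coordinates; they diagonalize the quadratic form without a real
    eigenbasis, which is enough for Rayleigh bounds. *)
Lemma real_symmetric_spectral (S : 'M[R]_p) : S^T = S ->
  exists (l : 'I_p -> R) (w : 'rV[R]_p -> 'I_p -> R),
  [/\ forall i, eigenvalue S (l i), forall v i, 0 <= w v i,
      forall v, bil 1%:M v v = \sum_i w v i
    & forall v, bil S v v = \sum_i l i * w v i].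
Proof.
move=> symS; pose toC := real_complex R; pose Sc : 'M[R[i]]_p := map_mx toC S.
have Sreal : Sc \is a realmx.
  by apply/mxOverP => i j; rewrite mxE complex_real.
have Ssym : Sc \is symmetricmx.
  by apply/is_hermitianmxP; rewrite expr0 scale1r; apply/matrixP => i j; rewrite !mxE -[in LHS]symS mxE.
have Sherm := realsym_hermsym Ssym Sreal.
have /orthomx_spectralP Sdec := hermitian_normalmx Sherm.
have /mxOverP spreal := hermitian_spectral_diag_real Sherm.
set P := spectralmx Sc in Sdec; set sp := spectral_diag Sc in Sdec spreal.
have Pu : P \is unitarymx by exact: spectral_unitarymx.
have Punit : P \in unitmx by exact: spectral_unit.
pose l i := complex.Re (sp 0 i).
have lE i : toC (l i) = sp 0 i by exact/RRe_real/spreal.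
pose y (v : 'rV[R]_p) : 'rV[R[i]]_p := map_mx toC v *m invmx P.
pose w v i := complex.Re (y v 0 i) ^+ 2 + complex.Im (y v 0 i) ^+ 2.
have wE v i : y v 0 i * (y v 0 i)^* = toC (w v i).
  rewrite /w; case: (y v 0 i) => a b /=; apply/eqP; rewrite eq_complex /=.
  by apply/andP; split; apply/eqP; ring.
have yT v : P *m (map_mx toC v)^T = ((y v)^t*)%sesqui.
  rewrite /y invmx_unitary// trmx_mul map_mxM -!map_trmx trmxK.
  congr (_ *m _).
    apply/matrixP => i j; rewrite !mxE. by rewrite -[LHS]conjCK.
  by apply/matrixP => i j; rewrite !mxE; apply/esym; apply: conj_Creal; rewrite /toC complex_real.
exists l, w; split.
(* Being an eigenvalue is passed to the complex matrix through the roots of the characteristic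
   polynomial; there row i of [P] is an eigenvector. *)
- move=> i; rewrite eigenvalue_root_char -(fmorph_root toC) map_char_poly -/Sc.
  rewrite -eigenvalue_root_char -[X in eigenvalue _ X]/(toC (l i)) lE; apply/eigenvalueP; exists (row i P).
    rewrite Sdec -row_mul !mulmxA mulmxV// mul1mx row_mul.
    by rewrite row_diag_mx -scalemxAl -rowE.
  apply/eqP => Pi0; move: Punit; rewrite -row_free_unit => /row_freeP[Q PQ].
  have := congr1 (row i) PQ; rewrite row_mul Pi0 mul0mx => /rowP/(_ i)/eqP.
  by rewrite !mxE eqxx eq_sym oner_eq0.
- by move=> v i; rewrite /w addr_ge0 ?sqr_ge0.
- move=> v; apply: complexI; rewrite [RHS]rmorph_sum /bil mulmx1.
  transitivity ((y v *m ((y v)^t*)%sesqui) 0 0).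
    by rewrite -yT /y mulmxA mulmxKV// map_trmx -map_mxM [RHS]mxE.
  rewrite mxE; apply: eq_bigr => i _; rewrite -[RHS]/(toC (w v i)) -wE; congr (_ * _).
  by rewrite !mxE.
- move=> v; apply: complexI; rewrite [RHS]rmorph_sum /bil.
  transitivity ((y v *m diag_mx sp *m ((y v)^t*)%sesqui) 0 0).
    rewrite -yT /y !mulmxA.
    have -> : map_mx toC v *m invmx P *m diag_mx sp *m P = map_mx toC v *m Sc.
      by rewrite [in RHS]Sdec !mulmxA.
    by rewrite map_trmx -!map_mxM [RHS]mxE.
  rewrite mxE; apply: eq_bigr => i _.
  transitivity (toC (l i) * toC (w v i)); last exact/esym/(rmorphM (real_complex R)).
  rewrite lE -wE mul_mx_diag mxE mulrA; congr (_ * _); first exact: mulrC.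
  by rewrite !mxE.
Qed.

Lemma eigenvalue_bounds (S A : 'M[R]_p) : S = A *m A^T -> forall v,
  lambda_min S * bil 1%:M v v <= bil S v v <= lambda_max S * bil 1%:M v v.
Proof.
move=> SA v; have symS : S^T = S by rewrite SA trmx_mul trmxK.
have SG : S = gram A^T by rewrite SA /gram trmxK.
have [l [w [le_l w0 w1 wS]]] := real_symmetric_spectral symS.
have eig a : eigenvalue S a -> exists2 u, 0 < bil 1%:M u u & bil S u u = a * bil 1%:M u u.
  move=> /eigenvalueP[u uS u0]; exists u; last by rewrite /bil uS -scalemxAl mulmx1 mxE.
  exact: bil1_gt0.
(* Comparison with [inf] and [sup] requires a bounded spectrum: 0 is a lower bound since S is a Gram
   matrix, the trace an upper bound. *)
have lb : has_lbound [set a | eigenvalue S a].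
  exists 0 => a /= /eig[u u0 uS].
  by rewrite -(pmulr_lge0 _ u0) -uS SG bil_gram_ge0.
have ub : has_ubound [set a | eigenvalue S a].
  exists (\sum_i bil S (delta_mx 0 i) (delta_mx 0 i)) => a /= /eig[u u0 uS].
  by rewrite -(ler_pM2r u0) -uS mulrC SG bil_gram_le_trace.
rewrite w1 wS !mulr_sumr; apply/andP; split; apply: ler_sum => i _; apply: ler_wpM2r => //.
  by apply: (ge_inf lb); exact: le_l.
by apply: (ub_le_sup ub); exact: le_l.
Qed.
End RealSpectral.

Section StructuralEquations.
Context {R : realType} {p : nat}.
Variables (Sigma B Omega : 'M[R]_p) (s : 'S_p).
Hypothesis Sigma_pos : positive_definite Sigma.
Hypothesis sem : sem_decomposition Sigma s B Omega.

Definition sem_residual (j : 'I_p) : 'rV[R]_p := unit_rv j - row j B^T.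

Lemma posdef_unit : Sigma \in unitmx.
Proof.
rewrite unitmxE unitfE; apply/negP => /det0P[v v0 vS].
by have := proj2 Sigma_pos v v0; rewrite vS mul0mx mxE ltxx.
Qed.

Lemma sem_residual_bil k j : bil Sigma (sem_residual k) (sem_residual j) = Omega k j.
Proof.
have [_ _ _ dec] := sem; set M := 1%:M - B in dec.
have MT : 1%:M - B^T = M^T by apply/matrixP => i l; rewrite !mxE eq_sym.
rewrite MT in dec.
have uM : M \in unitmx.
  by have := posdef_unit; rewrite -dec !unitmx_mul unitmx_inv => /andP[_]; rewrite unitmx_inv.
have resE i : sem_residual i = row i M^T.
  apply/rowP => l; rewrite /sem_residual mxE [X in _ + X]mxE unit_rvE !mxE.
  by [].
rewrite /bil !resE -row_mul tr_row trmxK -dec.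
have -> : M^T *m (invmx M^T *m Omega *m invmx M) = Omega *m invmx M.
  by rewrite !mulmxA mulmxV ?unitmx_tr// mul1mx.
by rewrite colE mulmxA -row_mul mulmxKV// -colE !mxE.
Qed.

(** Along the ordering, e_k is its own residual plus a combination of earlier e_i. Distinct
    residuals are Sigma-orthogonal as Omega is diagonal, so induction on the position of k
    applies. *)
Lemma sem_residual_orth j v : supp_in (predecessors s j) v -> bil Sigma (sem_residual j) v = 0.
Proof.
have [dO _ B0 _] := sem.
have unitE k : unit_rv k = sem_residual k + \sum_i B i k *: unit_rv i.
  rewrite /sem_residual -addrA [X in - X + _](_ : _ = \sum_i B i k *: unit_rv i) ?addNr ?addr0//.
  by rewrite [LHS]row_sum_delta; apply: eq_bigr => i _; rewrite !mxE.
have H m : forall k : 'I_p, (s^-1%g k < m)%N -> (s^-1%g k < s^-1%g j)%N ->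
    bil Sigma (sem_residual j) (unit_rv k) = 0.
  elim: m => [//|m IH] k km kj; rewrite unitE bilDr sem_residual_bil.
  have jk : j != k by apply: contraTneq kj => ->; rewrite ltnn.
  have /is_diag_mxP -> // := dO; rewrite add0r bil_sumr big1// => i _; rewrite bilZr.
  have [ki|ik] := leqP (s^-1%g k) (s^-1%g i); first by rewrite B0// mul0r.
  by rewrite IH ?mulr0//; [exact: leq_trans ik km | exact: ltn_trans ik kj].
move=> Sv; rewrite (supp_decomp Sv) bil_sumr big1// => k; rewrite inE => kj.
by rewrite bilZr (H _ k (ltnSn _) kj) mulr0.
Qed.

Lemma sem_parents j i : (i \in parents (support_graph B) j) = (B i j != 0).
Proof. by rewrite !inE. Qed.

Lemma sem_coef j i : (unit_rv j - sem_residual j) 0 i = B i j.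
Proof. by rewrite /sem_residual subKr !mxE. Qed.

Lemma sem_supp j : supp_in (parents (support_graph B) j) (unit_rv j - sem_residual j).
Proof. by move=> i; rewrite sem_parents negbK sem_coef => /eqP. Qed.

Lemma sem_parents_pred j : parents (support_graph B) j \subset predecessors s j.
Proof.
have [_ _ B0 _] := sem.
apply/fintype.subsetP => i; rewrite sem_parents inE ltnNge.
by apply: contra => ji; rewrite B0.
Qed.

Lemma sem_residual_norm j :
  bil Sigma (sem_residual j) (sem_residual j) <= bil Sigma (unit_rv j) (unit_rv j).
Proof.
have SS : Sigma^T = Sigma by case: Sigma_pos.
set v := unit_rv j - sem_residual j.
have vS : bil Sigma (sem_residual j) v = 0.
  by apply: sem_residual_orth; exact: supp_inS (sem_parents_pred j) (@sem_supp j).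
have -> : unit_rv j = sem_residual j + v by rewrite /v subrKC.
rewrite (bil_sqrD _ v)// vS mulr0 addr0 lerDl.
have [->|v0] := eqVneq v 0; first by rewrite bil0l.
exact/ltW/(proj2 Sigma_pos).
Qed.

End StructuralEquations.

(** * The conclusions *)

Section OnEvent.
Context {R : realType} {n p d dout : nat} (c1 c2 alpha gamma kappa nl nh delta0 t Cbeta tau : R)
  (Sigma A0 : 'M[R]_p) (B Omega : 'S_p -> 'M[R]_p) (X : 'M[R]_(n, p)).
Let L : R := ln p%:R.
Hypothesis n_gt0 : (0 < n)%N.
Hypothesis p_gt1 : (1 < p)%N.
Hypothesis d_gt0 : (0 < d)%N.
Hypothesis c1_gt0 : 0 < c1.
Hypothesis alpha01 : 0 < alpha < 1.
Hypothesis gamma_gt0 : 0 < gamma.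
Hypothesis kappa_bounds : 0 <= kappa <= n%:R.
Hypothesis t_gt0 : 0 < t.
Hypothesis c1_bounds : 1 <= c1 * Num.sqrt (1 + alpha / gamma) <= p%:R.
Hypothesis c2_large : (alpha + 1) * (4 * d%:R + 6) + t <= c2.
Hypothesis Sigma_pos : positive_definite Sigma.
Hypothesis SigmaA : Sigma = A0 *m A0^T.
Hypothesis sem : forall s, sem_decomposition Sigma s (B s) (Omega s).
Hypothesis delta01 : 0 < delta0 < 1.
Hypothesis nl_gt0 : 0 < nl.
Hypothesis nh_gt0 : 0 < nh.
Hypothesis lmin : nl / (1 - delta0) ^+ 2 <= lambda_min Sigma.
Hypothesis lmax : lambda_max Sigma <= nh / (1 + delta0) ^+ 2.
Hypothesis sparse : forall s : 'S_p,
  (4 * nh ^+ 2 * nl ^- 4 * (nh - nl) ^+ 2 + 1)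
    * (\max_(j < p) #|parents (support_graph (B s)) j|)%:R <= d%:R.
Hypothesis Cbeta_gt0 : 0 < Cbeta.
Hypothesis signal : forall (s : 'S_p) (i j : 'I_p), B s i j != 0 ->
  5 * (Cbeta + 4 * c2) * (nh ^+ 2 * ln p%:R / (alpha * nl ^+ 2 * n%:R)) <= `|B s i j| ^+ 2.
Hypothesis tau_gt0 : 0 < tau.
Hypothesis tau_delta : 10 * tau <= delta0.
Hypothesis tau_small : 10 * tau <= 1 / 40.
Hypothesis ev_norm : forall (S : {set 'I_p}) v, (#|S| <= 2 * d + 1)%N -> supp_in S v ->
  (1 - 10 * tau) * n%:R * bil Sigma v v <= bil (gram X) v v
  <= (1 + 10 * tau) * n%:R * bil Sigma v v.
Hypothesis ev_cross : forall k, (k = d \/ k = 2 * d)%N ->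
  forall j (S : {set 'I_p}) u v, (#|S| <= k)%N -> residual_direction Sigma j S u -> supp_in S v ->
  bil (gram X) u v ^+ 2 <=
    21 / 20 * (7 * k%:R + 10) * L * n%:R * bil Sigma u u * bil Sigma v v.

Let N_gt0 : 0 < n%:R :> R. Proof. by rewrite ltr0n. Qed.
Let L_gt0 : 0 < L. Proof. by rewrite /L ln_gt0// ltr1n. Qed.
Let a_gt0 : 0 < alpha. Proof. by case/andP: alpha01. Qed.

Let Sigma_lower v : nl * bil 1%:M v v <= (1 - delta0) ^+ 2 * bil Sigma v v.
Proof.
have c0 : 0 < (1 - delta0) ^+ 2 by case/andP: delta01 => _ h; rewrite exprn_gt0// subr_gt0.
have /andP[h _] := eigenvalue_bounds SigmaA v.
have h2 := ler_wpM2r (bil1_ge0 v) lmin.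
rewrite -(ler_pM2l (x := ((1 - delta0) ^+ 2)^-1)) ?invr_gt0// mulrA (mulrC _ nl).
by rewrite (mulrA _ _ (bil Sigma v v)) mulVf ?gt_eqF// mul1r (le_trans h2).
Qed.

Let Sigma_upper v : (1 + delta0) ^+ 2 * bil Sigma v v <= nh * bil 1%:M v v.
Proof.
have c0 : 0 < (1 + delta0) ^+ 2 by case/andP: delta01 => h _; rewrite exprn_gt0// addr_gt0.
have /andP[_ h] := eigenvalue_bounds SigmaA v.
have h2 := ler_wpM2r (bil1_ge0 v) lmax.
rewrite -(ler_pM2l (x := ((1 + delta0) ^+ 2)^-1)) ?invr_gt0// mulrA mulVf ?gt_eqF// mul1r.
by rewrite mulrA (mulrC _ nh); exact: le_trans h h2.
Qed.

Let Sigma_ge0 v : 0 <= bil Sigma v v.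
Proof. by rewrite SigmaA bil_cholesky bil1_ge0. Qed.

(** The margin delta0 between the spectrum of Sigma and the bounds [nl], [nh] absorbs the isometry
    loss 10 tau. *)
Let d1 : (1 - delta0) ^+ 2 <= 1 - 10 * tau.
Proof.
apply: (@le_trans _ _ (1 - delta0)); last by move: tau_delta; lra.
have /andP[h0 h1] := delta01; rewrite expr2 ler_piMl//; lra.
Qed.

Let d2 : 1 + 10 * tau <= (1 + delta0) ^+ 2.
Proof.
have /andP[h0 h1] := delta01.
apply: (@le_trans _ _ (1 + delta0)); first by move: tau_delta; lra.
rewrite expr2 ler_peMl//; lra.
Qed.

Let nl_le : nl <= nh.
Proof.
pose j : 'I_p := Ordinal (ltnW p_gt1).
have h1 := Sigma_lower (unit_rv j); have h2 := Sigma_upper (unit_rv j).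
rewrite unit_norm mulr1 in h1; rewrite unit_norm mulr1 in h2.
apply: le_trans h1 (le_trans _ h2); apply: ler_wpM2r => //.
by apply: le_trans d1 (le_trans _ d2); move: tau_gt0; lra.
Qed.

Let G_lower (S : {set 'I_p}) v : (#|S| <= 2 * d + 1)%N -> supp_in S v ->
  n%:R * nl * bil 1%:M v v <= bil (gram X) v v.
Proof.
move=> Sd Sv; have /andP[h _] := ev_norm Sd Sv; apply: le_trans h.
rewrite -mulrA -[leRHS]mulrA [leRHS]mulrCA; apply: ler_wpM2l; first exact: ltW.
by apply: le_trans (Sigma_lower v) _; apply: ler_wpM2r.
Qed.

Let G_upper (S : {set 'I_p}) v : (#|S| <= 2 * d + 1)%N -> supp_in S v ->
  bil (gram X) v v <= n%:R * nh * bil 1%:M v v.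
Proof.
move=> Sd Sv; have /andP[_ h] := ev_norm Sd Sv; apply: le_trans h _.
rewrite -mulrA -[leRHS]mulrA mulrCA; apply: ler_wpM2l; first exact: ltW.
by apply: le_trans (Sigma_upper v); apply: ler_wpM2r.
Qed.

Let G_Sigma (S : {set 'I_p}) v : (#|S| <= 2 * d + 1)%N -> supp_in S v ->
  (1 - 10 * tau) * n%:R * bil Sigma v v <= bil (gram X) v v.
Proof. by move=> Sd Sv; have /andP[] := ev_norm Sd Sv. Qed.

Let dl_bounds : 0 <= 10 * tau <= 1 / 40.
Proof. by rewrite tau_small andbT; move: tau_gt0; lra. Qed.

Let Pa s j := parents (support_graph (B s)) j.

Let nu_ge0 : 0 <= 4 * nh ^+ 2 * nl ^- 4 * (nh - nl) ^+ 2.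
Proof.
rewrite mulr_ge0 ?sqr_ge0// mulr_ge0 ?invr_ge0 ?exprn_ge0 ?(ltW nl_gt0)//.
by rewrite mulr_ge0 ?sqr_ge0.
Qed.

Let Pa_sparse s j : (4 * nh ^+ 2 * nl ^- 4 * (nh - nl) ^+ 2 + 1) * #|Pa s j|%:R <= d%:R.
Proof.
apply: le_trans (sparse s); apply: ler_wpM2l; first by rewrite addr_ge0.
by rewrite ler_nat (leq_bigmax j).
Qed.

Let Pa_card s j : (#|Pa s j| <= d)%N.
Proof.
rewrite -(ler_nat R); apply: le_trans (Pa_sparse s j).
by apply: ler_peMl => //; rewrite lerDr.
Qed.

Let Pa_pred s j : Pa s j \subset predecessors s j.
Proof. exact: sem_parents_pred (sem s) j. Qed.

Let bm : R := 5 * (Cbeta + 4 * c2) * (nh ^+ 2 * L / (alpha * nl ^+ 2 * n%:R)).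

(** Since alpha < 1, 2 alpha <= alpha + 1. This compares the signal condition, stated through c2,
    with the noise level 8 d + 12. *)
Let c2_ge : alpha * (8 * d%:R + 12) <= c2.
Proof.
have d0 : 0 <= d%:R :> R by [].
have : 0 <= (1 - alpha) * (4 * d%:R + 6).
  by apply: mulr_ge0; [case/andP: alpha01; lra | lra].
by move: c2_large t_gt0; lra.
Qed.

Let bmE : alpha * (n%:R * nl ^+ 2 * bm) = 5 * (Cbeta + 4 * c2) * (nh ^+ 2 * L).
Proof. by rewrite /bm; field; rewrite !gt_eqF. Qed.

Let bm_large : 20 * (c2 * nh ^+ 2 * L) <= alpha * (n%:R * nl ^+ 2 * bm).
Proof.
rewrite bmE; have : 0 <= Cbeta * (nh ^+ 2 * L).
  by apply: mulr_ge0; [exact: ltW | apply: mulr_ge0; [exact: sqr_ge0 | exact: ltW]].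
lra.
Qed.

Let bm_beta : 20 * (8 * d%:R + 12) * nh * L <= n%:R * nl * bm.
Proof.
have an : 0 < alpha * nl by rewrite mulr_gt0.
rewrite -(ler_pM2l an).
apply: (@le_trans _ _ (alpha * (n%:R * nl ^+ 2 * bm))); last first.
  by rewrite le_eqVlt; apply/orP; left; apply/eqP; ring.
apply: le_trans bm_large.
have h : 0 <= nh * L by apply: mulr_ge0; exact: ltW.
have d0 : 0 <= d%:R :> R by [].
have c20 : 0 <= c2 by apply: le_trans c2_ge; apply: mulr_ge0; [exact: ltW | lra].
have h1 := ler_wpM2r h c2_ge.
have h2 := ler_wpM2l (ltW nl_gt0) h1.
have h3 : 0 <= c2 * (nh * L) by apply: mulr_ge0.
have h4 := ler_wpM2r h3 nl_le.
lra.
Qed.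

Let psi := node_score c1 c2 alpha gamma kappa X.

Let res s j := sem_residual (B s) j.

Let res_supp s j : supp_in (Pa s j) (unit_rv j - res s j).
Proof. exact: sem_supp. Qed.

Let res_orth s j v : supp_in (predecessors s j) v -> bil Sigma (res s j) v = 0.
Proof. exact: sem_residual_orth Sigma_pos (sem s) j v. Qed.

Let res_norm s j : bil Sigma (res s j) (res s j) <= nh.
Proof.
apply: le_trans (sem_residual_norm Sigma_pos (sem s) j) _.
have := Sigma_upper (unit_rv j); rewrite unit_norm mulr1; apply: le_trans.
by apply: ler_peMl => //; apply: le_trans d2; move: tau_gt0; lra.
Qed.

Let res_coef s j i : i \in Pa s j -> bm <= (unit_rv j - res s j) 0 i ^+ 2.
Proof.
rewrite sem_coef sem_parents => /signal; rewrite real_normK ?num_real//.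
Qed.

Let rss_positive s j (S : {set 'I_p}) : S \subset predecessors s j -> (#|S| <= 2 * d)%N ->
  0 < rss X j S.
Proof.
apply: (rss_gt0 N_gt0 nl_gt0 dl_bounds Sigma_pos G_lower G_Sigma (Pa_pred s j) (@res_supp s j) (@res_orth s j)).
by rewrite inE ltnn.
Qed.

Lemma node_gain_on_event s j (S : {set 'I_p}) :
  S \in models s j d -> S != Pa s j ->
  t * L <= psi j (greedy_step d (psi j) j (Pa s j) S) - psi j S.
Proof.
rewrite inE => /andP[SA Sd] SS.
have beta_min i : i \in Pa s j ->
    20 * (8 * d%:R + 12) * nh * L <= n%:R * nl * (unit_rv j - res s j) 0 i ^+ 2.
  move=> iP; apply: le_trans bm_beta _; apply: ler_wpM2l; last exact: res_coef.
  by apply: mulr_ge0; exact: ltW.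
have beta_neq0 i : i \in Pa s j -> (unit_rv j - res s j) 0 i != 0.
  by rewrite sem_coef sem_parents.
have nn : nh != 0 by rewrite gt_eqF.
apply: (node_greedy_gain (nh := nh) N_gt0 p_gt1 c1_gt0 alpha01 gamma_gt0 kappa_bounds t_gt0 c1_bounds
  c2_large nh_gt0 (Pa_pred s j)) => //.
- move=> S' S'A S'd; apply: (rss_positive S'A); apply: leq_trans S'd _.
  by rewrite mul2n -addnn leq_add2l.
- move=> S' S'A S'd; apply: (rss_upper N_gt0 nl_gt0 G_lower G_upper); exact: leq_2d1.
- move=> S' l; exact: (rss_remove_overfit N_gt0 nl_gt0 dl_bounds (ltW L_gt0) Sigma_pos G_lower
    G_Sigma ev_cross (Pa_pred s j) (@res_supp s j) (@res_orth s j)).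
- move=> S' S'A S'd nS'.
  have [k kT Hk] := rss_add_gain N_gt0 nl_gt0 nl_le dl_bounds (ltW L_gt0) Sigma_pos G_lower
    G_upper G_Sigma ev_cross (Pa_pred s j) (Pa_card s j) (@res_supp s j) (@res_orth s j)
    (res_norm s j) beta_min beta_neq0 (@res_coef s j) S'A S'd nS'.
  exists k => //; have Hk2 := ler_wpM2l (ltW a_gt0) Hk.
  rewrite -/L -(ler_pM2l nh_gt0); move: bm_large Hk2; lra.
- move=> S' S'A S'd nS'.
  have [k [l [kT lQ Hk]]] := rss_swap_gain N_gt0 nl_gt0 nl_le dl_bounds (ltW L_gt0) Sigma_pos G_lower
    G_upper G_Sigma ev_cross (Pa_pred s j) (Pa_card s j) (@res_supp s j) (@res_orth s j)
    (res_norm s j) beta_min beta_neq0 (@res_coef s j) d_gt0 S'A S'd nS' (Pa_sparse s j).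
  exists k, l; split => //; have Hk2 := ler_wpM2l (ltW a_gt0) Hk.
  rewrite -/L -(ler_pM2l nh_gt0); move: bm_large Hk2; lra.
Qed.

Lemma node_posterior_on_event s j :
  1 - p%:R `^ (- (t - 2)) <=
  expR (psi j (Pa s j)) / \sum_(S in models s j d) expR (psi j S).
Proof.
have p0 : 0 < p%:R :> R by rewrite ltr0n ltnW.
have -> : p%:R `^ (- (t - 2)) = p%:R ^+ 2 * expR (- (t * L)) :> R.
  rewrite opprB powRD; last by apply/implyP => _; rewrite gt_eqF.
  by rewrite powR_mulrn ?(ltW p0)// /powR gt_eqF// mulNr.
have step S : S \in models s j d -> S != Pa s j ->
    expR (psi j S) <= expR (- (t * L)) * expR (psi j (greedy_step d (psi j) j (Pa s j) S)).
  move=> SM SS; have h := node_gain_on_event SM SS; rewrite -expRD ler_expR.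
  by rewrite addrC lerBrDr -lerBrDl.
exact: (greedy_posterior (expR_ge0 _) (Pa_pred s j) (Pa_card s j) step).
Qed.

Lemma graph_posterior_on_event s :
  1 - p%:R `^ (- (t - 3)) <=
  expR (graph_score c1 c2 alpha gamma kappa X (support_graph (B s))) /
  \sum_(G in sparse_dags s d dout) expR (graph_score c1 c2 alpha gamma kappa X G).
Proof.
have p0 : 0 < p%:R :> R by rewrite ltr0n ltnW.
have -> : p%:R `^ (- (t - 3)) = p%:R * p%:R `^ (- (t - 2)) :> R.
  have -> : - (t - 3) = 1 + - (t - 2) by ring.
  rewrite powRD ?powRr1 ?(ltW p0)//; by apply/implyP => _; rewrite gt_eqF.
apply: graph_posterior => j; last exact: node_posterior_on_event.
by rewrite inE Pa_pred Pa_card.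
Qed.

End OnEvent.

(** * Probability of the good event *)

Lemma sparse_count (R : realType) (p k M : nat) (L m y c z : R) :
  p%:R = expR L -> M%:R <= expR m -> k%:R * (L + m) + c <= y - z ->
  (p ^ k)%:R * ((M ^ k)%:R * (expR c * expR (- y))) <= expR (- z).
Proof.
move=> pL Mm h; rewrite -expRD.
apply: (@le_trans _ _ (expR (k%:R * L) * (expR (k%:R * m) * expR (c - y)))).
  apply: ler_pM => //; rewrite ?mulr_ge0 ?expR_ge0//.
    by rewrite natrX pL mulrC expRM_natr.
  apply: ler_pM => //; rewrite ?expR_ge0//.
  by rewrite natrX [k%:R * m]mulrC expRM_natr lerXn2r// nnegrE ?expR_ge0.
rewrite -!expRD ler_expR; lra.
Qed.

Lemma nat_above (R : realType) (x : R) : 0 <= x ->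
  exists K : nat, [/\ (0 < K)%N, x < K%:R & K%:R <= x + 1].
Proof.
move=> x0; have /andP[lx xl] := truncn_itv x0.
by exists (Num.truncn x).+1; split => //; rewrite -natr1 lerD2r.
Qed.

Section Events.
Context {R : realType} {disp : measure_display} {T : measurableType disp}
  (P : probability T R) {n p d : nat} (mu : probability (p.-tuple R) R)
  (Sigma : 'M[R]_p) (X : T -> 'M[R]_(n, p)).
Hypothesis Sigma_pos : positive_definite Sigma.
Hypothesis gauss : centered_gaussian Sigma mu.
Hypothesis rows : iid P (row_tuple X) mu.
Hypothesis n_gt0 : (0 < n)%N.
Hypothesis p_gt1 : (1 < p)%N.
Hypothesis d_bounds : (0 < d <= p)%N.
Let L : R := ln p%:R.

Let p_gt0 : 0 < p%:R :> R. Proof. by rewrite ltr0n ltnW. Qed.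
Let pL : p%:R = expR L. Proof. by rewrite lnK. Qed.
Let L_gt0 : 0 < L. Proof. by rewrite ln_gt0// ltr1n. Qed.
Let pV : p%:R^-1 = expR (- L). Proof. by rewrite expRN -pL. Qed.

(** The mesh tau / (2 k) needs at most (12 / tau + 3) p <= p^2 points per coordinate. With supports
    this costs (2 d + 1) * 3 L; adding L for the constant 2 and L for the probability 1/p gives at
    most 11 d L. *)
Lemma whp_restricted_isometry (tau : R) : 0 < tau <= 1 / 400 ->
  12 / tau + 3 <= p%:R -> 11 * (d%:R * L) <= 9 / 40 * tau ^+ 2 * n%:R ->
  whp P p%:R^-1 (fun w => forall (S : {set 'I_p}) v, (#|S| <= 2 * d + 1)%N -> supp_in S v ->
      (1 - 10 * tau) * n%:R * bil Sigma v v <= bil (gram (X w)) v v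
      <= (1 + 10 * tau) * n%:R * bil Sigma v v).
Proof.
move=> tau01 Cp dLn; have /andP[tau0 _] := tau01.
set k := (2 * d + 1)%N; have k0 : (0 < k)%N by rewrite /k addn1.
have kR : k%:R = 2 * d%:R + 1 :> R by rewrite /k natrD natrM.
have /andP[d0 dp] := d_bounds.
have d1 : 1 <= d%:R :> R by rewrite ler1n.
have dpR : d%:R <= p%:R :> R by rewrite ler_nat.
have p1 : 1 <= p%:R :> R by rewrite ler1n ltnW.
pose x := 2 * k%:R / tau; have x0 : 0 <= x by rewrite divr_ge0 ?mulr_ge0// ltW.
have [K [K0 xK Kx]] := nat_above x0.
have kK : 2 * k%:R ^+ 2 <= tau ^+ 2 * K%:R ^+ 2.
  rewrite -exprMn; apply: (@le_trans _ _ ((2 * k%:R) ^+ 2)).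
    by rewrite exprMn ler_wpM2r ?sqr_ge0//; lra.
  rewrite lerXn2r ?nnegrE ?mulr_ge0 ?(ltW tau0)//.
  by rewrite -ler_pdivrMl// mulrC ltW.
apply: whp_mono (whp_norm_sparse Sigma_pos gauss rows K0 tau01 k0 kK) => //.
rewrite pV; have -> : 2 = expR (ln 2) :> R by rewrite lnK// posrE.
have ln2L : ln 2 <= L by rewrite ler_ln ?posrE// ler_nat.
apply: (sparse_count pL (m := 2 * L)).
  have -> : expR (2 * L) = p%:R * p%:R by rewrite pL -expRD; congr expR; ring.
  apply: (@le_trans _ _ ((12 / tau + 3) * p%:R)); last by rewrite ler_wpM2r// ltW.
  rewrite natrD natrM; apply: (@le_trans _ _ (2 * (x + 1) + 1)); first lra.
  have xp : x <= 6 * (tau^-1 * p%:R).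
    rewrite /x [leRHS]mulrCA mulrC ler_wpM2l ?invr_ge0 ?(ltW tau0)// kR; lra.
  rewrite [leRHS]mulrDl -[12 / tau * _]mulrA; lra.
rewrite kR; have dL : L <= d%:R * L by rewrite ler_peMl// ltW.
have -> : n%:R * (9 / 40 * tau ^+ 2) = 9 / 40 * tau ^+ 2 * n%:R by ring.
apply: le_trans (lerB dLn (lexx L)).
have -> : (2 * d%:R + 1) * (L + 2 * L) = 6 * (d%:R * L) + 3 * L by ring.
lra.
Qed.

(** The deviation is e^2 = (7 k + 10) L / n, whose tail exponent 9/40 (7 k + 10) L is the exact
    budget. Each coordinate costs L for the vertex, L/2 for a grid of size C sqrt p and 3/40 L for
    C: 63/40 = 9/40 * 7. The fixed cost is 2 L for the choice of j and the probability 1/p, plus L/4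
    for the constant 4: 9/4 = 9/40 * 10. With accuracy 1/100 the grid has at most 200 sqrt k + 3 <=
    303 sqrt p points per coordinate, whence 3 * 101. *)
Lemma whp_residual_correlation (k : nat) (C : R) : (0 < k <= 2 * d)%N -> 3 * 101 <= C ->
  ln C <= 3 / 40 * L -> ln 4 <= 1 / 4 * L ->
  24 * (d%:R * L) <= (1 / 400) ^+ 2 * n%:R ->
  whp P p%:R^-1 (fun w => forall j (S : {set 'I_p}) u v, (#|S| <= k)%N ->
    residual_direction Sigma j S u -> supp_in S v ->
    bil (gram (X w)) u v ^+ 2 <=
      21 / 20 * (7 * k%:R + 10) * L * n%:R * bil Sigma u u * bil Sigma v v).
Proof.
move=> /andP[k0 kd] C303 lC l4 dLn.
have N0 : 0 < n%:R :> R by rewrite ltr0n.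
have C0 : 0 < C by lra.
have /andP[d0 dp] := d_bounds.
have d1 : 1 <= d%:R :> R by rewrite ler1n.
have kdR : k%:R <= 2 * d%:R :> R by rewrite -natrM ler_nat.
have kpR : k%:R <= 2 * p%:R :> R by apply: le_trans kdR _; rewrite ler_pM2l// ler_nat.
have p1 : 1 <= p%:R :> R by rewrite ler1n ltnW.
have dL : L <= d%:R * L by rewrite ler_peMl// ltW.
have kL : k%:R * L <= 2 * (d%:R * L) by rewrite mulrA ler_wpM2r// ltW.
pose y : R := (7 * k%:R + 10) * L.
have y0 : 0 <= y by rewrite mulr_ge0 ?(ltW L_gt0)// addr_ge0// mulr_ge0.
pose e := Num.sqrt (y / n%:R).
have e2 : e ^+ 2 = y / n%:R by rewrite sqr_sqrtr// divr_ge0// ltW.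
have e01 : 0 <= e <= 1 / 400.
  rewrite sqrtr_ge0/=; apply: (@le_trans _ _ (Num.sqrt ((1 / 400) ^+ 2))).
    rewrite ler_wsqrtr// ler_pdivrMr//; apply: le_trans dLn.
    rewrite /y mulrDl -mulrA; lra.
  by rewrite sqrtr_sqr ger0_norm// divr_ge0.
have eps01 : 0 < (1 / 100 : R) < 1 by apply/andP; split; lra.
pose x := 100 * Num.sqrt k%:R : R; have x0 : 0 <= x by rewrite mulr_ge0 ?sqrtr_ge0.
have [K [K0 xK Kx]] := nat_above x0.
have kK : k%:R <= (1 / 100) ^+ 2 * K%:R ^+ 2 :> R.
  rewrite -exprMn -[leLHS](@sqr_sqrtr _ k%:R)// lerXn2r ?nnegrE ?sqrtr_ge0 ?mulr_ge0//.
  by move: xK; rewrite /x; lra.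
apply: whp_mono (whp_cross_sparse Sigma_pos gauss rows K0 e01 eps01 kK).
  have -> : p%:R^-1 = p%:R * expR (- (2 * L)) :> R.
    by rewrite pV [in RHS]pL -expRD; congr expR; ring.
  rewrite natrM -mulrA ler_pM2l//; have -> : 4 = expR (ln 4) :> R by rewrite lnK// posrE.
  apply: (sparse_count pL (m := L / 2 + ln C)).
    have -> : expR (L / 2 + ln C) = C * Num.sqrt p%:R.
      rewrite expRD lnK ?posrE // mulrC; congr (_ * _).
      by rewrite -[LHS]gtr0_norm ?expR_gt0// -sqrtr_sqr -expRM_natr pL; congr (Num.sqrt (expR _)); field.
    have q1 : 1 <= Num.sqrt p%:R :> R by rewrite -[leLHS]sqrtr1 ler_wsqrtr.
    have xq : Num.sqrt k%:R <= 3 / 2 * Num.sqrt p%:R :> R.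
      rewrite -(@ger0_norm _ (3 / 2)) ?divr_ge0// -sqrtr_sqr -sqrtrM ?sqr_ge0//.
      by rewrite ler_wsqrtr//; apply: le_trans kpR _; rewrite ler_pM2r//; lra.
    have := ler_wpM2r (sqrtr_ge0 p%:R) C303.
    rewrite natrD natrM; move: Kx q1 xq; rewrite /x.
    move: (Num.sqrt p%:R) (Num.sqrt k%:R) => q s Kx q1 xq Cq.
    apply: le_trans Cq; lra.
  have -> : n%:R * (9 / 40 * e ^+ 2) = 9 / 40 * y.
    by rewrite e2; field; rewrite gt_eqF.
  rewrite /y; have := ler_wpM2l (ler0n R k) lC; lra.
move=> w H j S u v Sk ju Sv; apply: le_trans (H j S u v Sk ju Sv) _.
have -> : (n%:R * e) ^+ 2 = n%:R * y :> R.
  by rewrite exprMn e2; field; rewrite gt_eqF.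
have quu z : 0 <= bil Sigma z z.
  by have [A [_ [<- _ _]]] := gauss; rewrite bil_cholesky bil1_ge0.
have c21 : ((1 + 1 / 100) / (1 - 1 / 100)) ^+ 2 <= 21 / 20 :> R.
  by rewrite expr_div_n ler_pdivrMr ?exprn_gt0//; lra.
rewrite -!mulrA -/y.
have := ler_wpM2r (mulr_ge0 (ltW N0) (mulr_ge0 y0 (mulr_ge0 (quu u) (quu v)))) c21.
rewrite /y -!mulrA; lra.
Qed.

End Events.

Theorem theorem4 (R : realType)
  (p din dout : nat -> nat)
  (c1 c2 alpha gamma kappa nu_lo nu_hi : nat -> R)
  (delta0 t Cbeta : R)
  (Gstar : forall n, digraph (p n))
  (Sigma : forall n, 'M[R]_(p n))
  (B Omega : forall n, 'S_(p n) -> 'M[R]_(p n))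
  (mu : forall n, probability ((p n).-tuple R) R)
  (d : nat -> measure_display)
  (T : forall n, measurableType (d n))
  (P : forall n, probability (T n) R)
  (X : forall n, T n -> 'M[R]_(n, p n)) :
  p n @[n --> \oo] --> \oo ->
  (forall n, (0 < n)%N ->
    [/\ 0 < c1 n, 0 <= c2 n, 0 < alpha n < 1, 0 < gamma n & 0 <= kappa n]) ->
  (forall n, (0 < n)%N -> (0 < din n <= p n)%N /\ (0 < dout n <= p n)%N) ->
  (forall n, (0 < n)%N -> acyclic (Gstar n)) ->
  (forall n, (0 < n)%N -> positive_definite (Sigma n)) ->
  (forall n, (0 < n)%N ->
    forall s, sem_decomposition (Sigma n) s (B n s) (Omega n s)) ->
  (forall n, (0 < n)%N ->
    [/\ centered_gaussian (Sigma n) (mu n),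
        perfectly_markovian (mu n) (Gstar n)
      & iid (P n) (row_tuple (X n)) (mu n)]) ->
  (* (1) *)
  0 < delta0 < 1 ->
  (forall n, (0 < n)%N ->
    [/\ 0 < nu_lo n, 0 < nu_hi n,
        0 < nu_lo n / (1 - delta0) ^+ 2,
        nu_lo n / (1 - delta0) ^+ 2 <= lambda_min (Sigma n) <= lambda_max (Sigma n)
      & lambda_max (Sigma n) <= nu_hi n / (1 + delta0) ^+ 2]) ->
  (* (2) *)
  (fun n => (din n)%:R * ln (p n)%:R : R^o) =o_\oo (fun n => n%:R : R^o) ->
  (* (3) *)
  0 < t ->
  (forall n, (0 < n)%N ->
    [/\ kappa n <= n%:R,
        1 <= c1 n * Num.sqrt (1 + alpha n / gamma n) <= (p n)%:R
      & (alpha n + 1) * (4 * (din n)%:R + 6) + t <= c2 n]) ->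
  (* (4) *)
  (forall n, (0 < n)%N -> forall s : 'S_(p n),
    (4 * nu_hi n ^+ 2 * nu_lo n ^- 4 * (nu_hi n - nu_lo n) ^+ 2 + 1)
      * (\max_(j < p n) #|parents (support_graph (B n s)) j|)%:R
    <= (din n)%:R) ->
  (* (5) *)
  0 < Cbeta ->
  (forall n, (0 < n)%N -> forall (s : 'S_(p n)) (i j : 'I_(p n)),
    B n s i j != 0 ->
    5 * (Cbeta + 4 * c2 n)
      * (nu_hi n ^+ 2 * ln (p n)%:R / (alpha n * nu_lo n ^+ 2 * n%:R))
    <= `|B n s i j| ^+ 2) ->
  8 * t / 3 <= Cbeta ->
  \forall n \near \oo,
    exists E : set (T n),
    [/\ measurable E,
        ((1 - 3 * (p n)%:R^-1)%:E <= P n E)%E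
      & forall w, E w ->
        let psi := node_score (c1 n) (c2 n) (alpha n) (gamma n) (kappa n) (X n w) in
        let psiG := graph_score (c1 n) (c2 n) (alpha n) (gamma n) (kappa n) (X n w) in
        let Gs s := support_graph (B n s) in
        [/\ (* (i) *)
            forall (s : 'S_(p n)) (j : 'I_(p n)) (S : {set 'I_(p n)}),
              S \in models s j (din n) -> S != parents (Gs s) j ->
              t * ln (p n)%:R
              <= psi j (greedy_step (din n) (psi j) j (parents (Gs s) j) S)
                 - psi j S,
            (* (ii) *)
            2 < t -> forall (s : 'S_(p n)) (j : 'I_(p n)),
              1 - (p n)%:R `^ (- (t - 2))
              <= expR (psi j (parents (Gs s) j))
                 / \sum_(S in models s j (din n)) expR (psi j S)
          & (* (iii) *)
            3 < t -> forall s : 'S_(p n),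
              1 - (p n)%:R `^ (- (t - 3))
              <= expR (psiG (Gs s))
                 / \sum_(G in sparse_dags s (din n) (dout n)) expR (psiG G)]].
Proof.
move=> p_oo consts dbounds _ Spos sem gauss delta01 nubounds dlogp t0 c2b sparse Cb0 signal _.
have /andP[delta0_gt0 delta0_lt1] := delta01.
(* The first bound is the range of the chi-square tails and gives 10 tau <= 1/40; the second fits 10
   tau into the margin delta0. *)
pose tau : R := Num.min (1 / 400) (delta0 / 10).
have tau0 : 0 < tau by rewrite lt_min; apply/andP; split; lra.
have tau400 : tau <= 1 / 400 by rewrite ge_min lexx.
have tau_delta : 10 * tau <= delta0.
  have : tau <= delta0 / 10 by rewrite ge_min lexx orbT.
  lra.
have p_large (M : R) : \forall n \near \oo, M <= (p n)%:R.
  have : \forall n \near \oo, ((Num.truncn `|M|).+1 <= p n)%N by move/cvgnyPge: p_oo; apply.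
  apply: filterS => n; rewrite -(ler_nat R); apply: le_trans.
  by rewrite (le_trans (ler_norm _))// ltW// truncnS_gt.
have ln_large (M : R) : \forall n \near \oo, M <= ln (p n)%:R.
  apply: filterS (p_large (expR M)) => n h; rewrite -[leLHS]expRK ler_ln ?posrE ?expR_gt0//.
  exact: lt_le_trans (expR_gt0 _) h.
have dlogp_small (theta : R) : 0 < theta ->
    \forall n \near \oo, (din n)%:R * ln (p n)%:R <= theta * n%:R.
  move=> theta0; have /eqoP /(_ _ theta0) := dlogp.
  apply: filterS => n h; apply: le_trans (ler_norm _) (le_trans h _).
  by rewrite ger0_norm.
(* Serves both budgets: 11 theta <= 9/40 tau^2, and 24 theta <= tau^2 <= (1/400)^2. *)
pose theta : R := tau ^+ 2 / 100.
have theta0 : 0 < theta by rewrite divr_gt0 ?exprn_gt0.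
near=> n.
have n0 : (0 < n)%N by near: n; exact: nbhs_infty_gt.
have p1 : (1 < p n)%N by rewrite -(ler_nat R); near: n; exact: p_large.
have ptau : 12 / tau + 3 <= (p n)%:R by near: n; exact: p_large.
have lnC : ln (3 * 101) <= 3 / 40 * ln (p n)%:R :> R.
  rewrite -ler_pdivrMl//; near: n; exact: ln_large.
have ln4 : ln 4 <= 1 / 4 * ln (p n)%:R :> R.
  rewrite -ler_pdivrMl//; near: n; exact: ln_large.
have dL : (din n)%:R * ln (p n)%:R <= theta * n%:R by near: n; exact: dlogp_small.
have [c1_gt0 _ alpha01 gamma_gt0 kappa_ge0] := consts n n0.
have [d_bounds _] := dbounds n n0; have /andP[d_gt0 _] := d_bounds.
have [gaussn _ rows] := gauss n n0.
have [A0 [_ [SA _ _]]] := gaussn.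
have [nl0 nh0 _ /andP[lmin _] lmax] := nubounds n n0.
have [kappan c1b c2n] := c2b n n0.
have t400 : 0 < tau <= 1 / 400 by rewrite tau0.
have N0 : 0 <= n%:R :> R by [].
have tau2 := mulr_ge0 (sqr_ge0 tau) N0.
have dL' : (din n)%:R * ln (p n)%:R <= tau ^+ 2 * n%:R / 100 by rewrite mulrAC.
have dL1 : 11 * ((din n)%:R * ln (p n)%:R) <= 9 / 40 * tau ^+ 2 * n%:R.
  rewrite -mulrA; move: tau2 dL'.
  by move: (_ * ln _) (_ * n%:R) => x y; clear; lra.
have dL2 : 24 * ((din n)%:R * ln (p n)%:R) <= (1 / 400) ^+ 2 * n%:R :> R.
  have h : tau ^+ 2 * n%:R <= (1 / 400) ^+ 2 * n%:R.
    apply: (ler_wpM2r N0); rewrite !expr2.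
    exact: (ler_pM (ltW tau0) (ltW tau0) tau400 tau400).
  apply: le_trans h; move: tau2 dL'.
  by move: (_ * ln _) (_ * n%:R) => x y; clear; lra.
have kd1 : (0 < din n <= 2 * din n)%N by rewrite d_gt0 leq_pmull.
have kd2 : (0 < 2 * din n <= 2 * din n)%N by rewrite muln_gt0 d_gt0 leqnn.
have C303 : 3 * 101 <= 3 * 101 :> R by [].
have W1 := whp_restricted_isometry (Spos n n0) gaussn rows p1 d_bounds t400 ptau dL1.
have W2 := whp_residual_correlation (Spos n n0) gaussn rows n0 p1 d_bounds kd1 C303 lnC ln4 dL2.
have W3 := whp_residual_correlation (Spos n n0) gaussn rows n0 p1 d_bounds kd2 C303 lnC ln4 dL2.
(* Each of the three events, the isometry and the correlations at d and at 2 d, fails with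
   probability at most 1/p. *)
have [E [mE PE EQ]] := whp_and W1 (whp_and W2 W3).
exists E; split => //.
  rewrite -[E]setCK probability_setC; last exact: measurableC.
  rewrite EFinB leeB//; apply: le_trans PE _; rewrite lee_fin; lra.
move=> w /EQ[ev1 [ev2 ev3]].
have ev_cross k : (k = din n \/ k = 2 * din n)%N ->
    forall j (S : {set 'I_(p n)}) u v, (#|S| <= k)%N ->
    residual_direction (Sigma n) j S u -> supp_in S v ->
    bil (gram (X n w)) u v ^+ 2 <= 21 / 20 * (7 * k%:R + 10) * ln (p n)%:R * n%:R
      * bil (Sigma n) u u * bil (Sigma n) v v.
  by case=> ->; assumption.
have tau40 : 10 * tau <= 1 / 40 by move: tau400; clear; lra.
have kb : 0 <= kappa n <= n%:R by rewrite kappa_ge0.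
split => [s j S|_ s j|_ s].
- exact: (node_gain_on_event n0 p1 d_gt0 c1_gt0 alpha01 gamma_gt0 kb t0 c1b c2n (Spos n n0)
    (esym SA) (sem n n0) delta01 nl0 nh0 lmin lmax (sparse n n0) Cb0 (signal n n0) tau0
    tau_delta tau40 ev1 ev_cross).
- exact: (node_posterior_on_event n0 p1 d_gt0 c1_gt0 alpha01 gamma_gt0 kb t0 c1b c2n (Spos n n0)
    (esym SA) (sem n n0) delta01 nl0 nh0 lmin lmax (sparse n n0) Cb0 (signal n n0) tau0
    tau_delta tau40 ev1 ev_cross).
- exact: (graph_posterior_on_event n0 p1 d_gt0 c1_gt0 alpha01 gamma_gt0 kb t0 c1b c2n (Spos n n0)
    (esym SA) (sem n n0) delta01 nl0 nh0 lmin lmax (sparse n n0) Cb0 (signal n n0) tau0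
    tau_delta tau40 ev1 ev_cross).
Unshelve. all: by end_near.
Qed.
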